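(* Fix $T>0$. Then, under Dirichlet (D) or Neumann (N) boundary condition, there exist constants $C_1,C_2\in(0,\infty)$ such that $$C_1\,M\le\mathrm{Var}\big(w(t,x)\mid w(t_1,x_1),\dots,w(t_m,x_m)\big)\le C_2\,M,\qquad M:=\min\Big\{\min_{1\le j\le m}\rho^2((t,x),(t_j,x_j)),\ \sqrt t,\ f_1(x)\Big\},$$ for all $m\in\{1,2,\dots\}$ and all $(t,x),(t_1,x_1),\dots,(t_m,x_m)\in[0,T]\times[0,L]$ (the constants $C_1,C_2$ do not depend on $m$ nor on these points). Here $f_1$ is the principal eigenfunction under the respective boundary condition: $f_1(x)=\sqrt{2/L}\,\sin(\pi x/L)$ under (D) and $f_1(x)=\sqrt{1/L}$ under (N).
   Context: Fix $L>0$ and let $\xi$ be a space-time white noise on $[0,\infty)\times[0,L]$. Boundary conditions on $[0,L]$: (D) $w=0$ at $x=0$ and $x=L$; (N) $\partial_xw=0$ at $x=0$ and $x=L$. Let $\{(\lambda_n,f_n)\}_{n\ge1}$ be the eigenpairs of $-\frac12\partial_x^2$ on $(0,L)$ with the chosen boundary condition ($\lambda_1\le\lambda_2\le\cdots$, $\{f_n\}$ orthonormal in $L^2([0,L])$), and $G_t(x,y)=\sum_{n\ge1}e^{-\lambda_nt}f_n(x)f_n(y)$ the heat kernel. The centered Gaussian random field $w$ is the mild solution of $\partial_tw=\frac12\partial_x^2w+\xi$, $w(0,\cdot)=0$, i.e. $w(t,x)=\int_{(0,t)\times[0,L]}G_{t-s}(x,y)\,\xi(ds\,dy)$ for $t>0$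 and $w(0,x)=0$. The parabolic metric is $\rho((t,x),(s,y))=\max\{|t-s|^{1/4},|x-y|^{1/2}\}$. *)

(* Defs.v *)
From HB Require Import structures.
From mathcomp Require Import all_boot all_order all_algebra.
From mathcomp Require Import all_classical all_reals all_analysis.

Set Implicit Arguments.
Unset Strict Implicit.
Unset Printing Implicit Defensive.

Import Order.TTheory GRing.Theory Num.Theory.
Import numFieldNormedType.Exports.

Local Open Scope classical_set_scope.
Local Open Scope ring_scope.

Section eigenpairs.
Context {R : realType}.
Implicit Types (L mu t x y : R) (phi : R -> R) (lam : nat -> R)
  (f : nat -> R -> R).

Local Notation leb := (@lebesgue_measure R).

Inductive boundary_condition := Dirichlet | Neumann.

(* [- phi'' / 2 = mu phi] on ]0, L[ with boundary condition [bc]. [phi] is only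
   meaningful on [0, L]; [dphi] is its derivative, extended continuously to the
   end points, so that the Neumann condition is about one-sided derivatives.
   [phi] may be zero. *)
Definition eigen_equation L (bc : boundary_condition) mu phi :=
  exists dphi : R -> R,
  [/\ {within `[0, L], continuous phi},
      {within `[0, L], continuous dphi},
      forall x, x \in `]0, L[ -> is_derive x 1 phi (dphi x),
      forall x, x \in `]0, L[ ->
        derivable dphi x 1 /\ - (2^-1 * derive1 dphi x) = mu * phi x &
      match bc with
      | Dirichlet => phi 0 = 0 /\ phi L = 0
      | Neumann => dphi 0 = 0 /\ dphi L = 0
      end].

(* The sequences are indexed from 0: [lam n] and [f n] are the (n+1)-st
   eigenvalue and eigenfunction. The last clause says that the orthonormal
   system [f] exhausts the eigenfunctions. *)
Definition eigenpairs L (bc : boundary_condition) lam f :=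
  [/\ forall n, eigen_equation L bc (lam n) (f n),
      {homo lam : n m / (n <= m)%N >-> n <= m},
      forall n m, \int[leb]_(x in `[0, L]) (f n x * f m x) = (n == m)%:R &
      forall mu phi, eigen_equation L bc mu phi ->
        (forall n, \int[leb]_(x in `[0, L]) (phi x * f n x) = 0) ->
        forall x, x \in `[0, L] -> phi x = 0].

Definition principal_eigenfunction L (bc : boundary_condition) x : R :=
  match bc with
  | Dirichlet => Num.sqrt (2 / L) * sin (pi * x / L)
  | Neumann => Num.sqrt (1 / L)
  end.

Definition heat_kernel lam f t x y : R :=
  limn (series (fun n => expR (- lam n * t) * f n x * f n y)).

End eigenpairs.

Section white_noise.
Context {R : realType}.

(* [measurableTypeR R] is [R] with the Borel sigma-algebra in the form over
   which [lebesgue_measure] is declared in the library. *)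
Local Notation plane := (measurableTypeR R * measurableTypeR R)%type.

Definition plane_measure : set plane -> \bar R :=
  (@lebesgue_measure R \x @lebesgue_measure R)%E.

Definition space_time (L : R) : set (R * R) := `[0, +oo[ `*` `[0, L].

Definition square_integrable (D : set plane) (h : plane -> R) :=
  measurable_fun D h /\
  plane_measure.-integrable D (fun z => (h z ^+ 2)%:E).

Context d (Omega : measurableType d) (P : probability Omega R).

(* The degenerate law is singled out because [normal_prob 0 0] is not a point
   mass in the library. *)
Definition centered_gaussian (X : Omega -> R) :=
  exists2 s : R, 0 <= s &
    forall B : set R, measurable B ->
      P (X @^-1` B) = if s == 0 then \d_(0 : R) B else normal_prob 0 s B.

(* White noise as the isonormal Gaussian process over
   L^2([0, oo[ x [0, L], dt dx): [xi h] is the Wiener integral of [h] with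
   respect to the noise, and [xi] of the indicator of a set of finite measure
   is the noise of that set. *)
Definition white_noise (L : R) (xi : (R * R -> R) -> {RV P >-> R}) :=
  (forall n (h : 'I_n -> R * R -> R) (a : 'I_n -> R),
     (forall i, square_integrable (space_time L) (h i)) ->
     centered_gaussian (fun om => \sum_(i < n) a i * xi (h i) om)) /\
  (forall h g, square_integrable (space_time L) h ->
     square_integrable (space_time L) g ->
     ('E_P[fun om => (xi h om * xi g om)%R] =
       \int[plane_measure]_(z in space_time L) (h z * g z)%:E)%E).

(* (s, y) |-> 1_{]0, t[ x [0, L]}(s, y) G_{t - s}(x, y) *)
Definition mild_kernel (L : R) (lam : nat -> R) (f : nat -> R -> R)
    (t x : R) : R * R -> R :=
  (fun z => heat_kernel lam f (t - z.1) x z.2) \_ (`]0, t[ `*` `[0, L]).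

Definition mild_solution (L : R) (lam : nat -> R) (f : nat -> R -> R)
    (xi : (R * R -> R) -> {RV P >-> R}) (w : R -> R -> {RV P >-> R}) :=
  forall x, x \in `[0, L] ->
    {ae P, forall om, w 0 x om = 0} /\
    forall t, 0 < t -> {ae P, forall om, w t x om = xi (mild_kernel L lam f t x) om}.

End white_noise.

Section conditional_variance.
Context {R : realType} d (Omega : measurableType d) (P : probability Omega R).

Definition is_conditional_expectation (F : set (set Omega))
    (X Z : Omega -> R) :=
  [/\ forall B : set R, measurable B -> F (Z @^-1` B),
      P.-integrable setT (EFin \o Z) &
      forall A, F A ->
        (\int[P]_(om in A) (Z om)%:E = \int[P]_(om in A) (X om)%:E)%E].

(* A chosen version. One exists for an integrable [X] and a sub-sigma-algebra
   [F], so the default value is not used in that case. *)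
Definition conditional_expectation (F : set (set Omega)) (X : Omega -> R) :
    Omega -> R :=
  xget (cst 0) [set Z | is_conditional_expectation F X Z].

Definition conditional_variance m (X : Omega -> R) (Y : 'I_m -> Omega -> R) :
    Omega -> R :=
  let F := g_sigma_preimage Y in
  conditional_expectation F
    (fun om => (X om - conditional_expectation F X om) ^+ 2).

End conditional_variance.

Definition parabolic_dist {R : realType} (p q : R * R) : R :=
  Num.max (`|p.1 - q.1| `^ 4^-1) (`|p.2 - q.2| `^ 2^-1).

(* The neutral element of the iterated minimum is itself one of the terms of
   the minimum. *)
Definition min_quantity {R : realType} (L : R) (bc : boundary_condition)
    m (p : R * R) (q : 'I_m -> R * R) : R :=
  \big[Num.min/Num.min (Num.sqrt p.1) (principal_eigenfunction L bc p.2)]_(j < m)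
    parabolic_dist p (q j) ^+ 2.

(* Main.v *)
Require Import Defs.
From HB Require Import structures.
From mathcomp Require Import all_boot all_order all_algebra.
From mathcomp Require Import all_classical all_reals all_analysis.
From mathcomp Require Import measurable_realfun.
From mathcomp Require Import ring lra.

Set Implicit Arguments.
Unset Strict Implicit.
Unset Printing Implicit Defensive.

Import Order.TTheory GRing.Theory Num.Theory.
Import numFieldNormedType.Exports.

Local Open Scope classical_set_scope.
Local Open Scope ring_scope.

(** Since the noise is an isometry from L^2 of space-time into L^2 of the
    probability space, the field [w t x] is represented by the mild kernel
    [K t x], and the family of all these variables is jointly Gaussian. For
    Gaussian variables the residual of the orthogonal projection of [X] on
    [Y_1, ..., Y_m] is independent of the [Y_j], so the conditional variance is
    almost surely the constant squared norm of this residual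
    ([gaussian_conditional_variance]). The theorem thus compares the squared
    distance of [K t x] to the span of the [K t_j x_j] with the minimum [M].

    Upper bound ([kernel_upper_bound]). The distance to the span is at most the
    distance to [0] and to each [K t_j x_j]. The Fourier expansion of the kernel
    bounds the squared norm of an increment by a multiple of
    [sqrt |t - s| + |x - y|] ([mild_kernel_increment]): the [n]-th mode contributes
    at most a multiple of [min (n ^- 2, |t - s|)], respectively of
    [min (n ^- 2, |x - y| ^+ 2)].
    Comparing [(t, x)] with [(t_j, x_j)], with [(0, x)], and with [(t, 0)] and
    [(t, L)] where the Dirichlet field vanishes, one gets the three terms of [M].

    Lower bound ([kernel_lower_bound]). The kernel inverts the heat operator: for a
    smooth function [u] vanishing at time [0] and satisfying the boundary condition,
    the function [h] = [d_t u - 1/2 d_xx u] has inner product [u (s, y)] with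
    [K s y] ([dot_heat_operator]). Take for [u] a bump on the parabolic ball of
    radius [eps], a small multiple of [M], around [(t, x)]. By the definition of
    [M] it vanishes at all [(t_j, x_j)], so [h] is orthogonal to the span, while
    its inner product with [K t x] is at least [1]. As the squared norm of [h] is of
    order [eps ^- 1], the Cauchy-Schwarz inequality gives a squared distance of
    order at least [eps] ([residual_lower_bound]). Images of the bump under
    reflections at the end points adapt it to the boundary condition.

    The identity [dot_heat_operator] is first known for truncated Fourier series.
    In the limit it requires that a continuous function orthogonal to all
    eigenfunctions vanishes ([eigenfunctions_complete]), and this as well as the
    Gaussian conditioning rest on the same principle: the bounded multipliers of a
    space of functions with vanishing integrals against given weights form an
    algebra closed under bounded limits ([multiplier_algebra]), which therefore
    contains the indicators of all the sets that its elements determine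
    ([sigma_algebra_indic]). The eigenfunctions themselves are sines or cosines, as
    the eigenvalue equation shows ([eigenbasis_form]). *)

(** * Algebras of functions closed under bounded limits *)

Lemma cvg_seq_norm_le {R : realType} (u : nat -> R) (l M : R) :
  u @ \oo --> l -> (forall n, `|u n| <= M) -> `|l| <= M.
Proof.
by move=> ul uM; apply: (cvgr_to_le (cvg_norm ul)); apply: nearW.
Qed.

Lemma Rdominated_convergence {R : realType} d (T : measurableType d)
    (mu : {measure set T -> \bar R}) (D : set T) (f_ : nat -> T -> R)
    (f g : T -> R) :
  measurable D -> (forall n, measurable_fun D (f_ n)) ->
  (forall x, D x -> f_ ^~ x @ \oo --> f x) ->
  mu.-integrable D (EFin \o g) ->
  (forall n x, D x -> `|f_ n x| <= g x) ->
  mu.-integrable D (EFin \o f) /\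
  \int[mu]_(x in D) f_ n x @[n --> \oo] --> \int[mu]_(x in D) f x.
Proof.
move=> mD mf_ ff ig fg.
have [|||||intf _ h] := @dominated_convergence _ _ _ mu D mD
  (fun n x => (f_ n x)%:E) (fun x => (f x)%:E) (EFin \o g).
- by move=> n; exact/measurable_EFinP.
- by apply/measurable_EFinP; exact: measurable_fun_cvg mf_ ff.
- by apply: aeW => x Dx; apply: cvg_EFin; [exact: nearW|exact: ff].
- by [].
- by apply: aeW => x n Dx; rewrite lee_fin fg.
split=> //.
by apply: fine_cvg; rewrite fineK//; exact: integrable_fin_num.
Qed.

Section bounded_limit_algebra.
Context {R : realType} {T : Type}.
Implicit Types (A : set (T -> R)) (f g : T -> R).

Record bounded_limit_algebra A : Prop := BoundedLimitAlgebra {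
  algebra_cst : forall c : R, A (cst c);
  algebraD : forall f g, A f -> A g -> A (f \+ g);
  algebraM : forall f g, A f -> A g -> A (f \* g);
  algebra_lim : forall (f_ : nat -> T -> R) f (M : R), (forall n, A (f_ n)) ->
    (forall n x, `|f_ n x| <= M) -> (forall x, f_ ^~ x @ \oo --> f x) -> A f }.

(** An odd cubic with fixed points [-1], [0], [1], of which only [0] is
    repelling: its iterates converge to the sign, so that the sign of a bounded
    function is a bounded limit of polynomials in this function. *)
Definition sg_step (z : R) : R := (3 * z - z ^+ 3) / 2.

Lemma sg_step_opp z : sg_step (- z) = - sg_step z.
Proof. by rewrite /sg_step; field. Qed.

Lemma iter_sg_step_opp n z : iter n sg_step (- z) = - iter n sg_step z.
Proof. by elim: n => //= n ->; rewrite sg_step_opp. Qed.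

Lemma sg_step_norm z : `|z| <= 1 -> `|sg_step z| <= 1.
Proof.
rewrite !ler_norml => /andP[h1 h2].
have -> : sg_step z = (1 + z) ^+ 2 * (2 - z) / 2 - 1 by rewrite /sg_step; field.
apply/andP; split.
  by rewrite lerBrDr addNr divr_ge0 ?mulr_ge0 ?sqr_ge0//; lra.
have -> : (1 + z) ^+ 2 * (2 - z) / 2 - 1 = 1 - (1 - z) ^+ 2 * (2 + z) / 2 by field.
by rewrite lerBlDr lerDl divr_ge0 ?mulr_ge0 ?sqr_ge0//; lra.
Qed.

Lemma iter_sg_step_norm n z : `|z| <= 1 -> `|iter n sg_step z| <= 1.
Proof. by move=> z1; elim: n => //= n ih; exact: sg_step_norm. Qed.

Lemma cvg_iter_sg_step_gt0 z : 0 < z -> z <= 1 ->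
  iter n sg_step z @[n --> \oo] --> (1 : R).
Proof.
move=> z0 z1; pose q : R := (1 - z) * (2 + z) / 2.
have q0 : 0 <= q by rewrite /q; nra.
have q1 : q < 1 by rewrite /q; nra.
have bnd n : z <= iter n sg_step z <= 1 /\ 1 - iter n sg_step z <= q ^+ n.
  elim: n => [|n [/andP[ih1 ih2] ih3]] /=.
    by rewrite lexx z1 expr0; split => //; lra.
  set y := iter n sg_step z in ih1 ih2 ih3 *.
  have y1 : sg_step y <= 1.
    have /sg_step_norm : `|y| <= 1 by rewrite ler_norml; apply/andP; split; lra.
    by rewrite ler_norml => /andP[].
  have yz : z <= sg_step y.
    by apply: (le_trans ih1); rewrite /sg_step; nra.
  split; first by rewrite yz y1.
  have -> : 1 - sg_step y = (1 - y) * ((1 - y) * (2 + y) / 2) by rewrite /sg_step; field.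
  rewrite exprSr; apply: ler_pM => //; first lra.
    by rewrite divr_ge0// mulr_ge0//; lra.
  by rewrite /q; nra.
apply/cvgrPdist_le => e e0.
have /cvgrPdist_le/(_ _ e0) : (q ^+ n) @[n --> \oo] --> (0 : R).
  by apply: cvg_expr; rewrite ger0_norm.
apply: filterS => n; rewrite sub0r normrN ger0_norm ?exprn_ge0// => qn.
have [/andP[_ h1] h2] := bnd n.
by rewrite ger0_norm ?subr_ge0// (le_trans h2).
Qed.

Lemma cvg_iter_sg_step z : `|z| <= 1 ->
  iter n sg_step z @[n --> \oo] --> Num.sg z.
Proof.
rewrite ler_norml => /andP[zN1 z1]; have [z0|z0|->] := ltgtP z 0.
- rewrite ltr0_sg// -[z]opprK.
  under eq_fun do rewrite iter_sg_step_opp.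
  by apply: cvgN; apply: cvg_iter_sg_step_gt0; lra.
- by rewrite gtr0_sg//; exact: cvg_iter_sg_step_gt0.
- rewrite sgr0 (_ : (fun n => _) = cst 0); first exact: cvg_cst.
  by apply/funext; elim => //= n ->; rewrite /sg_step; field.
Qed.

Section closure.
Variables (A : set (T -> R)) (hA : bounded_limit_algebra A).

Lemma algebraZ c f : A f -> A (fun x => c * f x).
Proof. by move=> Af; exact: (algebraM hA (algebra_cst hA c)). Qed.

Lemma algebra_sg f : A f -> (forall x, `|f x| <= 1) -> A (fun x => Num.sg (f x)).
Proof.
move=> Af f1.
apply: (algebra_lim hA (f_ := fun n x => iter n sg_step (f x)) (M := 1)).
- elim => [//|n ih] /=.
  have -> : (fun x => sg_step (iter n sg_step (f x))) =
      (fun x => (3 / 2) * iter n sg_step (f x)) \+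
      (fun x => (- 2^-1) * (iter n sg_step (f x) *
        (iter n sg_step (f x) * iter n sg_step (f x)))).
    by apply/funext => x /=; rewrite /sg_step; field.
  apply: (algebraD hA); first exact: algebraZ.
  by apply: algebraZ; apply: (algebraM hA) => //; exact: (algebraM hA).
- by move=> n x; exact: iter_sg_step_norm.
- by move=> x; exact: cvg_iter_sg_step.
Qed.

Lemma algebra_indic_positive f : A f -> (forall x, `|f x| <= 1) ->
  A (\1_[set x | 0 < f x]).
Proof.
move=> Af f1; have As := algebra_sg Af f1.
have -> : \1_[set x | 0 < f x] = (fun x => 2^-1 * (Num.sg (f x) * Num.sg (f x)))
   \+ (fun x => 2^-1 * Num.sg (f x)).
  apply/funext => x /=; rewrite indicE; have [h|h|h] := ltgtP (f x) 0.
  - by rewrite memNset ?ltr0_sg//=; [field|move=> /=; lra].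
  - by rewrite mem_set ?gtr0_sg//=; field.
  - by rewrite memNset ?h ?sgr0 ?mulr0 ?addr0//= h ltxx.
by apply: (algebraD hA); apply: algebraZ => //; exact: (algebraM hA).
Qed.

(** The sets whose indicator lies in the algebra form a sigma-algebra: products
    of indicators give intersections, bounded limits give countable unions. *)
Lemma sigma_algebra_indic : sigma_algebra setT [set B : set T | A \1_B].
Proof.
have Acompl B : A \1_B -> A \1_(~` B).
  move=> AB; have -> : \1_(~` B) = (cst 1) \+ (fun x => (- 1) * \1_B x) :> (T -> R).
    apply/funext => x /=; rewrite !indicE in_setC.
    by case: (x \in B) => /=; ring.
  by apply: (algebraD hA); [exact: (algebra_cst hA)|exact: algebraZ].
split => /=.
- by rewrite indic0; exact: (algebra_cst hA 0).
- by move=> B AB; rewrite setTD; exact: Acompl.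
- move=> F AF; pose G n : set T := ~` \bigcap_(i < n) ~` F i.
  (* [G n] is the union of the first [n] sets, in a form made of intersections
     and complements only. *)
  apply: (algebra_lim hA (f_ := fun n => \1_(G n)) (M := 1)).
  + move=> n; apply: (Acompl); rewrite bigcap_mkord.
    elim: n => [|n ih]; first by rewrite big_ord0 indicT; exact: (algebra_cst hA 1).
    rewrite big_ord_recr/= indicI.
    by apply: (algebraM hA) => //; exact: Acompl.
  + by move=> n x; rewrite indicE; case: (_ \in _); rewrite /= ?normr1 ?normr0.
  + move=> x; rewrite indicE; have [|xF] := boolP (x \in _).
      rewrite inE => -[i _ Fix].
      apply: cvg_near_cst; near=> n; rewrite indicE mem_set// /G /= => h.
      by apply: (h i) => //=; near: n; exists i.+1.
    apply: cvg_near_cst; near=> n; rewrite indicE memNset// /G /= => h.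
    move: xF; rewrite notin_setE => xF; apply: h => i _ /= Fi.
    by apply: xF; exists i.
Unshelve. all: by end_near. Qed.

End closure.
End bounded_limit_algebra.

Section integral_annihilator.
Context {R : realType} d (T : measurableType d) (mu : {measure set T -> \bar R}).
Variables (I : Type) (W : I -> T -> R).
Hypothesis intW : forall i, mu.-integrable setT (EFin \o W i).

Definition bounded_measurable (f : T -> R) :=
  measurable_fun setT f /\ exists M, forall x, `|f x| <= M.

Definition annihilator : set (T -> R) :=
  [set f | bounded_measurable f /\ forall i, \int[mu]_x (f x * W i x) = 0].

(** The multipliers of an annihilator; they form an algebra because
    multiplications can be composed, and the limits are taken by dominated
    convergence. *)
Definition multiplier : set (T -> R) :=
  [set g | bounded_measurable g /\
    forall f, annihilator f -> annihilator (f \* g)].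

Lemma bounded_measurable_integrable f g : bounded_measurable f ->
  mu.-integrable setT (EFin \o g) -> mu.-integrable setT (EFin \o (f \* g)).
Proof.
move=> [mf [M fM]] ig.
have := integrableMr measurableT mf _ ig; apply.
exists M; split; first exact: num_real.
by move=> x Mx y _ /=; rewrite (le_trans (fM y))// ltW.
Qed.

Lemma bounded_measurableM f g :
  bounded_measurable f -> bounded_measurable g -> bounded_measurable (f \* g).
Proof.
move=> [mf [M fM]] [mg [N gN]]; split; first exact: measurable_funM.
by exists (M * N) => x; rewrite normrM ler_pM.
Qed.

Lemma bounded_measurableD f g :
  bounded_measurable f -> bounded_measurable g -> bounded_measurable (f \+ g).
Proof.
move=> [mf [M fM]] [mg [N gN]]; split; first exact: measurable_funD.
by exists (M + N) => x; rewrite (le_trans (ler_normD _ _))// lerD.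
Qed.

Lemma bounded_measurable_cst c : bounded_measurable (cst c).
Proof. by split => //; exists `|c|. Qed.

Lemma annihilatorD f g : annihilator f -> annihilator g -> annihilator (f \+ g).
Proof.
move=> [bf f0] [bg g0]; split; first exact: bounded_measurableD.
move=> i; under eq_Rintegral do rewrite mulrDl.
by rewrite RintegralD ?f0 ?g0 ?addr0//; exact: bounded_measurable_integrable.
Qed.

Lemma annihilatorZ c f : annihilator f -> annihilator (fun x => c * f x).
Proof.
move=> [bf f0]; split.
  exact: bounded_measurableM (bounded_measurable_cst c) bf.
move=> i; under eq_Rintegral do rewrite -mulrA.
by rewrite RintegralZl ?f0 ?mulr0//; exact: bounded_measurable_integrable.
Qed.

Lemma annihilator_lim (f_ : nat -> T -> R) f (M : R) : (forall n, annihilator (f_ n)) ->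
  (forall n x, `|f_ n x| <= M) -> (forall x, f_ ^~ x @ \oo --> f x) ->
  annihilator f.
Proof.
move=> Af fM ff.
have mf : measurable_fun setT f.
  apply: (@measurable_fun_cvg _ _ _ setT (fun n => f_ n)) => //.
  - by move=> n; have [[]] := Af n.
have fM' x : `|f x| <= M.
  by apply: cvg_seq_norm_le (ff x) _.
have bf : bounded_measurable f by split => //; exists M.
split => // i.
have mW : measurable_fun setT (W i).
  by have /measurable_int/measurable_EFinP := intW i.
have [||||_] := @Rdominated_convergence _ _ _ mu setT
  (fun n x => f_ n x * W i x) (fun x => f x * W i x)
  (fun x => M * `|W i x|) measurableT.
- by move=> n; apply: measurable_funM => //; have [[]] := Af n.
- by move=> x _; apply: cvgM; [exact: ff|exact: cvg_cst].
- have := integrableZl measurableT M (integrable_abse (intW i)).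
  by apply: eq_integrable => // x _; rewrite /= EFinM.
- by move=> n x _; rewrite normrM ler_wpM2r.
rewrite (_ : (fun n => _) = cst 0).
  by move=> h; exact: (cvg_unique (@Rhausdorff R) h (cvg_cst 0)).
by apply/funext => n; have [_] := Af n; apply.
Qed.

Lemma multiplier_algebra : bounded_limit_algebra multiplier.
Proof.
split.
- move=> c; split; first exact: bounded_measurable_cst.
  move=> f /(annihilatorZ c); congr annihilator.
  by apply/funext => x /=; rewrite mulrC.
- move=> f g [bf Af] [bg Ag]; split; first exact: bounded_measurableD.
  move=> h Ah; have := annihilatorD (Af _ Ah) (Ag _ Ah); congr annihilator.
  by apply/funext => x /=; rewrite mulrDr.
- move=> f g [bf Af] [bg Ag]; split; first exact: bounded_measurableM.
  by move=> h Ah; have := Ag _ (Af _ Ah); congr annihilator; apply/funext => x /=; rewrite mulrA.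
- move=> f_ f M mf fM ff.
  split.
    split; last first.
      by exists M => x; apply: cvg_seq_norm_le (ff x) _.
    apply: (@measurable_fun_cvg _ _ _ setT (fun n => f_ n)) => //.
    by move=> n; have [[]] := mf n.
  move=> g Ag; have [[_ [N gN]] _] := Ag.
  apply: (@annihilator_lim (fun n => g \* f_ n) _ (N * M)).
  + by move=> n; have [_] := mf n; exact.
  + by move=> n x; rewrite normrM ler_pM.
  + by move=> x; apply: cvgM; [exact: cvg_cst|exact: ff].
Qed.

End integral_annihilator.

(** * Derivatives, continuity and square-integrable functions *)

Section real_derivatives.
Context {R : realType}.
Implicit Types (f g : R -> R) (x a b k : R).

Lemma derive_to f x a b : is_derive x (1 : R) f a -> a = b -> is_derive x (1 : R) f b.
Proof. by move=> ? <-. Qed.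

Lemma derive_add f g x a b : is_derive x (1 : R) f a -> is_derive x (1 : R) g b ->
  is_derive x (1 : R) (fun y => f y + g y) (a + b).
Proof. by move=> ? ?; exact: is_deriveD. Qed.

Lemma derive_sub f g x a b : is_derive x (1 : R) f a -> is_derive x (1 : R) g b ->
  is_derive x (1 : R) (fun y => f y - g y) (a - b).
Proof. by move=> ? ?; exact: is_deriveB. Qed.

Lemma derive_opp f x a : is_derive x (1 : R) f a ->
  is_derive x (1 : R) (fun y => - f y) (- a).
Proof. by move=> ?; exact: is_deriveN. Qed.

Lemma derive_mul f g x a b : is_derive x (1 : R) f a -> is_derive x (1 : R) g b ->
  is_derive x (1 : R) (fun y => f y * g y) (a * g x + f x * b).
Proof.
move=> ? ?; apply: (derive_to (is_deriveM _ _)).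
by rewrite /GRing.scale/= addrC [a * _]mulrC.
Qed.

Lemma derive_const k x : is_derive x (1 : R) (fun=> k) 0.
Proof. exact: is_derive_cst. Qed.

Lemma derive_idfun x : is_derive x (1 : R) (fun y => y) 1.
Proof. exact: is_derive_id. Qed.

Lemma derive_scale k f x a : is_derive x (1 : R) f a ->
  is_derive x (1 : R) (fun y => k * f y) (k * a).
Proof.
move=> h; apply: (derive_to (derive_mul (derive_const k x) h)).
by rewrite mul0r add0r.
Qed.

Lemma derive_pow n f x a : is_derive x (1 : R) f a ->
  is_derive x (1 : R) (fun y => f y ^+ n.+1) (n.+1%:R * f x ^+ n * a).
Proof.
elim: n => [|n ih] h.
  by under eq_fun do rewrite expr1; rewrite expr0 !mul1r.
under eq_fun do rewrite exprS.
apply: (derive_to (derive_mul h (ih h))); rewrite (exprS _ n); ring.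
Qed.

Lemma derive_exp f x a : is_derive x (1 : R) f a ->
  is_derive x (1 : R) (fun y => expR (f y)) (a * expR (f x)).
Proof.
move=> h; apply: (derive_to (@is_derive1_comp _ expR f x _ _ (is_derive_expR _) h)).
by rewrite mulrC.
Qed.

Lemma derive_sine f x a : is_derive x (1 : R) f a ->
  is_derive x (1 : R) (fun y => sin (f y)) (a * cos (f x)).
Proof.
move=> h; apply: (derive_to (@is_derive1_comp _ (@sin R) f x _ _ (is_derive_sin _) h)).
by rewrite mulrC.
Qed.

Lemma derive_cosine f x a : is_derive x (1 : R) f a ->
  is_derive x (1 : R) (fun y => cos (f y)) (- a * sin (f x)).
Proof.
move=> h; apply: (derive_to (@is_derive1_comp _ (@cos R) f x _ _ (is_derive_cos _) h)).
by rewrite mulrC mulrN mulNr.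
Qed.

Lemma derive_continuous f (a : R -> R) : (forall x, is_derive x (1 : R) f (a x)) -> continuous f.
Proof.
move=> h x; apply: differentiable_continuous; apply/derivable1_diffP.
by have [] := h x.
Qed.

Lemma derive_lipschitz f (df : R -> R) (K : R) :
  (forall x, is_derive x (1 : R) f (df x)) -> (forall x, `|df x| <= K) ->
  forall x y, `|f x - f y| <= K * `|x - y|.
Proof.
move=> hf hK x y; wlog xy : x y / x <= y.
  move=> h; have [|/ltW] := leP x y; first exact: h.
  by move/h; rewrite distrC [X in _ <= _ * X]distrC.
have [|c _] := @MVT_segment _ f df x y xy (fun z _ => hf z).
  by apply: continuous_subspaceT; exact: derive_continuous hf.
by rewrite distrC [X in _ <= _ * X]distrC => ->; rewrite normrM ler_wpM2r.
Qed.

Lemma sin_lipschitz x y : `|sin x - sin y| <= `|x - y|.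
Proof.
rewrite -[leRHS]mul1r; apply: (@derive_lipschitz _ cos); exact: cos_max.
Qed.

Lemma cos_lipschitz x y : `|cos x - cos y| <= `|x - y|.
Proof.
rewrite -[leRHS]mul1r; apply: (@derive_lipschitz _ (fun x => - sin x)).
by move=> z; rewrite normrN; exact: sin_max.
Qed.

End real_derivatives.

Ltac derive_step := first
  [ eassumption | notypeclasses refine (derive_const _ _)
  | notypeclasses refine (derive_idfun _)
  | notypeclasses refine (derive_scale _ _)
  | notypeclasses refine (derive_pow _ _)
  | notypeclasses refine (derive_exp _)
  | notypeclasses refine (derive_sine _)
  | notypeclasses refine (derive_cosine _)
  | notypeclasses refine (derive_opp _)
  | notypeclasses refine (derive_sub _ _)
  | notypeclasses refine (derive_add _ _)
  | notypeclasses refine (derive_mul _ _) ].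
Ltac derive_tac := notypeclasses refine (derive_to _ _); [repeat derive_step | rewrite /=].

(** Pointwise versions, usable for a subspace topology on the domain too. *)
Section continuous_operations.
Context {R : realType} {T : topologicalType}.
Implicit Types f g : T -> R.

Lemma continuous_add f g : continuous f -> continuous g -> continuous (fun x => f x + g x).
Proof. by move=> cf cg x; apply: cvgD; [exact: cf|exact: cg]. Qed.

Lemma continuous_sub f g : continuous f -> continuous g -> continuous (fun x => f x - g x).
Proof. by move=> cf cg x; apply: cvgB; [exact: cf|exact: cg]. Qed.

Lemma continuous_opp f : continuous f -> continuous (fun x => - f x).
Proof. by move=> cf x; apply: cvgN; exact: cf. Qed.

Lemma continuous_mul f g : continuous f -> continuous g -> continuous (fun x => f x * g x).
Proof. by move=> cf cg x; apply: cvgM; [exact: cf|exact: cg]. Qed.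

Lemma continuous_const (c : R) : continuous (fun _ : T => c).
Proof. by move=> x; exact: cvg_cst. Qed.

Lemma continuous_pow f n : continuous f -> continuous (fun x => f x ^+ n).
Proof.
move=> cf; elim: n => [|n ih].
  by under eq_fun do rewrite expr0; exact: continuous_const.
by under eq_fun do rewrite exprS; exact: continuous_mul.
Qed.

Lemma continuous_after (h : R -> R) f : continuous h -> continuous f ->
  continuous (fun x => h (f x)).
Proof. by move=> ch cf x; apply: continuous_comp; [exact: cf|exact: ch]. Qed.

End continuous_operations.

Section square_integrability.
Context {R : realType} d (T : measurableType d) (mu : {measure set T -> \bar R}).
Variables (D : set T) (mD : measurable D).
Implicit Types f g : T -> R.

Definition L2 f := measurable_fun D f /\ mu.-integrable D (fun x => (f x ^+ 2)%:E).

Definition dot f g := \int[mu]_(x in D) (f x * g x).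

Lemma L2_measurable f : L2 f -> measurable_fun D f. Proof. by case. Qed.

Lemma integrable_domin f g : measurable_fun D f ->
  (forall x, D x -> `|f x| <= g x) -> mu.-integrable D (EFin \o g) ->
  mu.-integrable D (EFin \o f).
Proof.
move=> mf fg ig; apply: (le_integrable mD _ _ ig); first exact/measurable_EFinP.
by move=> x Dx /=; rewrite lee_fin (le_trans (fg _ Dx))// ler_norm.
Qed.

Lemma integrableRD f g : mu.-integrable D (EFin \o f) -> mu.-integrable D (EFin \o g) ->
  mu.-integrable D (EFin \o (fun x => f x + g x)).
Proof. by move=> i j; have := integrableD mD i j; apply: eq_integrable. Qed.

Lemma integrableRZ c f : mu.-integrable D (EFin \o f) ->
  mu.-integrable D (EFin \o (fun x => c * f x)).
Proof. by move=> i; have := integrableZl mD c i; apply: eq_integrable. Qed.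

Lemma integrableRB f g : mu.-integrable D (EFin \o f) -> mu.-integrable D (EFin \o g) ->
  mu.-integrable D (EFin \o (fun x => f x - g x)).
Proof. by move=> i j; have := integrableB mD i j; apply: eq_integrable. Qed.

Lemma L2M f g : L2 f -> L2 g -> mu.-integrable D (EFin \o (fun x => f x * g x)).
Proof.
move=> [mf f2] [mg g2].
apply: (integrable_domin (g := fun x => f x ^+ 2 + g x ^+ 2)).
- exact: measurable_funM.
- by move=> x _; rewrite ler_norml; apply/andP; split; nra.
- exact: integrableRD.
Qed.

Lemma L2D f g : L2 f -> L2 g -> L2 (fun x => f x + g x).
Proof.
move=> hf hg; split.
  by apply: measurable_funD; exact: L2_measurable.
have [_ f2] := hf; have [_ g2] := hg.
have := integrableRD (integrableRD f2 g2) (integrableRZ 2 (L2M hf hg)).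
by apply: eq_integrable => // x _ /=; congr EFin; ring.
Qed.

Lemma L2Z c f : L2 f -> L2 (fun x => c * f x).
Proof.
move=> [mf f2]; split; first exact: measurable_funM.
have := integrableRZ (c ^+ 2) f2; apply: eq_integrable => // x _ /=.
by rewrite exprMn.
Qed.

Lemma L2B f g : L2 f -> L2 g -> L2 (fun x => f x - g x).
Proof.
move=> hf hg; have := L2D hf (L2Z (-1) hg).
by under eq_fun do rewrite mulN1r.
Qed.

Lemma L2_0 : L2 (fun=> 0).
Proof.
split => //; under eq_fun do rewrite expr0n/=; exact: integrable0.
Qed.

Lemma L2_sum (I : Type) (s : seq I) (F : I -> T -> R) : (forall i, L2 (F i)) ->
  L2 (fun x => \sum_(i <- s) F i x).
Proof.
move=> h; elim: s => [|i s ih].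
  by under eq_fun do rewrite big_nil; exact: L2_0.
by under eq_fun do rewrite big_cons; exact: L2D.
Qed.

Lemma L2_ae f g : measurable_fun D g -> {ae mu, forall x, D x -> f x = g x} ->
  L2 f -> L2 g.
Proof.
move=> mg fg [mf if2]; split => //.
apply/integrableP; split.
  by apply/measurable_EFinP; exact: measurable_funX.
have /integrableP[_] := if2; apply: le_lt_trans.
rewrite le_eqVlt; apply/orP; left; apply/eqP/ae_eq_integral => //.
- by apply: measurableT_comp => //; apply/measurable_EFinP; exact: measurable_funX.
- by apply: measurableT_comp => //; apply/measurable_EFinP; exact: measurable_funX.
- by apply: filterS fg => x fg Dx; rewrite fg.
Qed.

Lemma eq_Rintegral_ae f g : measurable_fun D f -> measurable_fun D g ->
  {ae mu, forall x, D x -> f x = g x} ->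
  \int[mu]_(x in D) f x = \int[mu]_(x in D) g x.
Proof.
move=> mf mg fg; rewrite /Rintegral; congr fine; apply: ae_eq_integral => //.
- exact/measurable_EFinP.
- exact/measurable_EFinP.
- by apply: filterS fg => x fg Dx; rewrite fg.
Qed.

Lemma dotC f g : dot f g = dot g f.
Proof. by rewrite /dot; under eq_Rintegral do rewrite mulrC. Qed.

Lemma dotDl f g h : L2 f -> L2 g -> L2 h ->
  dot (fun x => f x + g x) h = dot f h + dot g h.
Proof.
move=> hf hg hh; rewrite /dot; under eq_Rintegral do rewrite mulrDl.
by rewrite RintegralD//; exact: L2M.
Qed.

Lemma dotZl c f h : L2 f -> L2 h -> dot (fun x => c * f x) h = c * dot f h.
Proof.
move=> hf hh; rewrite /dot; under eq_Rintegral do rewrite -mulrA.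
by rewrite RintegralZl//; exact: L2M.
Qed.

Lemma dotBl f g h : L2 f -> L2 g -> L2 h ->
  dot (fun x => f x - g x) h = dot f h - dot g h.
Proof.
move=> hf hg hh; rewrite /dot; under eq_Rintegral do rewrite mulrBl.
by rewrite RintegralB//; exact: L2M.
Qed.

Lemma dot0l h : dot (fun=> 0) h = 0.
Proof. by rewrite /dot; under eq_Rintegral do rewrite mul0r; rewrite Rintegral_cst// mul0r. Qed.

Lemma dot_suml (I : Type) (s : seq I) (F : I -> T -> R) h :
  (forall i, L2 (F i)) -> L2 h ->
  dot (fun x => \sum_(i <- s) F i x) h = \sum_(i <- s) dot (F i) h.
Proof.
move=> hF hh; elim: s => [|i s ih].
  rewrite big_nil /dot; under eq_Rintegral do rewrite big_nil mul0r.
  by rewrite Rintegral_cst// mul0r.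
rewrite big_cons -ih -dotDl//; last exact: L2_sum.
by rewrite /dot; under eq_Rintegral do rewrite big_cons.
Qed.

Lemma dot_ge0 f : 0 <= dot f f.
Proof. by apply: Rintegral_ge0 => x _; rewrite -expr2 sqr_ge0. Qed.

Lemma dot_sqrB f g : L2 f -> L2 g ->
  dot (fun x => f x - g x) (fun x => f x - g x) = dot f f - 2 * dot f g + dot g g.
Proof.
move=> hf hg; have hfg := L2B hf hg.
rewrite dotBl// [dot f _]dotC [dot g _]dotC !dotBl// [dot g f]dotC; ring.
Qed.

Lemma dot_sqr_comb u f g : L2 f -> L2 g ->
  dot (fun x => u * f x + g x) (fun x => u * f x + g x) =
  u ^+ 2 * dot f f + 2 * u * dot f g + dot g g.
Proof.
move=> hf hg; have h1 := L2Z u hf; have h2 := L2D h1 hg.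
rewrite (dotDl h1 hg h2) (dotZl u hf h2) [dot f _]dotC [dot g _]dotC.
rewrite (dotDl h1 hg hf) (dotDl h1 hg hg) (dotZl u hf hf) (dotZl u hf hg) [dot g f]dotC.
ring.
Qed.

(** The norm of [f - t * g] is nonnegative: take the minimizing [t] if [g] is
    not null, and otherwise a [t] that would make it negative. *)
Lemma cauchy_schwarz f g : L2 f -> L2 g -> dot f g ^+ 2 <= dot f f * dot g g.
Proof.
move=> hf hg.
have key t : 0 <= dot f f - 2 * t * dot f g + t ^+ 2 * dot g g.
  have := dot_ge0 (fun x => f x - t * g x).
  rewrite dot_sqrB//; last exact: L2Z.
  by rewrite [dot f (fun x => t * g x)]dotC !dotZl ?[dot g (fun x => t * g x)]dotC ?dotZl//;
    [rewrite [dot g f]dotC => h; rewrite (le_trans h)// le_eqVlt; apply/orP; left; apply/eqP; ring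
    |exact: L2Z].
have := dot_ge0 g; rewrite le_eqVlt => /orP[/eqP g0|g0].
  rewrite -g0 mulr0; move: key; rewrite -g0 => key.
  have [->|fg0] := eqVneq (dot f g) 0; first by rewrite expr0n.
  have := key ((dot f f + 1) / (2 * dot f g)); rewrite mulr0 addr0.
  rewrite (_ : 2 * _ * _ = dot f f + 1); last by field.
  lra.
have := key (dot f g / dot g g).
rewrite (_ : _ + _ = (dot f f * dot g g - dot f g ^+ 2) / dot g g); last first.
  by field; rewrite gt_eqF.
by rewrite pmulr_lge0 ?invr_gt0// subr_ge0.
Qed.

End square_integrability.

Lemma probability_L2_integrable {R : realType} d (T : measurableType d)
    (P : probability T R) (f : T -> R) :
  L2 P setT f -> P.-integrable setT (EFin \o f).
Proof.
move=> hf.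
have := @L2M _ _ _ P _ measurableT f (fun=> 1) hf.
rewrite (_ : (fun x => f x * 1) = f); last by apply/funext => x; rewrite mulr1.
apply; split => //.
exact: (finite_measure_integrable_cst P (1 ^+ 2)).
Qed.

(** * Moments of the normal law *)

Section normal_moments.
Context {R : realType}.
Local Notation leb := (@lebesgue_measure R).

(** The fundamental theorem of calculus on [[- n, n]]: the boundary terms vanish
    in the limit. *)
Lemma integral_derivative_eq0 (F f : R -> R) (C : R) :
  continuous f -> (forall x : R, is_derive x (1 : R) F (f x)) ->
  leb.-integrable setT (EFin \o f) ->
  (forall n, `|F n.+1%:R| <= C / n.+1%:R /\ `|F (- n.+1%:R)| <= C / n.+1%:R) ->
  \int[leb]_x f x = 0.
Proof.
move=> cf dF intf bF.
have mf : measurable_fun setT f by have /measurable_int/measurable_EFinP := intf.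
have := @Rdominated_convergence _ _ _ leb setT
  (fun n => f \_ `[- n.+1%:R, n.+1%:R]) f (fun x => `|f x|) measurableT.
have -> : (fun n => \int[leb]_x (f \_ `[- n.+1%:R, n.+1%:R]) x) =
    (fun n => F n.+1%:R - F (- n.+1%:R)).
  apply/funext => n; rewrite -Rintegral_mkcond /Rintegral.
  rewrite (@continuous_FTC2 _ f F)//.
  - by rewrite (@lt_trans _ _ 0)// ?oppr_lt0// ltr0Sn.
  - exact: continuous_subspaceT.
  - have dc := derive_continuous dF.
    split; first by move=> x _; have [] := dF x.
      exact/cvg_at_right_filter/dc.
    exact/cvg_at_left_filter/dc.
  - by move=> x _; rewrite derive1E; have [_ ->] := dF x.
case.
- move=> n; apply/(measurable_restrictT _ _).1 => //.
  exact: measurable_funS mf.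
- move=> x _; apply: cvg_near_cst; near=> n.
  rewrite patchE mem_set//= in_itv/= -ler_norml.
  rewrite (@le_trans _ _ n%:R) ?ler_nat//; near: n; exact: nbhs_infty_ger.
- exact: integrable_norm.
- by move=> n x _; rewrite patchE; case: ifP => // _; rewrite normr0.
move=> _ h; apply: (cvg_unique (@Rhausdorff R) h).
apply/cvgrPdist_le => e e0; near=> n.
rewrite sub0r normrN (le_trans (ler_normB _ _))//.
have [h1 h2] := bF n; rewrite (le_trans (lerD h1 h2))//.
have C0 : 0 <= C.
  by have := le_trans (normr_ge0 _) h1; rewrite pmulr_lge0// invr_gt0 ltr0Sn.
rewrite -mulrDl ler_pdivrMr ?ltr0Sn//.
rewrite -ler_pdivrMl// (@le_trans _ _ n%:R) ?ler_nat//.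
by near: n; exact: nbhs_infty_ger.
Unshelve. all: by end_near. Qed.

Lemma normal_pdf0_form (s : R) : s != 0 ->
  normal_pdf 0 s = (fun x => normal_peak s * expR (- (2 * s ^+ 2)^-1 * x ^+ 2)).
Proof.
move=> s0; rewrite normal_pdfE//; apply/funext => x; rewrite /= /normal_fun subr0.
by congr (_ * expR _); rewrite -mulr_natl !mulNr mulrC.
Qed.

Variables (s : R) (s_neq0 : s != 0).
Local Notation p := (normal_pdf 0 s).
Let c : R := (2 * s ^+ 2)^-1.

Let s2_gt0 : 0 < s ^+ 2. Proof. by rewrite exprn_even_gt0. Qed.
Let c_gt0 : 0 < c. Proof. by rewrite invr_gt0 mulr_gt0. Qed.

Lemma derive_normal_pdf (x : R) : is_derive x (1 : R) p (- (x / s ^+ 2 * p x)).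
Proof.
rewrite normal_pdf0_form//; derive_tac.
by field.
Qed.

Lemma normal_pdf_continuous : continuous p.
Proof. exact: (derive_continuous derive_normal_pdf). Qed.

(** The factor [x ^+ 2] is absorbed by half of the exponent: what remains is a
    multiple of the normal density with standard deviation [sqrt 2 * s]. *)
Lemma integrable_normal_moment : leb.-integrable setT (EFin \o (fun x => x ^+ 2 * p x)).
Proof.
pose s' : R := Num.sqrt 2 * s.
have s'0 : s' != 0 by rewrite mulf_neq0// gt_eqF// sqrtr_gt0.
have := integrableRZ measurableT
  (2 * c^-1 * normal_peak s / normal_peak s') (integrable_normal_pdf (0 : R) s').
apply: integrable_domin => //.
- apply: measurable_funM; first exact: measurable_funX.
  exact: measurable_normal_pdf.
- move=> x _; rewrite ger0_norm; last exact: mulr_ge0 (sqr_ge0 x) (normal_pdf_ge0 0 s x).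
  rewrite !normal_pdf0_form//.
  have -> : - (2 * s' ^+ 2)^-1 * x ^+ 2 = - (c * x ^+ 2 / 2).
    by rewrite /s' exprMn sqr_sqrtr// /c; field.
  have pk' : 0 < normal_peak s' by exact: normal_peak_gt0.
  have pk : 0 < normal_peak s by exact: normal_peak_gt0.
  set e := expR (- (c * x ^+ 2 / 2)).
  have -> : expR (- c * x ^+ 2) = e * e by rewrite /e -expRD /c; congr expR; field.
  rewrite [leRHS](_ : _ = normal_peak s * e * (2 / c)); last first.
    by field; rewrite !gt_eqF.
  rewrite [leLHS](_ : _ = normal_peak s * e * (x ^+ 2 * e)); last by ring.
  rewrite ler_pM2l ?mulr_gt0 ?expR_gt0// ler_pdivlMr// /e expRN.
  rewrite mulrAC ler_pdivrMr ?expR_gt0//.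
  have := expR_ge1Dx (c * x ^+ 2 / 2).
  lra.
Qed.

Lemma integrable_bounded_normal (g : R -> R) : continuous g ->
  (forall x, `|g x| <= 1 + x ^+ 2) ->
  leb.-integrable setT (EFin \o (fun x => g x * p x)).
Proof.
move=> cg gb.
have := integrableRD measurableT (integrable_normal_pdf (0 : R) s) integrable_normal_moment.
apply: integrable_domin => //.
- apply: measurable_funM; last exact: measurable_normal_pdf.
  exact: continuous_measurable_fun.
- move=> x _; rewrite normrM [X in _ * X]ger0_norm ?normal_pdf_ge0//.
  by have := normal_pdf_ge0 0 s x; have := gb x; nra.
Qed.

(** The quadratic factor is what the boundary terms of an integration by parts
    against functions of linear growth require. *)
Lemma normal_pdf_decay : exists C, forall x, (1 + x ^+ 2) * p x <= C.
Proof.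
exists (normal_peak s * (1 + c^-1)) => x; rewrite normal_pdf0_form// -/c.
rewrite mulrCA ler_pM2l ?normal_peak_gt0//.
rewrite mulNr expRN ler_pdivrMr ?expR_gt0//.
have := expR_ge1Dx (c * x ^+ 2).
have h : 0 < c^-1 by rewrite invr_gt0.
have := sqr_ge0 x; move: h; set y := x ^+ 2 => h y0 he.
apply: (@le_trans _ _ ((1 + c^-1) * (1 + c * y))); last first.
  by rewrite ler_pM2l// addr_gt0.
have -> : (1 + c^-1) * (1 + c * y) = 1 + y + (c^-1 + c * y) by field; rewrite gt_eqF.
by rewrite lerDl; exact: addr_ge0 (ltW h) (mulr_ge0 (ltW c_gt0) y0).
Qed.

(** Gaussian integration by parts. *)
Lemma normal_stein (g dg : R -> R) :
  (forall x : R, is_derive x (1 : R) g (dg x)) -> continuous dg ->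
  (forall x, `|g x| <= `|x|) -> (forall x, `|dg x| <= 1 + x ^+ 2) ->
  \int[leb]_x (x * g x * p x) = s ^+ 2 * \int[leb]_x (dg x * p x).
Proof.
move=> hg cdg gb dgb; have cg := derive_continuous hg.
have cp := normal_pdf_continuous.
have i1 : leb.-integrable setT (EFin \o (fun x => dg x * p x)).
  exact: integrable_bounded_normal.
have i2 : leb.-integrable setT (EFin \o (fun x => x * g x * p x)).
  apply: (integrable_bounded_normal (g := fun x => x * g x)).
    by apply: continuous_mul => // x; exact: cvg_id.
  move=> x; rewrite normrM; have := gb x.
  by have := normr_ge0 x; rewrite -[x ^+ 2]real_normK ?num_real//; nra.
have [C hC] := normal_pdf_decay.
have := @integral_derivative_eq0 (fun x => s ^+ 2 * (g x * p x))
  (fun x => s ^+ 2 * (dg x * p x) - x * g x * p x) (s ^+ 2 * C).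
rewrite RintegralB//; last exact: integrableRZ.
rewrite RintegralZl// => h.
apply/esym/eqP; rewrite -subr_eq0; apply/eqP; apply: h.
- have cid : continuous (fun x : R => x) by move=> x; exact: cvg_id.
  apply: continuous_sub.
    by apply: continuous_mul; [exact: continuous_const|exact: continuous_mul].
  by apply: continuous_mul => //; exact: continuous_mul.
- move=> x; have hp := derive_normal_pdf x.
  apply: (derive_to (derive_scale _ (derive_mul (hg x) hp))).
  by field.
- by apply: integrableRB => //; exact: integrableRZ.
- have key x : 1 <= `|x| -> `|s ^+ 2 * (g x * p x)| <= s ^+ 2 * C / `|x|.
    move=> x1; rewrite normrM gtr0_norm// -mulrA ler_pM2l//.
    rewrite ler_pdivlMr ?(lt_le_trans ltr01)// normrM.
    rewrite [X in _ * X * _]ger0_norm ?normal_pdf_ge0//.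
    apply: le_trans (hC x); rewrite mulrAC ler_wpM2r ?normal_pdf_ge0//.
    have := gb x; have := normr_ge0 (g x); rewrite -[x ^+ 2]real_normK ?num_real//.
    nra.
  move=> n; have h1 : 1 <= `|n.+1%:R : R| by rewrite normr_nat ler1n.
  have := key _ h1; rewrite normr_nat => ->; split => //.
  by have := key (- n.+1%:R); rewrite normrN normr_nat; apply; rewrite ler1n.
Qed.

Lemma Rintegral_normal_pdf : \int[leb]_x p x = 1.
Proof. by rewrite /Rintegral integral_normal_pdf. Qed.

Lemma normal_second_moment : \int[leb]_x (x ^+ 2 * p x) = s ^+ 2.
Proof.
have := @normal_stein (fun x => x) (fun=> 1).
under eq_Rintegral do rewrite -expr2.
under [X in _ * X]eq_Rintegral do rewrite mul1r.
rewrite Rintegral_normal_pdf mulr1; apply.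
- exact: cst_continuous.
- by [].
- by move=> x; rewrite normr1 lerDl sqr_ge0.
Qed.

(** By differentiation under the integral sign and integration by parts, the
    transform [F] solves [F' = - s ^+ 2 * u * F]. *)
Lemma normal_cos_transform (t : R) :
  \int[leb]_x (cos (t * x) * p x) = expR (- (s ^+ 2 * t ^+ 2 / 2)).
Proof.
pose F (u : R) := \int[leb]_x (cos (u * x) * p x).
have intF (u : R) : leb.-integrable setT (EFin \o (fun x => cos (u * x) * p x)).
  apply: (integrable_bounded_normal (g := fun x => cos (u * x))).
    by apply: (derive_continuous (a := fun x => - u * sin (u * x))) => x; derive_tac; ring.
  move=> x; rewrite (@le_trans _ _ 1) ?lerDl ?sqr_ge0//.
  by rewrite ler_norml cos_geN1 cos_le1.
have dF (u : R) : is_derive u (1 : R) F (- (s ^+ 2 * u * F u)).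
  pose f (v x : R) := cos (v * x) * p x.
  have df (v x : R) : is_derive v (1 : R) (f ^~ x) (- x * sin (v * x) * p x).
    by rewrite /f; derive_tac; ring.
  have intG : leb.-integrable setT (EFin \o (fun x => `|x| * p x)).
    apply: (integrable_bounded_normal (g := fun x => `|x|)).
      exact: norm_continuous.
    move=> x; rewrite normr_id -[x ^+ 2]real_normK ?num_real//.
    by have := sqr_ge0 (`|x| - 1); nra.
  have Gge0 (x : R) : 0 <= `|x| * p x by rewrite mulr_ge0 ?normal_pdf_ge0.
  have dfE (v x : R) : partial1of2 f v x = - x * sin (v * x) * p x.
    by rewrite partial1of2E; have [_ ->] := df v x.
  have ub (v x : R) : `]u - 1, u + 1[%classic v -> setT x ->
      `|partial1of2 f v x| <= `|x| * p x.
    move=> _ _; rewrite dfE !normrM normrN [X in _ * X]ger0_norm ?normal_pdf_ge0//.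
    rewrite ler_wpM2r ?normal_pdf_ge0// ler_piMr//.
    by rewrite ler_norml sin_geN1 sin_le1.
  have uI : `]u - 1, u + 1[%classic u by rewrite /= in_itv/=; apply/andP; split; lra.
  have dfv (v x : R) : `]u - 1, u + 1[%classic v -> setT x -> derivable (f ^~ x) v 1.
    by move=> _ _; have [] := df v x.
  have h1 := differentiation_under_integral measurableT uI
    (fun v _ => intF v) dfv Gge0 intG ub.
  have h2 := derivable_under_integral measurableT uI
    (fun v _ => intF v) dfv Gge0 intG ub.
  split; first exact: h2.
  rewrite -derive1E h1; under eq_Rintegral do rewrite dfE.
  have [->|u0] := eqVneq u 0.
    under eq_Rintegral do rewrite mul0r sin0 mulr0 mul0r.
    by rewrite Rintegral_cst// mul0r mulr0 mul0r oppr0.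
  have dg (x : R) : is_derive x (1 : R) (fun x => u^-1 * sin (u * x)) (cos (u * x)).
    by derive_tac; field.
  have cdg : continuous (fun x => cos (u * x)).
    by apply: (derive_continuous (a := fun x => - u * sin (u * x))) => x; derive_tac; ring.
  have b1 x : `|u^-1 * sin (u * x)| <= `|x|.
    rewrite normrM normfV ler_pdivrMl ?normr_gt0// -normrM.
    by have := sin_lipschitz (u * x) 0; rewrite sin0 !subr0.
  have b2 x : `|cos (u * x)| <= 1 + x ^+ 2.
    by rewrite (le_trans (cos_max _))// lerDl sqr_ge0.
  have := normal_stein dg cdg b1 b2.
  (* Integration by parts is applied to [sin (u * x) / u], which is bounded by
     [|x|]. *)
  have -> : \int[leb]_x (x * (u^-1 * sin (u * x)) * p x) =
      - u^-1 * \int[leb]_x (- x * sin (u * x) * p x).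
    rewrite -RintegralZl//; last first.
      apply: (integrable_bounded_normal (g := fun x => - x * sin (u * x))).
        apply: (derive_continuous (a := fun x => - sin (u * x) - x * (u * cos (u * x)))).
        by move=> x; derive_tac; ring.
      move=> x; rewrite normrM normrN; have := sin_max (u * x).
      have := normr_ge0 x; rewrite -[x ^+ 2]real_normK ?num_real//.
      by have := sqr_ge0 (`|x| - 1); nra.
    by apply: eq_Rintegral => x _; ring.
  move=> h; apply: (mulfI (x := - u^-1)); first by rewrite oppr_eq0 invr_eq0.
  by rewrite h /F; field.
pose K (u : R) := F u * expR (s ^+ 2 * u ^+ 2 / 2).
have K0 (u : R) : is_derive u (1 : R) K 0.
  have h : is_derive u (1 : R) (fun u => s ^+ 2 * u ^+ 2 / 2) (s ^+ 2 * u).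
    by derive_tac; field.
  by apply: (derive_to (derive_mul (dF u) (derive_exp h))); ring.
have := is_derive_0_is_cst t 0 K0.
rewrite /K {2}/F expr0n/= mulr0 mul0r expR0 mulr1.
under [X in _ = X -> _]eq_Rintegral do rewrite mul0r cos0 mul1r.
rewrite Rintegral_normal_pdf => h.
by rewrite -/(F t) expRN -[F t](mulfK (lt0r_neq0 (expR_gt0 (s ^+ 2 * t ^+ 2 / 2)))) h mul1r.
Qed.

End normal_moments.

(** * Expectations under a centered Gaussian law *)

Section gaussian_expectation.
Context {R : realType} d (Omega : measurableType d) (P : probability Omega R).
Local Notation leb := (@lebesgue_measure R).
Implicit Types X : Omega -> R.

(** The normal law has a density in the sense of Radon and Nikodym; it is almost
    everywhere the explicit one. *)
Lemma normal_law_expectation X (s : R) (g : R -> R) :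
  measurable_fun setT X -> s != 0 ->
  (forall B, measurable B -> P (X @^-1` B) = normal_prob 0 s B) ->
  measurable_fun setT g -> P.-integrable setT (EFin \o (fun om => g (X om))) ->
  \int[P]_om g (X om) = \int[leb]_x (g x * normal_pdf 0 s x).
Proof.
move=> mX s0 lawX mg ig; rewrite /Rintegral; congr fine.
have meg : measurable_fun setT (EFin \o g : measurableTypeR R -> \bar R).
  exact/measurable_EFinP.
have mX' : measurable_fun setT (X : Omega -> measurableTypeR R) := mX.
pose mX_mixin := isMeasurableFun.Build _ _ _ _ _ mX'.
pose X' := MeasurableFun.Pack (MeasurableFun.Class mX_mixin).
pose nu : {measure set (measurableTypeR R) -> \bar R} := distribution P X'.
have ipush : nu.-integrable setT (EFin \o g).
  by apply: (integrable_pushforward mX' meg).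
have eqnu (f : measurableTypeR R -> \bar R) :
    (\int[nu]_x f x = \int[normal_prob 0 s]_x f x)%E.
  by apply: eq_measure_integral => A mA _; exact: lawX.
have inormal : (normal_prob 0 s).-integrable setT (EFin \o g).
  apply/integrableP; split => //.
  by have /integrableP[_] := ipush; rewrite eqnu.
transitivity (\int[nu]_x (EFin \o g) x)%E.
  by rewrite (integral_pushforward mX' meg).
rewrite eqnu -(Radon_Nikodym_change_of_variables (normal_prob_dominates 0 s) measurableT inormal).
apply: ae_eq_integral => //.
- apply: emeasurable_funM => //; apply: (measurable_int leb).
  by apply: Radon_Nikodym_integrable; exact: normal_prob_dominates.
- apply/measurable_EFinP/measurable_funM => //; exact: measurable_normal_pdf.
have : ae_eq leb setT (Radon_Nikodym (charge_of_finite_measure (normal_prob 0 s)) leb)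
    (fun x => (normal_pdf 0 s x)%:E).
  apply: integral_ae_eq => //.
  - by apply: Radon_Nikodym_integrable; exact: normal_prob_dominates.
  - by apply/measurable_EFinP; exact: measurable_normal_pdf.
  - move=> A _ mA; rewrite -Radon_Nikodym_integral//.
    exact: normal_prob_dominates.
by apply: filterS => x h _; rewrite h// EFinM.
Qed.

Lemma gaussian_degenerate X : measurable_fun setT X ->
  (forall B : set R, measurable B -> P (X @^-1` B) = \d_(0 : R) B) ->
  {ae P, forall om, X om = 0}.
Proof.
move=> mX lawX; exists (X @^-1` (~` [set 0])); split.
- by rewrite -[X in measurable X]setTI; apply: mX => //; exact: measurableC.
- rewrite lawX; last exact: measurableC.
  by rewrite diracE memNset//= => h; exact: h.
- by [].
Qed.

Lemma bounded_measurable_after X (g : R -> R) (M : R) : measurable_fun setT X ->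
  measurable_fun setT g -> (forall x, `|g x| <= M) ->
  P.-integrable setT (EFin \o (fun om => g (X om))).
Proof.
move=> mX mg gM; apply: (integrable_domin measurableT (g := fun=> M)) => //.
  exact: measurableT_comp.
exact: finite_measure_integrable_cst.
Qed.

Lemma gaussian_second_moment X s : L2 P setT X -> 0 <= s ->
  (forall B : set R, measurable B ->
    P (X @^-1` B) = if s == 0 then \d_(0 : R) B else normal_prob 0 s B) ->
  \int[P]_om (X om ^+ 2) = s ^+ 2.
Proof.
move=> [mX X2] s_ge0; case: eqVneq => [->|s0] lawX.
  have X0 := gaussian_degenerate mX lawX.
  rewrite (@eq_Rintegral_ae _ _ _ P setT measurableT _ (fun=> 0)) //.
  - by rewrite Rintegral_cst//= mul0r expr0n.
  - exact: measurable_funX.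
  - by apply: filterS X0 => om -> _; rewrite expr0n.
rewrite (@normal_law_expectation X s (fun x => x ^+ 2) mX s0 lawX)//.
  exact: normal_second_moment.
Qed.

(** A centered Gaussian law is determined by its variance. *)
Lemma gaussian_law_expectation X Y (g : R -> R) (M : R) :
  L2 P setT X -> L2 P setT Y -> centered_gaussian P X -> centered_gaussian P Y ->
  \int[P]_om (X om ^+ 2) = \int[P]_om (Y om ^+ 2) ->
  measurable_fun setT g -> (forall x, `|g x| <= M) ->
  \int[P]_om g (X om) = \int[P]_om g (Y om).
Proof.
move=> LX LY [s s_ge0 lawX] [r r_ge0 lawY].
rewrite (gaussian_second_moment LX s_ge0 lawX) (gaussian_second_moment LY r_ge0 lawY).
move=> /(pexpIrn (n := 2) isT s_ge0 r_ge0) rs mg gM; rewrite -rs in lawY.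
have [mX _] := LX; have [mY _] := LY.
move: lawX lawY; case: eqVneq => [_|s0] lawX lawY.
  apply: (@eq_Rintegral_ae _ _ _ P setT measurableT).
  - exact: measurableT_comp.
  - exact: measurableT_comp.
  - have X0 := gaussian_degenerate mX lawX; have Y0 := gaussian_degenerate mY lawY.
    by apply: filterS2 X0 Y0 => om -> -> _.
rewrite (normal_law_expectation mX s0 lawX)//; last exact: bounded_measurable_after gM.
by rewrite (normal_law_expectation mY s0 lawY)//; exact: bounded_measurable_after gM.
Qed.

(** The sine is odd, and a variable and its opposite have the same law. *)
Lemma gaussian_sin X : L2 P setT X ->
  centered_gaussian P X -> centered_gaussian P (fun om => - X om) ->
  \int[P]_om sin (X om) = 0.
Proof.
move=> LX gX gNX.
have LN : L2 P setT (fun om => - X om).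
  by have := L2Z measurableT (-1) LX; under eq_fun do rewrite mulN1r.
have msin : measurable_fun setT (@sin R).
  by apply: continuous_measurable_fun; exact: continuous_sin.
have := @gaussian_law_expectation X (fun om => - X om) sin 1 LX LN gX gNX.
under [X in (_ = X -> _) -> _]eq_Rintegral do rewrite sqrrN.
move=> /(_ erefl msin (@sin_max R)).
under [X in _ = X -> _]eq_Rintegral do rewrite sinN -mulN1r.
rewrite RintegralZl//; last exact: bounded_measurable_after (LX.1) msin (@sin_max R).
by lra.
Qed.

Lemma gaussian_cos X : L2 P setT X -> centered_gaussian P X ->
  \int[P]_om cos (X om) = expR (- (\int[P]_om (X om ^+ 2) / 2)).
Proof.
move=> LX [s s_ge0 lawX]; rewrite (gaussian_second_moment LX s_ge0 lawX).
have mcos : measurable_fun setT (@cos R).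
  by apply: continuous_measurable_fun; exact: continuous_cos.
have [mX _] := LX.
move: lawX; case: eqVneq => [->|s0] lawX.
  have X0 := gaussian_degenerate mX lawX.
  rewrite (@eq_Rintegral_ae _ _ _ P setT measurableT _ (fun=> 1)) //.
  - by rewrite Rintegral_cst//= probability_setT expr0n/= mul0r oppr0 expR0 mulr1.
  - exact: measurableT_comp.
  - by apply: filterS X0 => om -> _; rewrite cos0.
rewrite (normal_law_expectation mX s0 lawX)//; last first.
  exact: bounded_measurable_after mX mcos (@cos_max R).
have := normal_cos_transform s0 1; rewrite expr1n mulr1 => <-.
by under [in RHS]eq_Rintegral do rewrite mul1r.
Qed.

End gaussian_expectation.

(** * Events determined by finitely many variables *)

Section generated_sigma_algebra.
Context {R : realType} d (Omega : measurableType d).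
Context m (Y : 'I_m -> Omega -> R).

(** Open half-lines generate the Borel sets. *)
Lemma g_sigma_preimage_sub (S : set (set Omega)) : sigma_algebra setT S ->
  (forall i (t : R), S (Y i @^-1` `]t, +oo[)) -> g_sigma_preimage Y `<=` S.
Proof.
move=> sS SY; apply: smallest_sub => //.
apply: (big_ind (fun B : set (set Omega) => B `<=` S)).
- by [].
- by move=> B C BS CS; rewrite subUset.
move=> i _ B [C mC <-]; rewrite setTI.
have : image_set_system setT (Y i) S C.
  have {mC} : (@RGenOInfty.G R).-sigma.-measurable C.
    by rewrite -RGenOInfty.measurableE.
  move: C; apply: smallest_sub.
    exact: sigma_algebra_image.
  by move=> _ [t ->]; rewrite /image_set_system/= setTI; exact: SY.
by rewrite /image_set_system/= setTI.
Qed.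

Lemma g_sigma_preimage_measurable : (forall i, measurable_fun setT (Y i)) ->
  g_sigma_preimage Y `<=` measurable.
Proof.
move=> mY; apply: g_sigma_preimage_sub; first exact: sigma_algebra_measurable.
by move=> i t; rewrite -[X in measurable X]setTI; apply: mY => //; exact: measurable_itv.
Qed.
End generated_sigma_algebra.

Section trigonometric_uniqueness.
Context {R : realType} d (Omega : measurableType d) (P : probability Omega R).
Context m (Y : 'I_m -> Omega -> R) (mY : forall i, measurable_fun setT (Y i)).
Variables (W : Omega -> R) (intW : P.-integrable setT (EFin \o W)).

Let phase (i : ('I_m -> R) * R) om := \sum_(j < m) i.1 j * Y j om + i.2.

Let mphase i : measurable_fun setT (phase i).
Proof.
apply: measurable_funD => //; apply: measurable_sum => j.
exact: measurable_funM.
Qed.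

Let Wt (i : ('I_m -> R) * R) om := cos (phase i om) * W om.

Let mcos : measurable_fun setT (@cos R).
Proof. by apply: continuous_measurable_fun; exact: continuous_cos. Qed.

Let bcos (f : Omega -> R) : measurable_fun setT f -> bounded_measurable (fun om => cos (f om)).
Proof.
move=> mf; split; first exact: measurableT_comp.
by exists 1 => om; exact: cos_max.
Qed.

Let intWt i : P.-integrable setT (EFin \o Wt i).
Proof.
have := bounded_measurable_integrable (bcos (mphase i)) intW.
exact.
Qed.

Hypothesis W_trig : forall (a : 'I_m -> R) (c : R),
  \int[P]_om (cos (\sum_(j < m) a j * Y j om + c) * W om) = 0.

Let M := multiplier P Wt.
Let algM : bounded_limit_algebra M := multiplier_algebra intWt.

(** A product of two cosines is a sum of cosines. *)
Let cos_multiplier j (k c : R) : M (fun om => cos (k * Y j om + c)).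
Proof.
split; first by apply: bcos; apply: measurable_funD => //; exact: measurable_funM.
move=> f [bf f0]; split.
  apply: bounded_measurableM => //.
  by apply: bcos; apply: measurable_funD => //; exact: measurable_funM.
move=> [a b].
have phE (s : R) om : \sum_(i < m) (a i + s * k *+ (i == j)) * Y i om =
    \sum_(i < m) a i * Y i om + s * k * Y j om.
  under eq_bigr do rewrite mulrDl; rewrite big_split/=; congr (_ + _).
  rewrite (bigD1 j)//= eqxx mulr1n big1 ?addr0// => i ij.
  by rewrite (negbTE ij) mulr0n mul0r.
have -> : (fun om => (f \* (fun om => cos (k * Y j om + c))) om * Wt (a, b) om) =
    (fun om => 2^-1 * (f om * Wt (fun i => a i + 1 * k *+ (i == j), b + c) om
     + f om * Wt (fun i => a i + (-1) * k *+ (i == j), b - c) om)).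
  apply/funext => om; rewrite /Wt /phase/= !phE.
  set V := \sum_(_ < _) _.
  have -> : V + 1 * k * Y j om + (b + c) = (V + b) + (k * Y j om + c) by ring.
  have -> : V + -1 * k * Y j om + (b - c) = (V + b) - (k * Y j om + c) by ring.
  by rewrite (cosD (V + b)) (cosB (V + b)); field.
have i1 i : P.-integrable setT (EFin \o (fun om => f om * Wt i om)).
  exact: bounded_measurable_integrable.
by rewrite RintegralZl// ?RintegralD// ?f0 ?addr0 ?mulr0//; exact: integrableRD.
Qed.

(** For large [n], [(Y j - t) / n] lies in a period of the sine around [0], where
    the sine has the sign of its argument. *)
Let sg_multiplier j (t : R) : M (fun om => Num.sg (Y j om - t)).
Proof.
apply: (algebra_lim algM (f_ := fun n om => Num.sg (sin ((Y j om - t) / n.+1%:R))) (M := 1)).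
- move=> n; apply: (algebra_sg algM); last by move=> om; exact: sin_max.
  have := cos_multiplier j n.+1%:R^-1 (- t / n.+1%:R - pi / 2).
  congr M; apply/funext => om; rewrite addrA cosBpihalf; congr sin; ring.
- by move=> n om; rewrite normr_sg; case: (_ != 0).
- move=> om; set x := Y j om - t.
  apply: cvg_near_cst; near=> n.
  have n0 : 0 < n.+1%:R :> R by rewrite ltr0Sn.
  have xn : `|x| / n.+1%:R < pi.
    rewrite ltr_pdivrMr// (@lt_le_trans _ _ (1 * n.+1%:R))//; last first.
      by rewrite ler_pM2r// (le_trans _ (pi_ge2 R))// ler1n.
    rewrite mul1r (@le_lt_trans _ _ n%:R)// ?ltr_nat//.
    by near: n; exact: nbhs_infty_ger.
  have [x0|x0|->] := ltgtP x 0.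
  + rewrite (ltr0_sg x0) -[x]opprK mulNr sinN ltr0_sg// oppr_lt0 sin_gt0_pi//.
    by rewrite divr_gt0 ?oppr_gt0//= -(ltr0_norm x0).
  + rewrite (gtr0_sg x0) gtr0_sg// sin_gt0_pi// divr_gt0//=.
    by rewrite -{1}(gtr0_norm x0).
  + by rewrite mul0r sin0.
Unshelve. all: by end_near. Qed.

(** Trigonometric functions of [Y] are multipliers of the functions orthogonal to
    [W] times all trigonometric functions. So are the signs of the [Y j - t], then
    the indicators of all events determined by [Y], and these multiply the
    constant [1]. *)
Lemma trig_orthogonal A : g_sigma_preimage Y A -> \int[P]_(om in A) W om = 0.
Proof.
move=> FA.
have : M \1_A.
  move: A FA; apply: g_sigma_preimage_sub; first exact: sigma_algebra_indic algM.
  move=> j t /=; have := algebra_indic_positive algM (sg_multiplier j t).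
  have h om : `|Num.sg (Y j om - t)| <= 1 by rewrite normr_sg; case: (_ != 0).
  move=> /(_ h); congr M; congr (\1__); apply/seteqP; split => om /=.
    by rewrite sgr_gt0 subr_gt0 in_itv/= andbT.
  by rewrite sgr_gt0 subr_gt0 in_itv/= andbT.
move=> [_ /(_ (cst 1))[|_]].
  split; first exact: bounded_measurable_cst.
  by move=> i; under eq_Rintegral do rewrite mul1r; exact: W_trig.
move=> /(_ (fun=> 0, 0)).
under eq_Rintegral => om _.
  rewrite /Wt /phase /= big1 ?addr0 ?cos0 ?mul1r; last by move=> ? _; rewrite mul0r.
  over.
move=> <-; rewrite Rintegral_mkcond; apply: eq_Rintegral => om _.
by rewrite patchE indicE; case: ifP => _; rewrite ?mul1r ?mul0r.
Qed.

End trigonometric_uniqueness.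

(** * Conditioning of Gaussian vectors *)

Section sine_limits.
Context {R : realType}.

Lemma sin_sub_id (y : R) : `|sin y - y| <= y ^+ 2.
Proof.
wlog y0 : y / 0 <= y.
  move=> h; have [|/ltW y0] := leP 0 y; first exact: h.
  by have := h (- y); rewrite oppr_ge0 y0 sinN sqrrN -opprD normrN; exact.
have [|c] := @MVT_segment _ (fun x => sin x - x) (fun x => cos x - 1) 0 y y0.
- apply: continuous_subspaceT; apply: continuous_sub => [|x]; last exact: cvg_id.
  exact: continuous_sin.
rewrite in_itv/= => /andP[c0 cy]; rewrite sin0 !subr0 => ->.
rewrite normrM (ger0_norm y0) expr2 ler_wpM2r//.
by have := cos_lipschitz c 0; rewrite cos0 subr0 (ger0_norm c0) => /le_trans; exact.
Qed.

(** Moments of the residual are recovered from its trigonometric functions by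
    this approximation of the identity. *)
Lemma cvg_scaled_sin (x : R) :
  (2 * n.+1%:R) * sin (x / (2 * n.+1%:R)) @[n --> \oo] --> x.
Proof.
apply/cvgrPdist_le => e e0; near=> n.
have n0 : 0 < 2 * n.+1%:R :> R by rewrite mulr_gt0.
rewrite distrC [X in `|X|](_ : _ = 2 * n.+1%:R *
  (sin (x / (2 * n.+1%:R)) - x / (2 * n.+1%:R))); last by field; rewrite gt_eqF// ltr0Sn.
rewrite normrM (gtr0_norm n0) -ler_pdivlMl// mulrC.
apply: (le_trans (sin_sub_id _)).
rewrite exprMn [X in X * _]expr2 -mulrA ler_pM2l ?invr_gt0//.
rewrite ler_pdivrMl//.
rewrite -ler_pdivrMr// (@le_trans _ _ n%:R)//.
  by near: n; exact: nbhs_infty_ger.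
by rewrite (@le_trans _ _ n.+1%:R) ?ler_nat// ler_peMl// ler1n.
Unshelve. all: by end_near. Qed.

Lemma scaled_sin_norm (x : R) n :
  `|(2 * n.+1%:R) * sin (x / (2 * n.+1%:R))| <= `|x|.
Proof.
have n0 : 0 < 2 * n.+1%:R :> R by rewrite mulr_gt0.
rewrite normrM (gtr0_norm n0) -ler_pdivlMl//.
have := sin_lipschitz (x / (2 * n.+1%:R)) 0; rewrite sin0 !subr0 => /le_trans; apply.
by rewrite normrM normfV (gtr0_norm n0) mulrC.
Qed.
End sine_limits.

Section gaussian_conditioning.
Context {R : realType} d (Omega : measurableType d) (P : probability Omega R).
Context m (X : Omega -> R) (Y : 'I_m -> Omega -> R).
Hypotheses (LX : L2 P setT X) (LY : forall j, L2 P setT (Y j)).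
Hypothesis gaussXY : forall (u : R) (a : 'I_m -> R),
  centered_gaussian P (fun om => u * X om + \sum_(j < m) a j * Y j om).
Variable b : 'I_m -> R.
Let Z om := \sum_(j < m) b j * Y j om.
Let U om := X om - Z om.
Hypothesis orthU : forall j, dot P setT U (Y j) = 0.

Let V (a : 'I_m -> R) om := \sum_(j < m) a j * Y j om.
Let comb (u : R) a om := u * U om + V a om.

Let LV a : L2 P setT (V a).
Proof. by apply: L2_sum => // j; exact: L2Z. Qed.

Let LU : L2 P setT U. Proof. by apply: L2B => //; exact: LV. Qed.

Let Lcomb u a : L2 P setT (comb u a).
Proof. by apply: L2D => //; exact: L2Z. Qed.

Let gauss_comb u a : centered_gaussian P (comb u a).
Proof.
have := gaussXY u (fun j => a j - u * b j); congr centered_gaussian.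
apply/funext => om; rewrite /comb /U /Z /V mulrBr -addrA; congr (_ + _).
under eq_bigr do rewrite mulrBl.
rewrite sumrB addrC mulr_sumr; congr (_ + _); congr (- _).
by apply: eq_bigr => j _; ring.
Qed.

Let s2 := \int[P]_om (U om ^+ 2).
Let v2 a := \int[P]_om (V a om ^+ 2).

Let orthV a : dot P setT U (V a) = 0.
Proof.
rewrite dotC dot_suml//; last by move=> j; exact: L2Z.
by apply: big1 => j _; rewrite dotZl// dotC orthU mulr0.
Qed.

Let var_comb u a : \int[P]_om (comb u a om ^+ 2) = u ^+ 2 * s2 + v2 a.
Proof.
have -> : \int[P]_om (comb u a om ^+ 2) = dot P setT (comb u a) (comb u a).
  by apply: eq_Rintegral => om _; rewrite expr2.
have -> : s2 = dot P setT U U by apply: eq_Rintegral => om _; rewrite expr2.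
have -> : v2 a = dot P setT (V a) (V a) by apply: eq_Rintegral => om _; rewrite expr2.
by rewrite dot_sqr_comb// orthV mulr0 addr0.
Qed.

Let mU : measurable_fun setT U. Proof. by have [] := LU. Qed.
Let mcomb u a : measurable_fun setT (comb u a). Proof. by have [] := Lcomb u a. Qed.

Let msin : measurable_fun setT (@sin R).
Proof. by apply: continuous_measurable_fun; exact: continuous_sin. Qed.
Let mcos : measurable_fun setT (@cos R).
Proof. by apply: continuous_measurable_fun; exact: continuous_cos. Qed.

Let intsin f : measurable_fun setT f -> P.-integrable setT (EFin \o (fun om => sin (f om))).
Proof. by move=> mf; exact: bounded_measurable_after mf msin (@sin_max R). Qed.
Let intcos f : measurable_fun setT f -> P.-integrable setT (EFin \o (fun om => cos (f om))).
Proof. by move=> mf; exact: bounded_measurable_after mf mcos (@cos_max R). Qed.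

Let e u a := expR (- ((u ^+ 2 * s2 + v2 a) / 2)).

(** The variance of [u * U + V a] is a sum, as [U] is orthogonal to the [Y j], and
    the cosine transform turns this sum into a product. *)
Let int_cos_comb u a c : \int[P]_om cos (comb u a om + c) = cos c * e u a.
Proof.
have i1 := integrableRZ measurableT (cos c) (intcos (mcomb u a)).
have i2 := integrableRZ measurableT (sin c) (intsin (mcomb u a)).
transitivity (\int[P]_om (cos c * cos (comb u a om) - sin c * sin (comb u a om))).
  by apply: eq_Rintegral => om _; rewrite cosD; ring.
rewrite RintegralB// !RintegralZl//; [|exact: intsin|exact: intcos].
rewrite gaussian_cos// gaussian_sin//; last first.
  have := gauss_comb (- u) (fun j => - a j); congr centered_gaussian.
  apply/funext => om; rewrite /comb /V opprD mulNr -sumrN; congr (_ + _).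
  by apply: eq_bigr => j _; rewrite mulNr.
by rewrite var_comb mulr0 subr0.
Qed.

Let int_sin_comb u a c : \int[P]_om sin (comb u a om + c) = sin c * e u a.
Proof.
have := int_cos_comb u a (c - pi / 2); rewrite cosBpihalf => <-.
by apply: eq_Rintegral => om _; rewrite addrA cosBpihalf.
Qed.

Let sin_trig u a c : \int[P]_om (cos (V a om + c) * sin (u * U om)) = 0.
Proof.
have mc w : measurable_fun setT (fun om => comb w a om + c) by exact: measurable_funD.
transitivity (\int[P]_om (2^-1 * (sin (comb u a om + c) - sin (comb (- u) a om + c)))).
  apply: eq_Rintegral => om _; rewrite /comb.
  have -> : u * U om + V a om + c = (V a om + c) + u * U om by ring.
  have -> : - u * U om + V a om + c = (V a om + c) - u * U om by ring.
  by rewrite (sinD (V a om + c)) (sinB (V a om + c)); field.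
rewrite RintegralZl//; last by apply: integrableRB => //; exact: intsin.
rewrite RintegralB//; try exact: intsin.
by rewrite !int_sin_comb /e sqrrN subrr mulr0.
Qed.

Let cos_trig u a c :
  \int[P]_om (cos (V a om + c) * (cos (u * U om) - expR (- (u ^+ 2 * s2 / 2)))) = 0.
Proof.
have mc w : measurable_fun setT (fun om => comb w a om + c) by exact: measurable_funD.
set k := expR _.
transitivity (\int[P]_om (2^-1 * (cos (comb u a om + c) + cos (comb (- u) a om + c)) -
    k * cos (comb 0 a om + c))).
  apply: eq_Rintegral => om _; rewrite /comb mul0r add0r.
  have -> : u * U om + V a om + c = (V a om + c) + u * U om by ring.
  have -> : - u * U om + V a om + c = (V a om + c) - u * U om by ring.
  by rewrite (cosD (V a om + c)) (cosB (V a om + c)); field.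
have i0 := intcos (mc 0).
have i1 := integrableRD measurableT (intcos (mc u)) (intcos (mc (- u))).
rewrite RintegralB//; try exact: integrableRZ.
rewrite !RintegralZl// RintegralD//; try exact: intcos.
rewrite !int_cos_comb /e sqrrN expr0n/= mul0r add0r mulrDl opprD expRD -/k.
by field.
Qed.

Let mY j : measurable_fun setT (Y j). Proof. by have [] := LY j. Qed.

Let mF A : g_sigma_preimage Y A -> measurable A.
Proof. exact: g_sigma_preimage_measurable. Qed.

Let intU : P.-integrable setT (EFin \o U).
Proof. exact: probability_L2_integrable. Qed.

Let muU u : measurable_fun setT (fun om => u * U om).
Proof. exact: measurable_funM. Qed.

(** The residual is centered given [Y]: this holds for its sines, which are
    orthogonal to all trigonometric functions of [Y]. *)
Lemma residual_mean A : g_sigma_preimage Y A -> \int[P]_(om in A) U om = 0.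
Proof.
move=> FA; have mA := mF FA.
have [||||_] := @Rdominated_convergence _ _ _ P A
  (fun n om => (2 * n.+1%:R) * sin (U om / (2 * n.+1%:R))) U (fun om => `|U om|) mA.
- move=> n; apply: measurable_funTS; apply: measurable_funM => //.
  by apply: measurableT_comp => //; exact: measurable_funM.
- by move=> om _; exact: cvg_scaled_sin.
- by apply: integrableS (integrable_norm intU).
- by move=> n om _; exact: scaled_sin_norm.
move=> h; apply: (cvg_unique (@Rhausdorff R) h).
rewrite (_ : (fun n => _) = cst 0); first exact: cvg_cst.
apply/funext => n; set N : R := 2 * n.+1%:R.
have iA : P.-integrable A (EFin \o (fun om => sin (U om / N))).
  by apply: integrableS (intsin _) => //; exact: measurable_funM.
rewrite RintegralZl//.
have := @trig_orthogonal _ _ _ P _ Y mY (fun om => sin (N^-1 * U om)) _ _ A FA.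
have -> : \int[P]_(om in A) sin (U om / N) = \int[P]_(om in A) sin (N^-1 * U om).
  by apply: eq_Rintegral => om _; rewrite mulrC.
move=> ->; first by rewrite mulr0.
- exact: intsin.
- by move=> a c; exact: sin_trig.
Qed.

(** The residual has a constant second moment given [Y]. Its scaled sines have
    this property, since [sin ^+ 2] is an affine function of a cosine, and the
    constant is identified on the whole space. *)
Lemma residual_second_moment A : g_sigma_preimage Y A ->
  \int[P]_(om in A) (U om ^+ 2) = s2 * fine (P A).
Proof.
move=> FA; have mA := mF FA.
pose g n om := ((2 * n.+1%:R) * sin (U om / (2 * n.+1%:R))) ^+ 2.
have cvg_g B : measurable B ->
    \int[P]_(om in B) g n om @[n --> \oo] --> \int[P]_(om in B) (U om ^+ 2).
  move=> mB; have [||||_] := @Rdominated_convergence _ _ _ P B g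
    (fun om => U om ^+ 2) (fun om => U om ^+ 2) mB.
  - move=> n; apply: measurable_funTS; apply: measurable_funX; apply: measurable_funM => //.
    by apply: measurableT_comp => //; exact: measurable_funM.
  - by move=> om _; rewrite expr2; apply: cvgM; exact: cvg_scaled_sin.
  - by have [_] := LU; exact: integrableS.
  - move=> n om _; rewrite /g normrX -[leRHS]real_normK ?num_real//.
    by rewrite lerXn2r ?nnegrE//; exact: scaled_sin_norm.
  exact.
have gE n B : measurable B -> g_sigma_preimage Y B -> \int[P]_(om in B) g n om =
    (2 * n.+1%:R) ^+ 2 / 2 * (1 - expR (- ((n.+1%:R^-1) ^+ 2 * s2 / 2))) * fine (P B).
  move=> mB FB; set u : R := n.+1%:R^-1; set k := expR _.
  have iA : P.-integrable B (EFin \o (fun om => cos (u * U om) - k)).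
    apply: integrableS (integrableRB _ (intcos _) _) => //.
    exact: finite_measure_integrable_cst.
  transitivity (\int[P]_(om in B) ((2 * n.+1%:R) ^+ 2 / 2 * (1 - k) -
      (2 * n.+1%:R) ^+ 2 / 2 * (cos (u * U om) - k))).
    apply: eq_Rintegral => om _; rewrite /g.
    have -> : u * U om = (U om / (2 * n.+1%:R)) *+ 2.
      by rewrite /u mulr2n; field; rewrite gt_eqF// ltr0Sn.
    by rewrite cos_mulr2n cos2sin2; field.
  rewrite RintegralB//; [|exact: finite_measure_integrable_cst|exact: integrableRZ].
  rewrite Rintegral_cst// RintegralZl//.
  rewrite (@trig_orthogonal _ _ _ P _ Y mY (fun om => cos (u * U om) - k)) ?mulr0 ?subr0//.
  - apply: integrableRB => //; first exact: intcos.
    exact: finite_measure_integrable_cst.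
  - by move=> a c; exact: cos_trig.
have FT : g_sigma_preimage Y setT.
  by have [h0 hC _] := smallest_sigma_algebra setT
    (\big[setU/set0]_(i < m) preimage_set_system setT (Y i) measurable);
  rewrite -[setT]setD0; exact: hC.
apply: (cvg_unique (@Rhausdorff R) (cvg_g _ mA)).
rewrite (_ : (fun n => _) = (fun n => \int[P]_om g n om * fine (P A))).
  by apply: cvgM; [exact: cvg_g|exact: cvg_cst].
apply/funext => n; rewrite (gE n A)// (gE n setT)//.
by rewrite probability_setT/= mulr1.
Qed.

End gaussian_conditioning.

Section orthogonal_projection.
Context {R : realType} d (T : measurableType d) (mu : {measure set T -> \bar R}).
Variables (D : set T) (mD : measurable D).

(** Normal equations: a vector orthogonal to the rows of the Gram matrix is the
    coordinate vector of a null function, so it is orthogonal to the right-hand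
    side as well. *)
Lemma exists_projection m (X : T -> R) (Y : 'I_m -> T -> R) :
  L2 mu D X -> (forall j, L2 mu D (Y j)) ->
  exists b : 'I_m -> R, forall j,
    dot mu D (fun x => X x - \sum_(i < m) b i * Y i x) (Y j) = 0.
Proof.
move=> LX LY.
pose G : 'M[R]_m := \matrix_(i, j) dot mu D (Y i) (Y j).
pose c : 'rV[R]_m := \row_j dot mu D X (Y j).
have dotV (v : 'I_m -> R) Z : L2 mu D Z ->
    dot mu D (fun x => \sum_(i < m) v i * Y i x) Z = \sum_(i < m) v i * dot mu D (Y i) Z.
  move=> LZ; rewrite dot_suml//; last by move=> i; exact: L2Z.
  by apply: eq_bigr => i _; rewrite dotZl.
have LV (v : 'I_m -> R) : L2 mu D (fun x => \sum_(i < m) v i * Y i x).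
  by apply: L2_sum => // i; exact: L2Z.
have : (c <= G)%MS.
  rewrite submxE; apply/eqP/matrixP => i j; rewrite !mxE.
  set C := cokermx G.
  pose v k := C k j.
  have Gv k : dot mu D (fun x => \sum_(i < m) v i * Y i x) (Y k) = 0.
    rewrite dotV//.
    have /matrixP/(_ k j) := mulmx_coker G; rewrite !mxE => h0; rewrite -[RHS]h0.
    by apply: eq_bigr => l _; rewrite /v -/C [G k l]mxE mulrC dotC.
  have v0 : dot mu D (fun x => \sum_(i < m) v i * Y i x)
      (fun x => \sum_(i < m) v i * Y i x) = 0.
    rewrite dotV//; apply: big1 => k _.
    by rewrite dotC Gv mulr0.
  have := cauchy_schwarz mD LX (LV v); rewrite v0 mulr0 => h.
  have : dot mu D X (fun x => \sum_(i < m) v i * Y i x) = 0.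
    by apply/eqP; rewrite -sqrf_eq0 eq_le h sqr_ge0.
  rewrite dotC dotV// => h1; rewrite -[RHS]h1; apply: eq_bigr => k _.
  by rewrite /v [c i k]mxE mulrC dotC.
move=> /submxP[b cb]; exists (fun i => b ord0 i) => j.
rewrite dotBl// dotV//.
have /matrixP/(_ ord0 j) := cb; rewrite !mxE => ->.
apply/eqP; rewrite subr_eq0; apply/eqP; apply: eq_bigr => i _.
by rewrite !mxE.
Qed.

End orthogonal_projection.

Section conditional_expectation_uniqueness.
Context {R : realType} d (Omega : measurableType d) (P : probability Omega R).
Variables (F : set (set Omega)) (sF : sigma_algebra setT F) (mF : F `<=` measurable).
Implicit Types X Z : Omega -> R.

Let FI A B : F A -> F B -> F (A `&` B).
Proof.
have [F0 FC FU] := sF.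
have FC' C : F C -> F (~` C) by rewrite -setTD; exact: FC.
move=> FA FB; rewrite -[A]setCK -[B]setCK -setCU -bigcup2E; apply: (FC').
by apply: FU => -[|[|i]] /=; rewrite /bigcup2/=; [exact: FC'|exact: FC'|].
Qed.

(** For rational [q], [Z < q < Z'] is an event of [F] on which [Z] and [Z'] have the
    same integral, hence a null event. *)
Lemma is_conditional_expectation_ae_le X Z Z' :
  is_conditional_expectation P F X Z -> is_conditional_expectation P F X Z' ->
  {ae P, forall om, Z' om <= Z om}.
Proof.
move=> [mZ iZ hZ] [mZ' iZ' hZ'].
pose A (q : rat) := Z @^-1` `]-oo, ratr q[ `&` Z' @^-1` `]ratr q, +oo[.
have FA q : F (A q) by apply: FI; [apply: mZ|apply: mZ']; exact: measurable_itv.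
have mA q : measurable (A q) by exact: mF.
have PA q : P.-negligible (A q).
  have iA : P.-integrable (A q) (EFin \o (fun om => Z' om - Z om)).
    apply: integrableRB => //; [exact: integrableS iZ'|exact: integrableS iZ].
  have mA' : measurable_fun (A q) (EFin \o (fun om => Z' om - Z om)).
    exact: measurable_int iA.
  have pos om : A q om -> 0 < Z' om - Z om.
    by move=> []; rewrite /= !in_itv/= andbT => h1 h2; rewrite subr_gt0 (lt_trans h1).
  have [+ _] := ae_eq_integral_abs P (mA q) mA'.
  have -> : (\int[P]_(x in A q) `|(EFin \o (fun om => (Z' om - Z om)%R)) x| = 0)%E.
    transitivity (\int[P]_(x in A q) ((Z' x)%:E - (Z x)%:E))%E.
      apply: eq_integral => om; rewrite inE => Aom /=.
      by rewrite gtr0_norm ?pos// EFinB.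
    rewrite integralB//; last 2 first.
      exact: integrableS iZ'.
      exact: integrableS iZ.
    rewrite hZ'// hZ// subee// -hZ//.
    by apply: integrable_fin_num => //; exact: integrableS iZ.
  move=> /(_ erefl) h; apply: negligibleS h => om Aom /= /(_ Aom).
  by move=> [h]; have := pos _ Aom; rewrite h ltxx.
have : P.-negligible (\bigcup_(n : nat) (if (unpickle n : option rat) is Some q then A q else set0)).
  by apply: negligible_bigcup => n; case: unpickle => // ; exact: negligible_set0.
apply: negligibleS => om /= /negP; rewrite -ltNge => /rat_in_itvoo[q].
rewrite in_itv/= => /andP[h1 h2]; exists (pickle q); [exact: I|rewrite pickleK].
by split; rewrite /= in_itv/= ?andbT.
Qed.

Lemma is_conditional_expectation_ae_eq X Z Z' :
  is_conditional_expectation P F X Z -> is_conditional_expectation P F X Z' ->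
  {ae P, forall om, Z om = Z' om}.
Proof.
move=> hZ hZ'.
have h1 := is_conditional_expectation_ae_le hZ hZ'.
have h2 := is_conditional_expectation_ae_le hZ' hZ.
by apply: filterS2 h1 h2 => om h1 h2; apply/eqP; rewrite eq_le h1 h2.
Qed.

Lemma conditional_expectation_ae X Z : is_conditional_expectation P F X Z ->
  {ae P, forall om, conditional_expectation P F X om = Z om}.
Proof.
move=> hZ; apply: is_conditional_expectation_ae_eq (hZ).
by apply: xgetPex; exists Z.
Qed.

End conditional_expectation_uniqueness.

Section gaussian_conditional_variance.
Context {R : realType} d (Omega : measurableType d) (P : probability Omega R).
Context m (X : Omega -> R) (Y : 'I_m -> Omega -> R).
Hypotheses (LX : L2 P setT X) (LY : forall j, L2 P setT (Y j)).
Hypothesis gaussXY : forall (u : R) (a : 'I_m -> R),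
  centered_gaussian P (fun om => u * X om + \sum_(j < m) a j * Y j om).

Let gen := \big[setU/set0]_(i < m) preimage_set_system setT (Y i) measurable.

Let Y_gen_measurable i : measurable_fun setT (Y i : g_sigma_algebraType gen -> R).
Proof.
move=> _ B mB; apply: sub_sigma_algebra; rewrite /gen (bigD1 i)//=; left.
by exists B.
Qed.

(** Given [Y], the residual [U] has mean zero and a constant second moment: the
    combination of the [Y i] is the conditional expectation of [X], and the
    constant is its conditional variance. *)
Lemma gaussian_conditional_variance (b : 'I_m -> R) :
  let U := fun om => X om - \sum_(i < m) b i * Y i om in
  (forall j, dot P setT U (Y j) = 0) ->
  {ae P, forall om, conditional_variance P X Y om = dot P setT U U}.
Proof.
move=> U orthU; rewrite /conditional_variance.
set F := g_sigma_preimage Y.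
have sF : sigma_algebra setT F by exact: smallest_sigma_algebra.
have mF : F `<=` measurable.
  by apply: g_sigma_preimage_measurable => j; have [] := LY j.
have LZ : L2 P setT (fun om => \sum_(i < m) b i * Y i om).
  by apply: L2_sum => // i; exact: L2Z.
have LU : L2 P setT U by exact: L2B.
have iX := probability_L2_integrable LX.
have iZ := probability_L2_integrable LZ.
have iU := probability_L2_integrable LU.
have hZ : is_conditional_expectation P F X (fun om => \sum_(i < m) b i * Y i om).
  split => //.
  - move=> B mB; have : measurable_fun setT
        ((fun om => \sum_(i < m) b i * Y i om) : g_sigma_algebraType gen -> R).
      by apply: measurable_sum => i; apply: measurable_funM => //; exact: Y_gen_measurable.
    by move=> /(_ measurableT B mB); rewrite setTI.
  - move=> A FA; have mA := mF _ FA.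
    have iXA : P.-integrable A (EFin \o X) by exact: integrableS iX.
    have iZA : P.-integrable A (EFin \o (fun om => \sum_(i < m) b i * Y i om)).
      exact: integrableS iZ.
    have := residual_mean LX LY gaussXY orthU FA.
    rewrite RintegralB// => /eqP; rewrite subr_eq0 => /eqP h.
    rewrite -[LHS]fineK; last exact: integrable_fin_num.
    rewrite -[RHS]fineK; last exact: integrable_fin_num.
    by rewrite -/(Rintegral _ _ _) -/(Rintegral _ _ _) h.
have ceX := conditional_expectation_ae sF mF hZ.
set Z' := conditional_expectation P F X.
have hZ' : is_conditional_expectation P F X Z' by apply: xgetPex; eexists; exact: hZ.
have mZ' : measurable_fun setT Z'.
  by move=> _ B mB; rewrite setTI; apply: mF; have [h _ _] := hZ'; exact: h.
apply: conditional_expectation_ae => //; split.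
- move=> B mB; have [F0 FC _] := sF; rewrite /preimage/=.
  have [h|h] := pselect (B (dot P setT U U)).
    rewrite (_ : [set _ | _] = setT `\` set0); first exact: FC.
    by rewrite setD0; apply/seteqP; split.
  by rewrite (_ : [set _ | _] = set0)//; apply/seteqP; split.
- exact: finite_measure_integrable_cst.
- move=> A FA; have mA := mF _ FA.
  have mX : measurable_fun setT X by have [] := LX.
  have := residual_second_moment LX LY gaussXY orthU FA.
  have -> : \int[P]_om (U om ^+ 2) = dot P setT U U.
    by apply: eq_Rintegral => om _; rewrite expr2.
  move=> h; rewrite integral_cst//.
  have PA : P A \is a fin_num by exact: fin_num_measure.
  transitivity ((dot P setT U U * fine (P A))%:E); first by rewrite EFinM; congr (_ * _)%E; apply/esym/fineK.
  rewrite -h /Rintegral fineK; last first.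
    by apply: integrable_fin_num => //; have [_] := LU; exact: integrableS.
  apply: ae_eq_integral => //.
  + apply/measurable_EFinP; apply: measurable_funX; apply: measurable_funTS.
    by have [] := LU.
  + apply/measurable_EFinP; apply: measurable_funX; apply: measurable_funTS.
    exact: measurable_funB.
  + by apply: filterS ceX => om h' _; rewrite /U -h'.
Qed.

End gaussian_conditional_variance.

(** * The Sturm-Liouville problem on an interval *)

Section interval_calculus.
Context {R : realType} (a b : R) (ab : a < b).
Local Notation leb := (@lebesgue_measure R).
Implicit Types f F : R -> R.

Lemma integrable_within f : {within `[a, b], continuous f} ->
  leb.-integrable `[a, b] (EFin \o f).
Proof. by apply: continuous_compact_integrable; exact: segment_compact. Qed.

Lemma measurable_within f : {within `[a, b], continuous f} ->
  measurable_fun `[a, b] f.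
Proof. exact: subspace_continuous_measurable_fun. Qed.

Lemma Rintegral_derivative f F : {within `[a, b], continuous f} ->
  {within `[a, b], continuous F} ->
  (forall x, x \in `]a, b[ -> is_derive x (1 : R) F (f x)) ->
  \int[leb]_(x in `[a, b]) f x = F b - F a.
Proof.
move=> cf cF dF; rewrite /Rintegral (@continuous_FTC2 _ f F)//.
- have /continuous_within_itvP[//|_ h1 h2] := cF.
  by split => // x /dF[].
- by move=> x /dF[_ <-]; rewrite derive1E.
Qed.

Lemma constant_of_derive0 f : {within `[a, b], continuous f} ->
  (forall x, x \in `]a, b[ -> is_derive x (1 : R) f 0) ->
  forall x, x \in `[a, b] -> f x = f a.
Proof.
move=> cf df x; rewrite in_itv/= => /andP[ax xb].
have sub : `[a, x] `<=` `[a, b].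
  by apply: subset_itvl; rewrite bnd_simp.
have [||y _] := @MVT_segment _ f (fun=> 0) a x ax.
- move=> y; rewrite in_itv/= => /andP[ay yx]; apply: df.
  by rewrite in_itv/= ay (lt_le_trans yx).
- exact: continuous_subspaceW cf.
- by rewrite mul0r => /eqP; rewrite subr_eq0 => /eqP.
Qed.

End interval_calculus.

Section sturm_liouville.
Context {R : realType} (L : R) (L_gt0 : 0 < L) (bc : boundary_condition).
Local Notation leb := (@lebesgue_measure R).

Record twice_differentiable (f df ddf : R -> R) : Prop := TwiceDifferentiable {
  td_cont : {within `[0, L], continuous f};
  td_dcont : {within `[0, L], continuous df};
  td_ddcont : {within `[0, L], continuous ddf};
  td_derive : forall x, x \in `]0, L[ -> is_derive x (1 : R) f (df x);
  td_dderive : forall x, x \in `]0, L[ -> is_derive x (1 : R) df (ddf x) }.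

Definition boundary_vanishes (f df : R -> R) :=
  match bc with
  | Dirichlet => f 0 = 0 /\ f L = 0
  | Neumann => df 0 = 0 /\ df L = 0
  end.

(** Both boundary conditions make the Laplacian symmetric. *)
Lemma green_identity f df ddf g dg ddg :
  twice_differentiable f df ddf -> twice_differentiable g dg ddg ->
  boundary_vanishes f df -> boundary_vanishes g dg ->
  \int[leb]_(x in `[0, L]) (ddf x * g x) = \int[leb]_(x in `[0, L]) (f x * ddg x).
Proof.
move=> [cf cdf cddf hf hdf] [cg cdg cddg hg hdg] bf bg.
have c1 := @continuous_mul _ (subspace `[0, L]) _ _ cddf cg.
have c2 := @continuous_mul _ (subspace `[0, L]) _ _ cf cddg.
have c3 := @continuous_mul _ (subspace `[0, L]) _ _ cdf cg.
have c4 := @continuous_mul _ (subspace `[0, L]) _ _ cf cdg.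
have := @Rintegral_derivative _ 0 L L_gt0
  (fun x => ddf x * g x - f x * ddg x) (fun x => df x * g x - f x * dg x).
rewrite RintegralB//; [|exact: integrable_within|exact: integrable_within] => h.
have der x : x \in `]0, L[ -> is_derive x (1 : R)
    (fun x => df x * g x - f x * dg x) (ddf x * g x - f x * ddg x).
  move=> x0L; have h1 := hf x x0L; have h2 := hdf x x0L.
  have h3 := hg x x0L; have h4 := hdg x x0L.
  by derive_tac; ring.
apply/eqP; rewrite -subr_eq0; apply/eqP.
rewrite (h (@continuous_sub _ (subspace `[0, L]) _ _ c1 c2)
  (@continuous_sub _ (subspace `[0, L]) _ _ c3 c4) der).
by move: bf bg; rewrite /boundary_vanishes; case: bc => -[-> ->] [-> ->];
  rewrite !(mul0r, mulr0) !subr0.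
Qed.

Lemma eigen_equation_twice_differentiable mu phi : eigen_equation L bc mu phi ->
  exists2 dphi, twice_differentiable phi dphi (fun x => - (2 * mu) * phi x) &
    boundary_vanishes phi dphi.
Proof.
move=> [dphi [c dc d dd bphi]]; exists dphi => //; split => //.
- by apply: (@continuous_mul _ (subspace `[0, L])) => //; exact: continuous_const.
- move=> x /dd[der h]; split => //; rewrite -derive1E.
  have -> : derive1 dphi x = - 2 * - (2^-1 * derive1 dphi x) by field.
  by rewrite h; ring.
Qed.

(** [sin (k pi x / L)] or [cos (k pi x / L)]. *)
Definition sturm_mode (k : nat) (x : R) : R :=
  match bc with
  | Dirichlet => sin (k%:R * pi / L * x)
  | Neumann => cos (k%:R * pi / L * x)
  end.

Definition mode_derivative (k : nat) (x : R) : R :=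
  match bc with
  | Dirichlet => (k%:R * pi / L) * cos (k%:R * pi / L * x)
  | Neumann => - (k%:R * pi / L) * sin (k%:R * pi / L * x)
  end.

Definition mode_eigenvalue (k : nat) : R := (k%:R * pi / L) ^+ 2 / 2.

Lemma sin_natmul_pi (k : nat) : sin (k%:R * pi) = 0 :> R.
Proof.
have := alternatingn (@sinDpi R) k 0; rewrite add0r sin0 mulr0.
by rewrite mulr_natl.
Qed.

Lemma sin_eq0_natmul_pi (y : R) : 0 <= y -> sin y = 0 -> exists k : nat, y = k%:R * pi.
Proof.
move=> y0 siny; have pi0 := pi_gt0 R.
have yp : 0 <= y / pi by rewrite divr_ge0// ltW.
exists (Num.truncn (y / pi)); set k := Num.truncn _.
have /andP[k1 k2] := truncn_itv yp; rewrite -/k in k1 k2.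
move: k1 k2; rewrite ler_pdivlMr// ltr_pdivrMr// => k1 k2.
have := alternatingn (@sinDpi R) k (y - k%:R * pi).
rewrite -(mulr_natl pi k) subrK siny => /esym/eqP; rewrite mulf_eq0 signr_eq0/= => /eqP s0.
move: k1; rewrite le_eqVlt => /orP[/eqP <-//|k1].
have : 0 < sin (y - k%:R * pi).
  apply: sin_gt0_pi; rewrite subr_gt0 k1/= ltrBlDl.
  by move: k2; rewrite -natr1 mulrDl mul1r.
by rewrite s0 ltxx.
Qed.

Lemma derive_mode k (x : R) : is_derive x (1 : R) (sturm_mode k) (mode_derivative k x).
Proof.
rewrite /sturm_mode /mode_derivative; case: bc; derive_tac; ring.
Qed.

Lemma derive_mode_derivative k (x : R) :
  is_derive x (1 : R) (mode_derivative k) (- (2 * mode_eigenvalue k) * sturm_mode k x).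
Proof.
rewrite /sturm_mode /mode_derivative /mode_eigenvalue; case: bc; derive_tac; field; rewrite gt_eqF//.
Qed.

Lemma mode_continuous k : continuous (sturm_mode k).
Proof. exact: (derive_continuous (derive_mode k)). Qed.

Lemma mode_derivative_continuous k : continuous (mode_derivative k).
Proof. exact: (derive_continuous (derive_mode_derivative k)). Qed.

Lemma mode_twice_differentiable k : twice_differentiable (sturm_mode k) (mode_derivative k)
  (fun x => - (2 * mode_eigenvalue k) * sturm_mode k x).
Proof.
split.
- by apply: continuous_subspaceT; exact: mode_continuous.
- by apply: continuous_subspaceT; exact: mode_derivative_continuous.
- apply: continuous_subspaceT; apply: continuous_mul; last exact: mode_continuous.
  exact: continuous_const.
- by move=> x _; exact: derive_mode.
- by move=> x _; exact: derive_mode_derivative.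
Qed.

Lemma mode_boundary k : boundary_vanishes (sturm_mode k) (mode_derivative k).
Proof.
rewrite /boundary_vanishes /sturm_mode /mode_derivative; case: bc;
  rewrite mulr0 ?sin0 ?mulr0 divfK ?gt_eqF// sin_natmul_pi ?mulr0//.
Qed.

Lemma mode_eigen_equation k : eigen_equation L bc (mode_eigenvalue k) (sturm_mode k).
Proof.
exists (mode_derivative k); split.
- by apply: continuous_subspaceT; exact: mode_continuous.
- by apply: continuous_subspaceT; exact: mode_derivative_continuous.
- by move=> x _; exact: derive_mode.
- move=> x _; have [h1 h2] := derive_mode_derivative k x; split => //.
  by rewrite derive1E h2; field.
- exact: mode_boundary.
Qed.

Lemma mode_sqr_integral k : bc = Neumann \/ (0 < k)%N ->
  L / 2 <= \int[leb]_(x in `[0, L]) (sturm_mode k x ^+ 2).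
Proof.
have [->|k0 _] := posnP k.
  case => // bcN; rewrite /sturm_mode bcN.
  under eq_Rintegral do rewrite !mul0r cos0 expr1n.
  rewrite Rintegral_cst//= lebesgue_measure_itv/= lte_fin L_gt0 oppr0 adde0/=.
  by rewrite mul1r ler_pdivrMr// ler_pMr// ler1n.
set c : R := k%:R * pi / L.
have c0 : c != 0 by rewrite gt_eqF// divr_gt0// mulr_gt0 ?pi_gt0// ltr0n.
have cL : c * L = k%:R * pi by rewrite /c divfK// gt_eqF.
pose s : R := match bc with Dirichlet => -1 | Neumann => 1 end.
pose F x := x / 2 + s * (sin (c * x) * cos (c * x) / (2 * c)).
have dF x : is_derive x (1 : R) F (sturm_mode k x ^+ 2).
  have -> : sturm_mode k x ^+ 2 = (cos (c * x) ^+ 2 + sin (c * x) ^+ 2) / 2 +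
      s * (cos (c * x) ^+ 2 - sin (c * x) ^+ 2) / 2.
    by rewrite /sturm_mode /s -/c; case: bc; field.
  by rewrite cos2Dsin2 /F; derive_tac; field.
rewrite (@Rintegral_derivative _ 0 L L_gt0 _ F _ _ (fun x _ => dF x)).
- rewrite /F cL sin_natmul_pi !(mulr0, mul0r) sin0 !(mulr0, mul0r) !addr0 subr0.
  exact: lexx.
- by apply: continuous_subspaceT; apply: continuous_pow; exact: mode_continuous.
- by apply: continuous_subspaceT; exact: derive_continuous dF.
Qed.

End sturm_liouville.

(** * Classification of the eigenpairs *)

Section eigenfunctions.
Context {R : realType} (L : R) (L_gt0 : 0 < L) (bc : boundary_condition).
Local Notation leb := (@lebesgue_measure R).
Local Notation mode := (sturm_mode L bc).

Definition admissible (k : nat) := bc = Neumann \/ (0 < k)%N.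

Lemma eq_integral_itv (f g : R -> R) : (forall x, x \in `[0, L] -> f x = g x) ->
  \int[leb]_(x in `[0, L]) f x = \int[leb]_(x in `[0, L]) g x.
Proof. by move=> fg; apply: eq_Rintegral => x; rewrite inE => /fg. Qed.

(** The integral of [(phi' phi)'] vanishes, and it is the integral of
    [phi' ^+ 2] minus [2 * mu]. *)
Lemma eigenvalue_ge0 mu phi : eigen_equation L bc mu phi ->
  \int[leb]_(x in `[0, L]) (phi x * phi x) = 1 -> 0 <= mu.
Proof.
move=> /eigen_equation_twice_differentiable[dphi [c dc ddc d dd] bv] phi1.
have c1 := @continuous_mul _ (subspace `[0, L]) _ _ dc dc.
have c2 := @continuous_mul _ (subspace `[0, L]) _ _ ddc c.
have der x : x \in `]0, L[ -> is_derive x (1 : R)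
    (fun x => dphi x * phi x) (- (2 * mu) * phi x * phi x + dphi x * dphi x).
  by move=> x0L; have h1 := d x x0L; have h2 := dd x x0L; derive_tac.
have := Rintegral_derivative L_gt0 (@continuous_add _ (subspace `[0, L]) _ _ c2 c1)
  (@continuous_mul _ (subspace `[0, L]) _ _ dc c) der.
rewrite RintegralD//; [|exact: integrable_within|exact: integrable_within].
have -> : \int[leb]_(x in `[0, L]) (- (2 * mu) * phi x * phi x) = - (2 * mu).
  under eq_Rintegral do rewrite -mulrA.
  rewrite RintegralZl ?phi1 ?mulr1//.
  exact: integrable_within (@continuous_mul _ (subspace `[0, L]) _ _ c c).
have -> : dphi L * phi L - dphi 0 * phi 0 = 0.
  by move: bv; rewrite /boundary_vanishes; case: bc => -[-> ->]; rewrite ?mulr0 ?mul0r subrr.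
have : 0 <= \int[leb]_(x in `[0, L]) (dphi x * dphi x).
  by apply: Rintegral_ge0 => x _; rewrite -expr2 sqr_ge0.
lra.
Qed.

Lemma mode_norm_le k A phi : admissible k ->
  (forall x, x \in `[0, L] -> phi x = A * mode k x) ->
  \int[leb]_(x in `[0, L]) (phi x * phi x) = 1 -> A ^+ 2 <= 2 / L.
Proof.
move=> adm phiE phi1; have := mode_sqr_integral L_gt0 adm.
have cm : {within `[0, L], continuous (fun x => mode k x ^+ 2)}.
  by apply: continuous_subspaceT; apply: continuous_pow; exact: mode_continuous.
move: phi1; rewrite (@eq_integral_itv _ (fun x => A ^+ 2 * mode k x ^+ 2)); last first.
  by move=> x /phiE ->; ring.
rewrite RintegralZl//; last exact: integrable_within.
set I := \int[_]_(x in _) _ => AI IL.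
have := ler_wpM2l (sqr_ge0 A) IL; rewrite AI mulrA ler_pdivrMr// mul1r => h.
by rewrite ler_pdivlMr.
Qed.

(** The Wronskians of [phi] with the cosine and sine solutions are constant, so
    [phi] is their combination with coefficients [phi 0] and [phi' 0]. The
    condition at [0] removes one of them, and the condition at [L] quantizes the
    frequency [w]. *)
Lemma eigenfunction_form mu phi : eigen_equation L bc mu phi ->
  \int[leb]_(x in `[0, L]) (phi x * phi x) = 1 ->
  exists k A, [/\ admissible k, mu = mode_eigenvalue L k &
    forall x, x \in `[0, L] -> phi x = A * mode k x].
Proof.
move=> eqphi phi1; have mu0 := eigenvalue_ge0 eqphi phi1.
move: (eqphi) => /eigen_equation_twice_differentiable[dphi [c dc ddc d dd] bv].
pose w := Num.sqrt (2 * mu).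
have w2 : 2 * mu = w ^+ 2 by rewrite sqr_sqrtr// mulr_ge0.
have w_ge0 : 0 <= w by exact: sqrtr_ge0.
(* [S] is the solution with [S 0 = 0] and derivative [1] at [0], also for [w = 0]. *)
pose S x := if w == 0 then x else sin (w * x) / w.
pose C x := cos (w * x).
have wS x : w * S x = sin (w * x).
  by rewrite /S; case: eqVneq => [->|w0]; [rewrite !mul0r sin0|field].
have dS (x : R) : is_derive x (1 : R) S (C x).
  rewrite /S /C; case: eqVneq => [->|w0]; first by rewrite mul0r cos0; exact: derive_idfun.
  by derive_tac; field.
have dC (x : R) : is_derive x (1 : R) C (- w ^+ 2 * S x).
  have -> : - w ^+ 2 * S x = - w * sin (w * x) by rewrite -wS; ring.
  by rewrite /C; derive_tac; ring.
have CS x : C x ^+ 2 + w ^+ 2 * S x ^+ 2 = 1.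
  by rewrite -exprMn wS cos2Dsin2.
have cC : {within `[0, L], continuous C} by apply: continuous_subspaceT; exact: derive_continuous dC.
have cS : {within `[0, L], continuous S} by apply: continuous_subspaceT; exact: derive_continuous dS.
have cw2 : {within `[0, L], continuous (fun x => w ^+ 2 * phi x)}.
  by apply: (@continuous_mul _ (subspace `[0, L])) => //; exact: continuous_const.
have S0 : S 0 = 0 by rewrite /S; case: eqVneq => // _; rewrite mulr0 sin0 mul0r.
have C0 : C 0 = 1 by rewrite /C mulr0 cos0.
have h1 x : x \in `[0, L] -> phi x * C x - dphi x * S x = phi 0.
  move=> x0L; have der y : y \in `]0, L[ ->
      is_derive y (1 : R) (fun x => phi x * C x - dphi x * S x) 0.
    move=> y0L; have e1 := d y y0L; have e2 := dd y y0L; have e3 := dS y; have e4 := dC y.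
    by derive_tac; rewrite w2; ring.
  have := constant_of_derive0 (@continuous_sub _ (subspace `[0, L]) _ _
      (@continuous_mul _ (subspace `[0, L]) _ _ c cC)
      (@continuous_mul _ (subspace `[0, L]) _ _ dc cS)) der x0L.
  by rewrite /from_subspace S0 C0 mulr1 mulr0 subr0.
have h2 x : x \in `[0, L] -> w ^+ 2 * phi x * S x + dphi x * C x = dphi 0.
  move=> x0L; have der y : y \in `]0, L[ ->
      is_derive y (1 : R) (fun x => w ^+ 2 * phi x * S x + dphi x * C x) 0.
    move=> y0L; have e1 := d y y0L; have e2 := dd y y0L; have e3 := dS y; have e4 := dC y.
    by derive_tac; rewrite w2; ring.
  have := constant_of_derive0 (@continuous_add _ (subspace `[0, L]) _ _
      (@continuous_mul _ (subspace `[0, L]) _ _ cw2 cS)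
      (@continuous_mul _ (subspace `[0, L]) _ _ dc cC)) der x0L.
  by rewrite /from_subspace S0 C0 mulr1 mulr0 add0r.
have phiE x : x \in `[0, L] -> phi x = phi 0 * C x + dphi 0 * S x.
  move=> x0L; rewrite -(h1 x x0L) -(h2 x x0L) -[LHS]mulr1 -(CS x); ring.
have dphiE x : x \in `[0, L] -> dphi x = dphi 0 * C x - w ^+ 2 * S x * phi 0.
  move=> x0L; rewrite -(h1 x x0L) -(h2 x x0L) -[LHS]mulr1 -(CS x); ring.
have L0L : L \in `[0, L] by rewrite in_itv/= lexx ltW.
have phi_neq0 : ~ (forall x, x \in `[0, L] -> phi x = 0).
  move=> h; move: phi1; rewrite (@eq_integral_itv _ (fun=> 0)).
    by rewrite Rintegral_cst//= mul0r => /esym/eqP; rewrite oner_eq0.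
  by move=> x /h ->; rewrite mulr0.
have wL k : w * L = k%:R * pi -> mu = mode_eigenvalue L k /\ w = k%:R * pi / L.
  move=> h; have -> : w = k%:R * pi / L by rewrite -h mulfK// gt_eqF.
  split => //; have : mu = w ^+ 2 / 2 by rewrite -w2; field.
  by move=> ->; rewrite /mode_eigenvalue -h mulfK// gt_eqF.
have wL0 : 0 <= w * L by rewrite mulr_ge0// ltW.
have swL0 : sin (w * L) = 0 -> exists k : nat, w * L = k%:R * pi.
  exact: sin_eq0_natmul_pi.
rewrite /admissible /sturm_mode; move: bv; rewrite /boundary_vanishes; case: bc => -[b0 bL].
- have phiE' x : x \in `[0, L] -> phi x = dphi 0 * S x.
    by move=> /phiE; rewrite b0 mul0r add0r.
  have d0 : dphi 0 != 0.
    apply/eqP => d0; apply: phi_neq0 => x /phiE' ->; by rewrite d0 mul0r.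
  have SL : S L = 0.
    by move: bL; rewrite phiE'// => /eqP; rewrite mulf_eq0 (negbTE d0)/= => /eqP.
  have w0 : w != 0.
    by apply: contraTneq L_gt0 => w0; move: SL; rewrite /S w0 eqxx => ->; rewrite ltxx.
  have [|k wk] := swL0; first by rewrite -wS SL mulr0.
  have [muk wE] := wL _ wk.
  exists k, (dphi 0 / w); split => //.
  + right; rewrite lt0n; apply: contra_neq w0 => k0.
    by rewrite wE k0 !mul0r.
  + move=> x /phiE' ->; rewrite -wE /S (negbTE w0); field; exact: w0.
- have d0 x : x \in `[0, L] -> phi x = phi 0 * C x.
    by move=> /phiE; rewrite b0 mul0r addr0.
  have p0 : phi 0 != 0.
    apply/eqP => p0; apply: phi_neq0 => x /d0 ->; by rewrite p0 mul0r.
  have [|k wk] := swL0.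
    move: bL; rewrite dphiE// b0 mul0r sub0r => /eqP; rewrite oppr_eq0 mulf_eq0 (negbTE p0) orbF.
    rewrite expr2 -mulrA wS mulf_eq0 => /orP[/eqP ->|/eqP//].
    by rewrite mul0r sin0.
  have [muk wE] := wL _ wk.
  exists k, (phi 0); split => //; first by left.
  by move=> x /d0 ->; rewrite -wE.
Qed.

End eigenfunctions.

Section eigenbasis.
Context {R : realType} (L : R) (L_gt0 : 0 < L) (bc : boundary_condition).
Local Notation leb := (@lebesgue_measure R).
Local Notation mode := (sturm_mode L bc).
Variables (lam : nat -> R) (f : nat -> R -> R) (lam_f : eigenpairs L bc lam f).

Lemma mode_eigenvalue_lt j k : (j < k)%N -> mode_eigenvalue L j < mode_eigenvalue L k :> R.
Proof.
move=> jk; rewrite /mode_eigenvalue ltr_pM2r ?invr_gt0// ltrXn2r//.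
- by rewrite divr_ge0 ?mulr_ge0 ?pi_ge0// ltW.
- by rewrite ltr_pM2r ?invr_gt0// ltr_pM2r ?pi_gt0// ltr_nat.
Qed.

Lemma mode_eigenvalue_inj j k : mode_eigenvalue L j = mode_eigenvalue L k :> R -> j = k.
Proof.
move=> jk; have [h|h|//] := ltngtP j k.
- by have := mode_eigenvalue_lt h; rewrite jk ltxx.
- by have := mode_eigenvalue_lt h; rewrite jk ltxx.
Qed.

(** The eigenpairs are the modes, up to a bounded normalising factor and to a
    relabelling [ix] that only skips frequencies forward. *)
Lemma eigenbasis_form : exists (ix : nat -> nat) (A : nat -> R),
  [/\ forall n, [/\ admissible bc (ix n), lam n = mode_eigenvalue L (ix n),
        A n ^+ 2 <= 2 / L & forall x, x \in `[0, L] -> f n x = A n * mode (ix n) x],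
      forall n, (n <= ix n)%N, forall n, A n != 0 &
      forall k, admissible bc k -> exists n, ix n = k].
Proof.
have [eqf homlam orth compl] := lam_f.
have norm1 n : \int[leb]_(x in `[0, L]) (f n x * f n x) = 1 by rewrite orth eqxx.
have /choice[ix hix] n := eigenfunction_form L_gt0 (eqf n) (norm1 n).
have /choice[A hA] := hix.
exists ix, A.
have fE n x : x \in `[0, L] -> f n x = A n * mode (ix n) x by have [_ _] := hA n; exact.
have adm n : admissible bc (ix n) by have [] := hA n.
have lamE n : lam n = mode_eigenvalue L (ix n) by have [] := hA n.
have A0 n : A n != 0.
  apply/eqP => A0; have := norm1 n; rewrite (@eq_integral_itv _ L _ (fun=> 0)).
    by rewrite Rintegral_cst//= mul0r => /esym/eqP; rewrite oner_eq0.
  by move=> x /fE ->; rewrite A0 !mul0r.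
have cm j k : {within `[0, L], continuous (fun x => mode j x * mode k x)}.
  by apply: continuous_subspaceT; apply: continuous_mul; exact: mode_continuous.
have int_ff n m : \int[leb]_(x in `[0, L]) (f n x * f m x) =
    A n * A m * \int[leb]_(x in `[0, L]) (mode (ix n) x * mode (ix m) x).
  rewrite (@eq_integral_itv _ L _ (fun x => A n * A m * (mode (ix n) x * mode (ix m) x))).
    by rewrite RintegralZl//; exact: integrable_within.
  by move=> x x0L; rewrite !fE//; ring.
have mode2 k : admissible bc k -> \int[leb]_(x in `[0, L]) (mode k x * mode k x) != 0.
  move=> ak; rewrite gt_eqF//.
  have := mode_sqr_integral L_gt0 ak; under eq_Rintegral do rewrite expr2.
  by apply: lt_le_trans; rewrite divr_gt0.
have inj n m : ix n = ix m -> n = m.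
  move=> nm; apply/eqP; rewrite -[_ == _]negbK; apply/negP => nm'.
  have := orth n m; rewrite (negbTE nm') int_ff nm => /eqP.
  by rewrite !mulf_eq0 !(negbTE (A0 _))/= (negbTE (mode2 _ (adm m))).
have mono n : (ix n < ix n.+1)%N.
  have := homlam n n.+1 (leqnSn n); rewrite !lamE.
  have [//|h|h] := ltngtP (ix n) (ix n.+1).
    by rewrite leNgt mode_eigenvalue_lt.
  by move/inj: h => /eqP; rewrite -[n.+1]addn1 -{1}[n]addn0 eqn_add2l.
split => //.
- move=> n; split; [exact: adm|exact: lamE| |exact: fE].
  exact: (mode_norm_le L_gt0 (adm n) (fE n) (norm1 n)).
- by elim=> // n ih; exact: leq_ltn_trans ih (mono n).
- move=> k ak; have [//|nk] := pselect (exists n, ix n = k).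
  have : forall x, x \in `[0, L] -> mode k x = 0.
    apply: (compl _ _ (mode_eigen_equation L_gt0 bc k)) => n.
    have ne : mode_eigenvalue L k - lam n != 0 :> R.
      rewrite subr_eq0 lamE; apply/eqP => /mode_eigenvalue_inj h; apply: nk.
      by exists n.
    have [df tdf bf] := eigen_equation_twice_differentiable (eqf n).
    have := green_identity L_gt0 (mode_twice_differentiable L_gt0 bc k) tdf
      (mode_boundary L_gt0 bc k) bf.
    have cmf : leb.-integrable `[0, L] (EFin \o (fun x => mode k x * f n x)).
      apply: integrable_within; apply: (@continuous_mul _ (subspace `[0, L])).
        by apply: continuous_subspaceT; exact: mode_continuous.
      by have [] := tdf.
    rewrite (_ : (fun x => - (2 * mode_eigenvalue L k) * mode k x * f n x) =
      (fun x => - (2 * mode_eigenvalue L k) * (mode k x * f n x))); last first.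
      by apply/funext => x; rewrite -mulrA.
    rewrite (_ : (fun x => mode k x * (- (2 * lam n) * f n x)) =
      (fun x => - (2 * lam n) * (mode k x * f n x))); last first.
      by apply/funext => x; ring.
    rewrite !RintegralZl// => h; apply: (mulfI ne).
    by rewrite mulr0; move: h; set I := \int[_]_(_ in _) _ => h; lra.
  move=> h; have := mode2 k ak; rewrite (@eq_integral_itv _ L _ (fun=> 0)).
    by rewrite Rintegral_cst//= mul0r eqxx.
  by move=> x /h ->; rewrite mulr0.
Qed.

End eigenbasis.

(** * Completeness of the eigenfunctions *)

Section completeness.
Context {R : realType} (L : R) (L_gt0 : 0 < L) (bc : boundary_condition).
Local Notation leb := (@lebesgue_measure R).
Local Notation mode := (sturm_mode L bc).
Variables (lam : nat -> R) (f : nat -> R -> R) (lam_f : eigenpairs L bc lam f).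
Variable e : R -> R.
Hypothesis ce : {within `[0, L], continuous e}.
Hypothesis ef0 : forall n, \int[leb]_(x in `[0, L]) (e x * f n x) = 0.

Let cont_em k : {within `[0, L], continuous (fun x => e x * mode k x)}.
Proof.
apply: (@continuous_mul _ (subspace `[0, L])) => //.
by apply: continuous_subspaceT; exact: mode_continuous.
Qed.

Let em0 k : \int[leb]_(x in `[0, L]) (e x * mode k x) = 0.
Proof.
have [ix [A [h1 _ A0 h3]]] := eigenbasis_form L_gt0 lam_f.
have [adm|nadm] := pselect (admissible bc k).
  have [n ixn] := h3 k adm; have [_ _ _ fE] := h1 n.
  have := ef0 n; rewrite (@eq_integral_itv _ L _ (fun x => A n * (e x * mode k x))).
    rewrite RintegralZl//; last exact: integrable_within.
    by move=> /eqP; rewrite mulf_eq0 (negbTE (A0 n))/= => /eqP.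
  by move=> x /fE ->; rewrite ixn; ring.
have k0 : k = 0%N by apply/eqP; rewrite -leqn0 leqNgt; apply/negP => k0; apply: nadm; right.
have bcD : bc = Dirichlet by case: bc nadm => // nadm; exfalso; apply: nadm; left.
rewrite (@eq_integral_itv _ L _ (fun=> 0)); first by rewrite Rintegral_cst//= mul0r.
by move=> x _; rewrite /sturm_mode bcD k0 !mul0r sin0 mulr0.
Qed.

Let W k := (fun x => e x * mode k x) \_ `[0, L].

Let intW k : leb.-integrable setT (EFin \o W k).
Proof.
have := integrable_within (@cont_em k); rewrite integrable_mkcond//.
by rewrite restrict_EFin.
Qed.

Let c (x : R) := cos (pi / L * x).

Let ann1 : annihilator leb W (cst 1).
Proof.
split; first exact: bounded_measurable_cst.
move=> k; under eq_Rintegral do rewrite mul1r.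
by rewrite -Rintegral_mkcond.
Qed.

Let M := multiplier leb W.
Let algM : bounded_limit_algebra M := multiplier_algebra intW.

(** At [k = 0] the predecessor frequency is [- 1]: it is [1] up to the parity sign
    of the mode. *)
Let mode_step k x : mode k x * c x =
  2^-1 * (mode k.+1 x + (if bc is Dirichlet then - 1 else 1) ^+ (k == 0%N) * mode (if k is j.+1 then j else 1%N) x).
Proof.
rewrite /sturm_mode /c; case: k => [|k] /=.
- by case: bc; rewrite ?mul1r ?mul0r ?sin0 ?cos0 ?expr1 ?mul1r ?mulN1r ?subrr ?mulr0//; field.
have E1 : k.+2%:R * pi / L * x = k.+1%:R * pi / L * x + pi / L * x.
  by rewrite -[k.+2%:R]natr1; ring.
have E2 : k%:R * pi / L * x = k.+1%:R * pi / L * x - pi / L * x.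
  by rewrite -[k.+1%:R]natr1; ring.
rewrite E1 E2 expr0; set a := k.+1%:R * pi / L * x; set b := pi / L * x.
by case: bc; rewrite ?(sinD a b) ?(sinB a b) ?(cosD a b) ?(cosB a b); field.
Qed.

Let cos_multiplier : M c.
Proof.
have bc' : bounded_measurable c.
  split; last by exists 1 => x; exact: cos_max.
  apply: continuous_measurable_fun.
  by apply: (derive_continuous (a := fun x => - (pi / L) * sin (pi / L * x))) => x; derive_tac; ring.
split => // g [bg g0]; split; first exact: bounded_measurableM.
move=> k; set s : R := (if bc is Dirichlet then - 1 else 1) ^+ (k == 0%N).
set j := if k is j.+1 then j else 1%N.
have -> : (fun x => (g \* c) x * W k x) = (fun x => 2^-1 * (g x * W k.+1 x + s * (g x * W j x))).
  apply/funext => x; rewrite /W /= !patchE; case: ifP => _; last by rewrite !mulr0 addr0 mulr0.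
  have := mode_step k x; rewrite -/s -/j => h.
  rewrite [LHS](_ : _ = g x * e x * (mode k x * c x)); last by ring.
  by rewrite h; ring.
have ig i : leb.-integrable setT (EFin \o (fun x => g x * W i x)).
  exact: bounded_measurable_integrable.
have isg := integrableRZ measurableT s (ig j).
rewrite RintegralZl//; last exact: integrableRD.
by rewrite RintegralD// RintegralZl// !g0 mulr0 addr0 mulr0.
Qed.

(** The frequency of a mode without zeros in the interval. *)
Let k0 : nat := if bc is Dirichlet then 1 else 0.

Let mode_gt0 x : x \in `]0, L[ -> 0 < mode k0 x.
Proof.
rewrite in_itv/= => /andP[x0 xL]; rewrite /sturm_mode /k0; case: bc.
  rewrite mul1r sin_gt0_pi// mulr_gt0 ?divr_gt0 ?pi_gt0//=.
  by rewrite -[ltRHS]mulr1 -mulrA ltr_pM2l ?pi_gt0// mulrC ltr_pdivrMr// mul1r.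
by rewrite !mul0r cos0.
Qed.

(** [cos (pi x / L)] decreases, so [[0, a[] is a superlevel set of a multiplier. *)
Let initial_integral a : a \in `]0, L[ -> \int[leb]_(x in `[0, a]) (e x * mode k0 x) = 0.
Proof.
rewrite in_itv/= => /andP[a0 aL].
have pL (x : R) : 0 <= x -> x <= L -> pi / L * x \in `[0, pi].
  move=> x0 xL; rewrite in_itv/= mulr_ge0 ?divr_ge0 ?pi_ge0 ?(ltW L_gt0)//=.
  rewrite -[leRHS]mulr1 -mulrA ler_pM2l ?pi_gt0// mulrC ler_pdivrMr//.
  by rewrite mul1r.
pose g x := 2^-1 * c x + (- (2^-1 * c a)).
have Mg : M g.
  by apply: (algebraD algM (algebraZ algM _ cos_multiplier)); exact: algebra_cst.
have g1 x : `|g x| <= 1.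
  have := cos_geN1 (pi / L * x); have := cos_le1 (pi / L * x).
  have := cos_geN1 (pi / L * a); have := cos_le1 (pi / L * a).
  by rewrite /g /c ler_norml => *; apply/andP; split; lra.
have [_ /(_ _ ann1)[_ /(_ k0)]] := algebra_indic_positive algM Mg g1.
move=> h; rewrite -[RHS]h /Rintegral -integral_itv_bndo_bndc; last first.
  apply: measurable_funS (measurable_int _ (integrable_within (@cont_em k0))) => //.
  by apply: subset_itvl; rewrite bnd_simp ltW.
congr fine; rewrite [LHS]integral_mkcond; apply: eq_integral => x _.
rewrite restrict_EFin /W /= patchE indicE patchE.
case: ifPn; rewrite ?inE ?notin_setE /= in_itv/=.
  move=> /andP[x0 xa]; have xL : x <= L by rewrite ltW// (lt_trans xa).
  rewrite (mem_set (_ : [set` `[0, L]] x)); last by rewrite /= in_itv/= x0.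
  rewrite mem_set ?mulr1n ?mul1r//= /g -mulrN -mulrDr mulr_gt0// subr_gt0 /c.
  by rewrite ltr_cos ?pL// ?(ltW a0) ?(ltW aL)// ltr_pM2l// divr_gt0 ?pi_gt0.
move=> /negP xa; case: ifPn; rewrite ?mulr0// inE /= in_itv/= => /andP[x0 xL].
rewrite memNset ?mulr0n ?mul1r ?mul0r//= /g -mulrN -mulrDr => h'; apply: (negP xa).
rewrite x0/=; move: h'; rewrite pmulr_rgt0// subr_gt0 /c.
by rewrite ltr_cos ?pL// ?(ltW a0) ?(ltW aL)// ltr_pM2l// divr_gt0 ?pi_gt0.
Qed.

(** Sines, respectively cosines, span a class stable under multiplication by
    [cos (pi x / L)], which separates the points of the interval. So [e * mode k0]
    has a vanishing primitive, and [mode k0] has no zero. *)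
Lemma eigenfunctions_complete x : x \in `[0, L] -> e x = 0.
Proof.
have /continuous_within_itvP[//|ce_in ce0 ceL] := ce.
have inner y : y \in `]0, L[ -> e y = 0.
  move=> y0L; move: (y0L); rewrite in_itv/= => /andP[y0 yL].
  have cg : {for y, continuous (fun x => e x * mode k0 x)}.
    by apply: continuousM; [exact: ce_in|exact: mode_continuous].
  have [dF] := continuous_FTC1_closed yL (integrable_within (@cont_em k0)) y0 cg.
  rewrite derive1E.
  have nearF : \near y, (fun x => \int[leb]_(t in `[0, x]) (e t * mode k0 t)) y = cst 0 y.
    near=> z; rewrite initial_integral// in_itv/=; apply/andP; split; near: z.
      exact: lt_nbhsr.
      exact: lt_nbhsl.
  rewrite (near_eq_derive _ nearF) ?oner_eq0// derive_cst => /esym/eqP.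
  by rewrite mulf_eq0 (gt_eqF (mode_gt0 y0L)) orbF => /eqP.
rewrite in_itv/= => /andP[]; rewrite le_eqVlt => /orP[/eqP <- _|x0].
  apply: (cvg_unique (@Rhausdorff R) ce0).
  apply: cvg_near_cst.
  apply: filterS2 (nbhs_right_gt (0 : R)) (nbhs_right_lt L_gt0) => z z0 zL.
  by apply: inner; rewrite in_itv/= z0.
rewrite le_eqVlt => /orP[/eqP ->|xL]; last by apply: inner; rewrite in_itv/= x0.
apply: (cvg_unique (@Rhausdorff R) ceL).
apply: cvg_near_cst.
apply: filterS2 (nbhs_left_lt L) (nbhs_left_gt L_gt0) => z zL z0.
by apply: inner; rewrite in_itv/= z0.
Unshelve. all: by end_near. Qed.

End completeness.

(** * Tensor products and limits of square-integrable functions *)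

Section tensor_products.
Context {R : realType}.
Local Notation leb := (@lebesgue_measure R).
Local Notation plane := (measurableTypeR R * measurableTypeR R)%type.
Local Notation leb2 := (leb \x leb)%E.
Implicit Types a b c e : R -> R.

Definition tensor a b : plane -> R := fun z => a z.1 * b z.2.

Lemma measurable_tensor a b : measurable_fun setT a -> measurable_fun setT b ->
  measurable_fun setT (tensor a b).
Proof.
move=> ma mb; apply: measurable_funM.
- have ma' : measurable_fun setT (a : measurableTypeR R -> R) := ma.
  exact: (measurableT_comp ma' measurable_fst).
- have mb' : measurable_fun setT (b : measurableTypeR R -> R) := mb.
  exact: (measurableT_comp mb' measurable_snd).
Qed.

Lemma integrable_tensor a b : leb.-integrable setT (EFin \o a) ->
  leb.-integrable setT (EFin \o b) -> leb2.-integrable setT (EFin \o tensor a b).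
Proof.
move=> ia ib.
have /measurable_int/measurable_EFinP ma := ia.
have /measurable_int/measurable_EFinP mb := ib.
apply/integrable12ltyP; first by apply/measurable_EFinP; exact: measurable_tensor.
have /integrableP[_ a_lty] := ia; have /integrableP[_ b_lty] := ib.
under eq_integral => x _.
  rewrite (_ : (\int[leb]_y _)%E = (`|(a x)%:E| * \int[leb]_y `|(b y)%:E|)%E); last first.
    rewrite -ge0_integralZl//; last first.
      by apply: measurableT_comp => //; exact/measurable_EFinP.
    by apply: eq_integral => y _; rewrite /tensor/= normrM EFinM.
  over.
rewrite ge0_integralZr//; last 2 first.
- by apply: measurableT_comp => //; exact/measurable_EFinP.
- by apply: integral_ge0.
apply: lte_mul_pinfty => //; first exact: integral_ge0.
by rewrite ge0_fin_numE//; exact: integral_ge0.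
Qed.

Lemma Rintegral_tensor a b : leb.-integrable setT (EFin \o a) ->
  leb.-integrable setT (EFin \o b) ->
  \int[leb2]_z tensor a b z = \int[leb]_x a x * \int[leb]_y b y.
Proof.
move=> ia ib; rewrite /Rintegral -integral12_prod_meas1; last exact: integrable_tensor.
have fb := integrable_fin_num measurableT ib.
have fa := integrable_fin_num measurableT ia.
set ib' := (\int[leb]_y (b y)%:E)%E in fb *.
transitivity (fine (\int[leb]_x (ib' * (a x)%:E)))%E.
  congr fine; apply: eq_integral => x _; rewrite /fubini_F muleC.
  transitivity (\int[leb]_y ((a x)%:E * (EFin \o b) y))%E; last exact: integralZl.
  by apply: eq_integral => y _; rewrite /tensor/= EFinM.
by rewrite -[ib' in LHS]fineK// integralZl// fineM// mulrC.
Qed.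

Lemma L2_tensor a b : L2 leb setT a -> L2 leb setT b -> L2 leb2 setT (tensor a b).
Proof.
move=> [ma a2] [mb b2]; split; first exact: measurable_tensor.
have := integrable_tensor a2 b2; apply: eq_integrable => // z _ /=.
by rewrite /tensor exprMn.
Qed.

Lemma dot_tensor a b c e : L2 leb setT a -> L2 leb setT b -> L2 leb setT c -> L2 leb setT e ->
  dot leb2 setT (tensor a b) (tensor c e) = dot leb setT a c * dot leb setT b e.
Proof.
move=> La Lb Lc Le; rewrite -Rintegral_tensor; last 2 first.
- exact: L2M.
- exact: L2M.
by apply: eq_Rintegral => z _; rewrite /tensor; ring.
Qed.

End tensor_products.

Section L2_limits.
Context {R : realType} d (T : measurableType d) (mu : {measure set T -> \bar R}).
Variables (D : set T) (mD : measurable D).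

Lemma dot_sqrD_le (a b : T -> R) : L2 mu D a -> L2 mu D b ->
  dot mu D (fun r => a r + b r) (fun r => a r + b r) <= 2 * dot mu D a a + 2 * dot mu D b b.
Proof.
move=> La Lb; have LB := L2B mD La Lb.
have := dot_ge0 mu D (fun r => a r - b r); rewrite dot_sqrB// => h.
have := dot_sqr_comb mD 1 La Lb.
by under eq_fun do rewrite mul1r; move=> ->; lra.
Qed.

Lemma dot_sqrB_le (a b : T -> R) : L2 mu D a -> L2 mu D b ->
  dot mu D (fun r => a r - b r) (fun r => a r - b r) <= 2 * dot mu D a a + 2 * dot mu D b b.
Proof.
move=> La Lb; have := dot_ge0 mu D (fun r => 1 * a r + b r).
by rewrite dot_sqr_comb// dot_sqrB//; lra.
Qed.

(** Fatou's lemma for the squares. *)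
Lemma L2_pointwise_limit (F : nat -> T -> R) (G : T -> R) (B : R) :
  (forall n, L2 mu D (F n)) -> (forall n, dot mu D (F n) (F n) <= B) ->
  (forall x, D x -> F ^~ x @ \oo --> G x) ->
  L2 mu D G /\ dot mu D G G <= B.
Proof.
move=> LF FB FG.
have mF n : measurable_fun D (F n) by have [] := LF n.
have mG : measurable_fun D G by exact: measurable_fun_cvg mF FG.
have key : (\int[mu]_(x in D) (G x ^+ 2)%:E <= B%:E)%E.
  have := @fatou _ _ _ mu D mD (fun n x => (F n x ^+ 2)%:E).
  have -> : (\int[mu]_(x in D) limn_einf ((fun n x => (F n x ^+ 2)%:E)^~ x) =
      \int[mu]_(x in D) (G x ^+ 2)%:E)%E.
    apply: eq_integral => x; rewrite inE => Dx.
    have h : (F n x ^+ 2)%:E @[n --> \oo] --> (G x ^+ 2)%:E.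
      apply: cvg_EFin; first exact: nearW.
      by rewrite expr2; under eq_fun do rewrite expr2; apply: cvgM; exact: FG.
    by rewrite is_cvg_limn_einfE; [exact/cvg_lim|apply/cvg_ex; eexists; exact: h].
  move=> h; apply: (le_trans (h _ _)).
  - by move=> n; apply/measurable_EFinP; exact: measurable_funX.
  - by move=> n x _; rewrite lee_fin sqr_ge0.
  have hB n : (\int[mu]_(x in D) (F n x ^+ 2)%:E <= B%:E)%E.
    rewrite -[X in (X <= _)%E]fineK ?lee_fin; last first.
      by apply: integrable_fin_num => //; have [] := LF n.
    by have := FB n; rewrite /dot; under eq_Rintegral do rewrite -expr2.
  rewrite limn_einf_lim; apply: lime_le; first exact: is_cvg_einfs.
  apply: nearW => n; apply: le_trans (hB n).
  by apply: ereal_inf_lbound; exists n => /=.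
have G2 : mu.-integrable D (fun x => (G x ^+ 2)%:E).
  apply/integrableP; split; first by apply/measurable_EFinP; exact: measurable_funX.
  under eq_integral do rewrite /= ger0_norm ?sqr_ge0//.
  by rewrite (le_lt_trans key)// ltry.
split => //.
rewrite /dot; under eq_Rintegral do rewrite -expr2.
by rewrite -lee_fin /Rintegral fineK//; exact: integrable_fin_num.
Qed.

Lemma cvg_dot_of_norm (F : nat -> T -> R) (G h : T -> R) (eps : nat -> R) :
  (forall n, L2 mu D (F n)) -> L2 mu D G -> L2 mu D h ->
  (forall n, dot mu D (fun x => G x - F n x) (fun x => G x - F n x) <= eps n) ->
  eps @ \oo --> 0 ->
  dot mu D h (F n) @[n --> \oo] --> dot mu D h G.
Proof.
move=> LF LG Lh hn eps0; apply/cvgrPdist_le => e e0.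
have C0 : 0 < dot mu D h h + 1 by rewrite ltr_wpDl// dot_ge0.
have e2 : 0 < e ^+ 2 / (dot mu D h h + 1) by rewrite divr_gt0// exprn_gt0.
have /cvgrPdist_le/(_ _ e2) := eps0; apply: filterS => n.
rewrite sub0r normrN => hle.
rewrite -(ler_pXn2r (n := 2))// ?nnegrE//; last exact: ltW.
rewrite real_normK ?num_real//.
have LB : L2 mu D (fun x => G x - F n x) by exact: L2B.
have -> : dot mu D h G - dot mu D h (F n) = dot mu D h (fun x => G x - F n x).
  by rewrite [RHS]dotC dotBl// ![dot _ _ _ h]dotC.
rewrite (le_trans (cauchy_schwarz mD Lh LB))//.
have h0 := dot_ge0 mu D h.
rewrite (@le_trans _ _ ((dot mu D h h + 1) * `|eps n|))//.
  rewrite ler_pM// ?dot_ge0// ?lerDl//.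
  by rewrite (le_trans (hn n))// ler_norm.
by rewrite mulrC -ler_pdivlMr.
Qed.

End L2_limits.

(** * Sums over the frequencies *)

Section summation_bounds.
Context {R : realType}.

(** The sum of [(n ^+ 2 + A ^+ 2)^-1] is compared with a telescoping sum. *)
Lemma atan_increment (A : R) (n : nat) : 0 < A ->
  (n.+1%:R ^+ 2 + A ^+ 2)^-1 <= A^-1 * (atan (n.+1%:R / A) - atan (n%:R / A)).
Proof.
move=> A0; have A0' : A != 0 by rewrite gt_eqF.
have [|||c] := @MVT_segment _ (fun x => A^-1 * atan (x / A))
  (fun x => (x ^+ 2 + A ^+ 2)^-1) n%:R n.+1%:R.
- by rewrite ler_nat.
- move=> x _.
  have h : is_derive x (1 : R) (fun x => x / A) A^-1 by derive_tac; ring.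
  have := derive_scale A^-1 (@is_derive1_comp _ atan (fun x => x / A) x _ _ (is_derive1_atan _) h).
  move=> h'; apply: (derive_to h').
  have -> : 1 + (x / A) ^+ 2 = (x ^+ 2 + A ^+ 2) / A ^+ 2 by field.
  have : x ^+ 2 + A ^+ 2 != 0 by rewrite gt_eqF// ltr_wpDl ?exprn_gt0// sqr_ge0.
  by set v := x ^+ 2 + A ^+ 2 => v0; field; rewrite ?A0' ?v0.
- apply: continuous_subspaceT; apply: continuous_mul; first exact: continuous_const.
  apply: continuous_after; first by move=> x; exact: continuous_atan.
  by apply: continuous_mul => [x|]; [exact: cvg_id|exact: continuous_const].
rewrite in_itv/= => /andP[c1 c2]; rewrite -mulrBr => ->.
rewrite -natrB// subSnn mulr1 lef_pV2 ?posrE ?ltr_wpDl ?exprn_gt0 ?sqr_ge0//.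
have c0 : 0 <= c by rewrite (le_trans _ c1).
by rewrite lerD2r lerXn2r ?nnegrE.
Qed.

(** Up to a constant, the contribution of the [n]-th mode to the squared norm of
    an increment of the kernel; [s] stands for the time increment or the squared
    space increment. *)
Definition gap (n : nat) (s : R) : R := Num.min ((maxn n 1)%:R ^- 2) s.

Lemma gap_ge0 n s : 0 <= s -> 0 <= gap n s.
Proof. by move=> s0; rewrite /gap le_min s0 invr_ge0 exprn_ge0. Qed.

(** Only the first [1 / sqrt s] terms equal [s]; the others are bounded by a
    convergent series whose tail is again of order [sqrt s]. *)
Lemma sum_gap N s : 0 <= s -> \sum_(0 <= n < N) gap n s <= 8 * Num.sqrt s.
Proof.
rewrite le_eqVlt => /orP[/eqP <-|s0].
  rewrite sqrtr0 mulr0 big1// => n _; rewrite /gap; apply/min_idPr.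
  by rewrite invr_ge0 exprn_ge0.
set d := Num.sqrt s; have d0 : 0 < d by rewrite sqrtr_gt0.
have sd : s = d ^+ 2 by rewrite sqr_sqrtr// ltW.
pose A := d^-1; have A0 : 0 < A by rewrite invr_gt0.
have gapS n : gap n.+1 s <= 2 * (A^-1 * (atan (n.+1%:R / A) - atan (n%:R / A))).
  apply: (@le_trans _ _ (2 * (n.+1%:R ^+ 2 + A ^+ 2)^-1)).
    have x0 : 0 < n.+1%:R ^+ 2 :> R by rewrite exprn_gt0.
    have y0 : 0 < A ^+ 2 by rewrite exprn_gt0.
    have -> : s = (A ^+ 2)^-1 by rewrite /A exprVn invrK.
    rewrite /gap (maxn_idPl _)//.
    move: x0 y0; set x := n.+1%:R ^+ 2; set y := A ^+ 2 => x0 y0.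
    rewrite ler_pdivlMr ?addr_gt0// mulrDr.
    have h1 : Num.min x^-1 y^-1 * x <= 1.
      by rewrite -[leRHS](mulVf (lt0r_neq0 x0)) ?ler_pM2r ?ge_min ?lexx//.
    have h2 : Num.min x^-1 y^-1 * y <= 1.
      by rewrite -[leRHS](mulVf (lt0r_neq0 y0)) ?ler_pM2r ?ge_min ?lexx ?orbT//.
    by rewrite (le_trans (lerD h1 h2))// -mulr2n.
  by rewrite ler_pM2l// atan_increment.
have pi4 : pi < 4 :> R by have := pihalf_lt2 R; lra.
have sumS M : \sum_(0 <= n < M) gap n.+1 s <= d * pi.
  apply: (@le_trans _ _ (2 * (A^-1 * (atan (M%:R / A) - atan (0 / A))))).
    elim: M => [|M ih]; first by rewrite big_nil subrr !mulr0.
    rewrite big_nat_recr//= (le_trans (lerD ih (gapS M)))//.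
    by rewrite le_eqVlt; apply/orP; left; apply/eqP; ring.
  rewrite mul0r atan0 subr0 /A invrK mulrCA ler_pM2l//.
  by have := atan_ltpi2 (M%:R * d); lra.
case: N => [|N]; first by rewrite big_geq// mulr_ge0// ltW.
rewrite big_nat_recl//.
have g0 : gap 0 s <= d * pi.
  by apply: (le_trans _ (sumS 1%N)); rewrite big_nat1.
have := lerD g0 (sumS N) => /le_trans; apply.
have := ler_pM2l d0 pi 4; rewrite (ltW pi4) => h.
by rewrite (le_trans (lerD h h))// -mulrDr mulrC ler_pM2r// -natrD.
Qed.

(** Comparison with the telescoping sum of [n^-1 - n.+1^-1]. *)
Lemma sum_inverse_squares N M : (0 < N)%N -> (N <= M)%N ->
  \sum_(N <= n < M) (n%:R ^- 2 : R) <= 2 / N%:R.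
Proof.
move=> N0 NM; apply: (@le_trans _ _ (2 * (N%:R^-1 - M%:R^-1))); last first.
  by rewrite ler_pM2l// gerBl invr_ge0.
rewrite -(subnK NM); elim: (M - N)%N => [|k ih].
  by rewrite add0n big_geq// subrr mulr0.
rewrite addSn big_nat_recr/= ?leq_addl//; apply: (le_trans (lerD ih (lexx _))).
set m := (k + N)%N; have m0 : 0 < m%:R :> R by rewrite ltr0n /m addn_gt0 N0 orbT.
have m1 : 0 < m.+1%:R :> R by rewrite ltr0n.
suff : m%:R ^- 2 <= 2 * (m%:R^-1 - m.+1%:R^-1) :> R.
  by move=> h; rewrite (le_trans (lerD (lexx _) h))// -mulrDr addrA subrK.
have -> : m%:R^-1 - m.+1%:R^-1 = (m%:R * m.+1%:R)^-1 :> R.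
  by rewrite -[m.+1%:R]natr1 in m1 *; field; rewrite !gt_eqF.
rewrite ler_pdivlMr ?mulr_gt0// mulrC ler_pdivrMr ?exprn_gt0// expr2 [leRHS]mulrCA ler_pM2l//.
rewrite -natrM ler_nat mul2n -addnn -addn1 leq_add2l.
by rewrite -(ltr0n R).
Qed.

End summation_bounds.

(** * Time dependence of one mode *)

Section time_kernels.
Context {R : realType}.
Local Notation leb := (@lebesgue_measure R).

(** The time factor of one Fourier mode of the mild kernel. *)
Definition decay (c lam t : R) : R -> R :=
  (fun r => c * expR (- lam * (t - r))) \_ `]0, t[.

Let mexp (lam t : R) : continuous (fun r => expR (- lam * (t - r))).
Proof.
apply: (derive_continuous (a := fun r => lam * expR (- lam * (t - r)))) => r.
by derive_tac; ring.
Qed.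

Lemma patch_integrable (f : R -> R) (a b : R) : continuous f ->
  leb.-integrable setT (EFin \o (f \_ `[a, b])).
Proof.
move=> cf; have := @integrable_within _ a b f (continuous_subspaceT cf).
by rewrite integrable_mkcond// restrict_EFin.
Qed.

Lemma Rintegral_patch (f : R -> R) (a b : R) :
  \int[leb]_x (f \_ `[a, b]) x = \int[leb]_(x in `[a, b]) f x.
Proof. by rewrite -Rintegral_mkcond. Qed.

Lemma decay_in c lam t r : 0 < r -> r < t -> decay c lam t r = c * expR (- lam * (t - r)).
Proof. by move=> r0 rt; rewrite /decay patchE mem_set//= in_itv/= r0 rt. Qed.

Lemma decay_out c lam t r : ~~ (0 < r < t) -> decay c lam t r = 0.
Proof. by move=> h; rewrite /decay patchE memNset//= in_itv/=; exact/negP. Qed.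

Lemma L2_decay c lam t : L2 leb setT (decay c lam t).
Proof.
have md : measurable_fun setT (decay c lam t).
  apply/(measurable_restrictT _ _).1 => //; apply: measurable_funTS.
  apply: continuous_measurable_fun; apply: continuous_mul; last exact: mexp.
  exact: continuous_const.
split => //.
have cs : continuous (fun r => (c * expR (- lam * (t - r))) ^+ 2).
  by apply: continuous_pow; apply: continuous_mul; [exact: continuous_const|exact: mexp].
have := patch_integrable 0 t cs; apply: integrable_domin => //.
  exact: measurable_funX.
move=> r _; rewrite ger0_norm ?sqr_ge0// /decay !patchE.
case: ifPn => [|_]; last first.
  by rewrite expr0n/=; case: ifP => // _; exact: sqr_ge0.
rewrite inE /= in_itv/= => /andP[r0 rt]; rewrite mem_set//=.
by rewrite in_itv/= !ltW.
Qed.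

Lemma decayB c c' lam t r : decay c lam t r - decay c' lam t r = decay (c - c') lam t r.
Proof. by rewrite /decay !patchE; case: ifP => _; rewrite ?subr0// mulrBl. Qed.

Let energy (lam s t : R) := \int[leb]_(r in `[s, t]) expR (- lam * (t - r)) ^+ 2.

Let energy_le_length lam s t : 0 <= lam -> s <= t -> energy lam s t <= t - s.
Proof.
move=> lam0; rewrite le_eqVlt => /orP[/eqP <-|st].
  by rewrite /energy set_itv1 Rintegral_set1 subrr.
have -> : t - s = \int[leb]_(r in `[s, t]) 1.
  by rewrite Rintegral_cst//= lebesgue_measure_itv/= lte_fin st mul1r.
apply: le_Rintegral => //.
- by apply: integrable_within; apply: continuous_subspaceT; apply: continuous_pow; exact: mexp.
- by apply: integrable_within; apply: continuous_subspaceT; exact: continuous_const.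
move=> r; rewrite /= in_itv/= => /andP[_ rt].
rewrite expr_le1 ?expR_ge0// -expR0 ler_expR mulNr oppr_le0 mulr_ge0// subr_ge0//.
Qed.

Let energy_le_inverse lam s t : 0 < lam -> s <= t -> energy lam s t <= (2 * lam)^-1.
Proof.
move=> lam0; rewrite le_eqVlt => /orP[/eqP <-|st].
  by rewrite /energy set_itv1 Rintegral_set1 invr_ge0 mulr_ge0// ltW.
have dF (r : R) : is_derive r (1 : R) (fun r => (2 * lam)^-1 * expR (- lam * (t - r)) ^+ 2)
    (expR (- lam * (t - r)) ^+ 2).
  by derive_tac; field; rewrite gt_eqF.
rewrite /energy (@Rintegral_derivative _ s t st _ _ _ _ (fun r _ => dF r)).
- rewrite subrr mulr0 expR0 expr1n mulr1 gerBl mulr_ge0 ?sqr_ge0//.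
  by rewrite invr_ge0 mulr_ge0// ltW.
- by apply: continuous_subspaceT; apply: continuous_pow; exact: mexp.
- by apply: continuous_subspaceT; exact: derive_continuous dF.
Qed.

Let energy_ge0 lam s t : 0 <= energy lam s t.
Proof. by apply: Rintegral_ge0 => r _; exact: sqr_ge0. Qed.

(** Before time [s] the two functions differ by the factor
    [1 - exp (- lam * (t - s))]; after it, only one of them is present. *)
Let decay_increment c lam s t : 0 <= lam -> 0 <= s -> s <= t ->
  dot leb setT (fun r => decay c lam t r - decay c lam s r)
    (fun r => decay c lam t r - decay c lam s r) <=
  c ^+ 2 * (energy lam s t + (1 - expR (- lam * (t - s))) ^+ 2 * energy lam 0 s).
Proof.
move=> lam0 s0 st; set q := 1 - _.
pose g1 r := c ^+ 2 * expR (- lam * (t - r)) ^+ 2.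
pose g2 r := (c * q) ^+ 2 * expR (- lam * (s - r)) ^+ 2.
have cg1 : continuous g1.
  by apply: continuous_mul; [exact: continuous_const|apply: continuous_pow; exact: mexp].
have cg2 : continuous g2.
  by apply: continuous_mul; [exact: continuous_const|apply: continuous_pow; exact: mexp].
have i1 := patch_integrable s t cg1; have i2 := patch_integrable 0 s cg2.
have LB : L2 leb setT (fun r => decay c lam t r - decay c lam s r).
  by apply: L2B => //; exact: L2_decay.
have iE u v w : leb.-integrable `[u, v] (EFin \o (fun r => expR (- lam * (w - r)) ^+ 2)).
  by apply: integrable_within; apply: continuous_subspaceT; apply: continuous_pow; exact: mexp.
have -> : c ^+ 2 * (energy lam s t + q ^+ 2 * energy lam 0 s) =
    \int[leb]_r ((g1 \_ `[s, t]) r + (g2 \_ `[0, s]) r).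
  rewrite RintegralD// !Rintegral_patch /g1 /g2 !RintegralZl// /energy; ring.
apply: le_Rintegral => //.
- exact: L2M.
- exact: integrableRD.
move=> r _; rewrite -expr2.
have h1 : 0 <= (g1 \_ `[s, t]) r by rewrite patchE; case: ifP => // _; rewrite /g1 mulr_ge0 ?sqr_ge0.
have h2 : 0 <= (g2 \_ `[0, s]) r by rewrite patchE; case: ifP => // _; rewrite /g2 mulr_ge0 ?sqr_ge0.
have [rs|sr] := ltP r s.
- have [r0|r0] := ltP 0 r; last first.
    by rewrite !decay_out ?[0 < r]ltNge ?r0// subrr expr0n/= addr_ge0.
  rewrite (@le_trans _ _ ((g2 \_ `[0, s]) r)) ?lerDr//.
  rewrite !decay_in// ?(lt_le_trans rs st)// patchE mem_set/= ?in_itv/= ?(ltW r0) ?(ltW rs)//.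
  rewrite /g2 /q (_ : - lam * (t - r) = - lam * (t - s) + - lam * (s - r)); last by ring.
  by rewrite expRD le_eqVlt; apply/orP; left; apply/eqP; ring.
- rewrite (@le_trans _ _ ((g1 \_ `[s, t]) r)) ?lerDl//.
  rewrite [decay c lam s r]decay_out ?subr0; last by rewrite [r < s]ltNge sr andbF.
  have [/andP[r0 rt]|rn] := boolP (0 < r < t); last by rewrite decay_out// expr0n.
  by rewrite decay_in// patchE mem_set/= ?in_itv/= ?sr ?(ltW rt)// /g1 exprMn.
Qed.

Let one_minus_exp (lam u : R) : 0 <= lam -> 0 <= u ->
  0 <= 1 - expR (- lam * u) <= 1 /\ 1 - expR (- lam * u) <= lam * u.
Proof.
move=> lam0 u0; have := expR_ge0 (- lam * u).
have : expR (- lam * u) <= 1 by rewrite -expR0 ler_expR mulNr oppr_le0 mulr_ge0.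
have := expR_ge1Dx (- lam * u) => h1 h2 h3; split; first by apply/andP; split; lra.
by move: h1; rewrite mulNr; lra.
Qed.

(** The bound for low frequencies. *)
Lemma decay_increment_le_length c lam s t : 0 <= lam -> 0 <= s -> s <= t ->
  dot leb setT (fun r => decay c lam t r - decay c lam s r)
    (fun r => decay c lam t r - decay c lam s r) <= 2 * c ^+ 2 * (t - s).
Proof.
move=> lam0 s0 st; apply: (le_trans (decay_increment c lam0 s0 st)).
rewrite [leRHS](_ : _ = c ^+ 2 * (2 * (t - s))); last by ring.
apply: ler_wpM2l; first exact: sqr_ge0.
have [|/andP[q0 q1] q2] := @one_minus_exp lam (t - s) lam0; first by rewrite subr_ge0.
move: q0 q1 q2; set q := 1 - _ => q0 q1 q2.
suff : q ^+ 2 * energy lam 0 s <= t - s by have := energy_le_length lam0 st; lra.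
move: lam0; rewrite le_eqVlt => /orP[/eqP l0|l0].
  have q0' : q = 0 by apply/eqP; rewrite eq_le q0 andbT (le_trans q2)// -l0 mul0r.
  by rewrite q0' expr0n/= mul0r subr_ge0.
have := energy_le_inverse l0 s0; have := energy_ge0 lam 0 s.
set E := energy _ _ _ => E0 E1.
apply: (@le_trans _ _ (q * E)).
  by rewrite ler_wpM2r// expr2 ler_piMl.
apply: (@le_trans _ _ (lam * (t - s) * (2 * lam)^-1)); first exact: ler_pM.
rewrite invfM mulrCA [lam * _]mulrC mulfK ?gt_eqF// ler_piMl ?subr_ge0//.
by rewrite invf_le1// ler1n.
Qed.

(** The bound for high frequencies. *)
Lemma decay_increment_le_inverse c lam s t : 0 < lam -> 0 <= s -> s <= t ->
  dot leb setT (fun r => decay c lam t r - decay c lam s r)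
    (fun r => decay c lam t r - decay c lam s r) <= c ^+ 2 / lam.
Proof.
move=> l0 s0 st; apply: (le_trans (decay_increment c (ltW l0) s0 st)).
apply: ler_wpM2l; first exact: sqr_ge0.
have [|/andP[q0 q1] _] := @one_minus_exp lam (t - s) (ltW l0); first by rewrite subr_ge0.
move: q0 q1; set q := 1 - _ => q0 q1.
have E1 := energy_le_inverse l0 s0; have E0 := energy_ge0 lam 0 s.
have := energy_le_inverse l0 st; rewrite invfM in E1 * => E2.
have : q ^+ 2 * energy lam 0 s <= energy lam 0 s.
  by rewrite ler_piMl// expr_le1.
lra.
Qed.

Lemma decay_time0 c lam : decay c lam 0 = (fun=> 0).
Proof.
by apply/funext => r; rewrite /decay patchE memNset//= in_itv/= => /andP[/lt_trans h /h]; rewrite ltxx.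
Qed.

Lemma decay_norm_le_inverse c lam t : 0 < lam -> 0 <= t ->
  dot leb setT (decay c lam t) (decay c lam t) <= c ^+ 2 / lam.
Proof.
move=> l0 t0; have := decay_increment_le_inverse c l0 (lexx 0) t0.
by rewrite decay_time0; under eq_fun do rewrite subr0.
Qed.

Lemma decay_norm_le_length c lam t : 0 <= lam -> 0 <= t ->
  dot leb setT (decay c lam t) (decay c lam t) <= 2 * c ^+ 2 * t.
Proof.
move=> l0 t0; have := decay_increment_le_length c l0 (lexx 0) t0.
by rewrite decay_time0 subr0; under eq_fun do rewrite subr0.
Qed.

End time_kernels.

(** * Bounds on the eigenpairs *)

Section eigenfunction_bounds.
Context {R : realType} (L : R) (L_gt0 : 0 < L) (bc : boundary_condition).

(** What the kernel estimates use of the eigenpairs: quadratic growth of the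
    eigenvalues, except for the constant Neumann mode, and uniform bounds on the
    eigenfunctions and on their Lipschitz constants. *)
Record spectral_bounds (lam : nat -> R) (f : nat -> R -> R) (kappa B : R) : Prop := {
  sb_kappa : 0 < kappa;
  sb_B : 0 < B;
  sb_ge0 : forall n, 0 <= lam n;
  sb_growth : forall n, lam n = 0 \/ kappa * (maxn n 1)%:R ^+ 2 <= lam n;
  sb_zero : forall n, lam n = 0 -> n = 0%N /\
    forall x y, x \in `[0, L] -> y \in `[0, L] -> f n x = f n y;
  sb_bound : forall n x, x \in `[0, L] -> f n x ^+ 2 <= B;
  sb_lipschitz : forall n x y, x \in `[0, L] -> y \in `[0, L] ->
    (f n x - f n y) ^+ 2 <= B * lam n * (x - y) ^+ 2 }.

Lemma mode_sqr_le1 k (x : R) : sturm_mode L bc k x ^+ 2 <= 1.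
Proof.
rewrite /sturm_mode -real_normK ?num_real// expr_le1//.
by case: bc; [exact: sin_max|exact: cos_max].
Qed.

Lemma mode_increment_sqr k (x y : R) :
  (sturm_mode L bc k x - sturm_mode L bc k y) ^+ 2 <=
  2 * mode_eigenvalue L k * (x - y) ^+ 2.
Proof.
rewrite /mode_eigenvalue (_ : 2 * _ * _ = (k%:R * pi / L * x - k%:R * pi / L * y) ^+ 2); last by field; rewrite gt_eqF.
rewrite -real_normK ?num_real// -[leRHS]real_normK ?num_real// lerXn2r ?nnegrE//.
by rewrite /sturm_mode; case: bc; [exact: sin_lipschitz|exact: cos_lipschitz].
Qed.

Lemma eigenpairs_bounds lam f : eigenpairs L bc lam f ->
  exists kappa B : R, spectral_bounds lam f kappa B.
Proof.
move=> lam_f; have [ix [A [hA nix _ _]]] := eigenbasis_form L_gt0 lam_f.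
have pL : 0 < (pi / L) ^+ 2 / 2 :> R by rewrite divr_gt0// exprn_gt0// divr_gt0// pi_gt0.
have eigE k : mode_eigenvalue L k = (pi / L) ^+ 2 / 2 * k%:R ^+ 2 :> R.
  by rewrite /mode_eigenvalue; field; rewrite gt_eqF.
exists ((pi / L) ^+ 2 / 2), (4 / L); split => //.
- by rewrite divr_gt0.
- by move=> n; have [_ -> _ _] := hA n; rewrite divr_ge0// sqr_ge0.
- move=> n; have [_ -> _ _] := hA n; rewrite eigE.
  have [->|k0] := eqVneq (ix n) 0%N; first by left; rewrite expr0n mulr0.
  right; rewrite ler_pM2l// lerXn2r ?nnegrE// ler_nat geq_max nix.
  by rewrite lt0n.
- move=> n; have [_ -> _ fE] := hA n; rewrite eigE => /eqP.
  rewrite mulf_eq0 (gt_eqF pL)/= sqrf_eq0 pnatr_eq0 => /eqP k0; split.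
    by have := nix n; rewrite k0 leqn0 => /eqP.
  move=> x y hx hy; rewrite !fE// k0 /sturm_mode !mul0r.
  by case: bc.
- move=> n x hx; have [_ _ A2 fE] := hA n; rewrite fE// exprMn.
  rewrite (@le_trans _ _ (2 / L * 1))//.
    by rewrite ler_pM ?sqr_ge0// mode_sqr_le1.
  by rewrite mulr1 ler_pM2r ?invr_gt0// ler_nat.
- move=> n x y hx hy; have [_ lamE A2 fE] := hA n; rewrite !fE// -mulrBr exprMn.
  rewrite (_ : 4 / L * _ * _ = 2 / L * (2 * lam n * (x - y) ^+ 2)); last by field; rewrite gt_eqF.
  by rewrite ler_pM ?sqr_ge0// lamE mode_increment_sqr.
Qed.

End eigenfunction_bounds.

(** * Fourier truncations of the mild kernel *)

Section partial_kernels.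
Context {R : realType} (L : R) (lam : nat -> R) (f : nat -> R -> R) (kappa B : R).
Local Notation leb := (@lebesgue_measure R).
Local Notation plane := (measurableTypeR R * measurableTypeR R)%type.
Local Notation leb2 := (leb \x leb)%E.
Hypothesis sb : spectral_bounds L lam f kappa B.
Hypothesis cf : forall n, {within `[0, L], continuous (f n)}.
Hypothesis orth : forall n m, \int[leb]_(x in `[0, L]) (f n x * f m x) = (n == m)%:R.

Definition truncated_mode (n : nat) : R -> R := f n \_ `[0, L].
Local Notation g := truncated_mode.

Lemma dot_patch (u v : R -> R) :
  dot leb setT (u \_ `[0, L]) (v \_ `[0, L]) = \int[leb]_(x in `[0, L]) (u x * v x).
Proof.
rewrite /dot [RHS]Rintegral_mkcond; apply: eq_Rintegral => x _.
by rewrite !patchE; case: ifP => _; rewrite ?mul0r.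
Qed.

Lemma L2_patch (u : R -> R) : {within `[0, L], continuous u} ->
  L2 leb setT (u \_ `[0, L]).
Proof.
move=> cu; split.
  by apply/(measurable_restrictT _ _).1 => //; exact: measurable_within.
have i2 : leb.-integrable `[0, L] (EFin \o (fun x => u x ^+ 2)).
  exact: integrable_within (@continuous_pow _ (subspace `[0, L]) _ 2 cu).
rewrite integrable_mkcond// restrict_EFin in i2; move: i2.
apply: eq_integrable => // x _; rewrite /= !patchE.
by case: ifP => _ //; rewrite expr0n.
Qed.

Lemma L2_mode n : L2 leb setT (g n).
Proof. exact: L2_patch. Qed.

Lemma dot_modes n m : dot leb setT (g n) (g m) = (n == m)%:R.
Proof. by rewrite dot_patch orth. Qed.

Lemma pythagoras_modes (s : seq nat) (a : nat -> R -> R) : uniq s ->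
  (forall n, L2 leb setT (a n)) ->
  dot leb2 setT (fun z => \sum_(n <- s) tensor (a n) (g n) z)
    (fun z => \sum_(n <- s) tensor (a n) (g n) z) = \sum_(n <- s) dot leb setT (a n) (a n).
Proof.
move=> us La; have Lt n : L2 leb2 setT (tensor (a n) (g n)).
  by apply: L2_tensor => //; exact: L2_mode.
rewrite dot_suml//; last exact: L2_sum.
apply: eq_big_seq => n ns; rewrite dotC dot_suml// (bigD1_seq n)//= big1 => [|m mn].
  by rewrite addr0 dot_tensor ?dot_modes ?eqxx ?mulr1//; exact: L2_mode.
by rewrite dot_tensor ?dot_modes ?(negbTE mn) ?mulr0//; exact: L2_mode.
Qed.

Definition partial_kernel N t x : plane -> R :=
  fun z => \sum_(0 <= n < N) tensor (decay (f n x) (lam n) t) (g n) z.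
Local Notation KN := partial_kernel.

Lemma L2_partial_kernel N t x : L2 leb2 setT (KN N t x).
Proof.
by apply: L2_sum => // n; apply: L2_tensor; [exact: L2_decay|exact: L2_mode].
Qed.

Lemma le_mul_min (X C a b : R) : X <= C * a -> X <= C * b -> X <= C * Num.min a b.
Proof. by move=> h1 h2; rewrite minEle; case: ifP. Qed.

Lemma term_space_increment n x y t : 0 <= t -> x \in `[0, L] -> y \in `[0, L] ->
  dot leb setT (decay (f n x - f n y) (lam n) t) (decay (f n x - f n y) (lam n) t) <=
  (4 * B / kappa + B) * gap n ((x - y) ^+ 2).
Proof.
move=> t0 xL yL; have k0 := sb_kappa sb; have B0 := sb_B sb.
have Bk : 0 < B / kappa by rewrite divr_gt0.
have [l0|lk] := sb_growth sb n.
  have [_ /(_ x y xL yL) ->] := sb_zero sb l0.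
  apply: le_trans (decay_norm_le_length _ (sb_ge0 sb n) t0) _.
  rewrite subrr expr0n/= mulr0 mul0r mulr_ge0 ?gap_ge0 ?sqr_ge0// addr_ge0// ?ltW//.
  by rewrite -mulrA mulr_gt0.
have m0 : 0 < (maxn n 1)%:R ^+ 2 :> R by rewrite exprn_gt0// ltr0n leq_max orbT.
have l0 : 0 < lam n by rewrite (lt_le_trans _ lk)// mulr_gt0.
apply: le_trans (decay_norm_le_inverse _ l0 t0) _.
apply: le_mul_min.
- have := sb_bound sb n xL; have := sb_bound sb n yL => h1 h2.
  have : (f n x - f n y) ^+ 2 <= 4 * B by nra.
  move=> h; rewrite mulrDl (@le_trans _ _ (4 * B / kappa * (maxn n 1)%:R ^- 2))//; last first.
    by rewrite lerDl divr_ge0 ?(ltW m0) ?(ltW B0).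
  rewrite -[leRHS]mulrA -invfM; apply: ler_pM => //; first exact: sqr_ge0.
    by rewrite invr_ge0 ltW.
  by rewrite lef_pV2 ?posrE ?mulr_gt0.
- rewrite ler_pdivrMr// (le_trans (sb_lipschitz sb n xL yL))//.
  rewrite [leRHS]mulrAC -mulrA -[leRHS]mulrA.
  apply: ler_pM; [exact: ltW|by rewrite mulr_ge0 ?sqr_ge0 ?ltW| |exact: lexx].
  by rewrite lerDr -mulrA ltW// mulr_gt0.
Qed.

Lemma term_time_increment T n x s t : 0 < T -> s \in `[0, T] -> t \in `[0, T] ->
  x \in `[0, L] ->
  dot leb setT (fun r => decay (f n x) (lam n) t r - decay (f n x) (lam n) s r)
    (fun r => decay (f n x) (lam n) t r - decay (f n x) (lam n) s r) <=
  (2 * B + B / kappa + 2 * B * T) * gap n `|t - s|.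
Proof.
move=> T0; wlog st : s t / s <= t.
  move=> h sT tT xL; have [|/ltW ts] := leP s t; first by move/h; exact.
  have := h _ _ ts tT sT xL; rewrite distrC; apply: le_trans; rewrite le_eqVlt.
  by apply/orP; left; apply/eqP/eq_Rintegral => r _; ring.
move=> /itvP sT /itvP tT xL; have k0 := sb_kappa sb; have B0 := sb_B sb.
have s0 : 0 <= s by rewrite sT.
have tsT : t - s <= T by rewrite lerBlDr (@le_trans _ _ T) ?tT// lerDl.
rewrite ger0_norm ?subr_ge0//.
have Bk : 0 < B / kappa by rewrite divr_gt0.
have BT : 0 < 2 * B * T by rewrite !mulr_gt0.
have B2 : 0 < 2 * B by rewrite !mulr_gt0.
have b := sb_bound sb n xL; have ts0 : 0 <= t - s by rewrite subr_ge0.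
have len := decay_increment_le_length (f n x) (sb_ge0 sb n) s0 st.
have lenB : 2 * f n x ^+ 2 * (t - s) <= 2 * B * (t - s).
  by rewrite ler_wpM2r// ler_pM2l.
apply: le_mul_min; last first.
  rewrite (le_trans len)// (le_trans lenB)// ler_wpM2r//; lra.
have m0 : 0 < (maxn n 1)%:R ^+ 2 :> R by rewrite exprn_gt0// ltr0n leq_max orbT.
have [l0|lk] := sb_growth sb n.
  have [n0 _] := sb_zero sb l0; rewrite (_ : maxn n 1 = 1%N); last by rewrite n0.
  rewrite expr1n invr1 mulr1.
  rewrite (le_trans len)// (le_trans lenB)// (@le_trans _ _ (2 * B * T)) ?ler_pM2l//.
  lra.
have l0 : 0 < lam n by rewrite (lt_le_trans _ lk)// mulr_gt0.
apply: (le_trans (decay_increment_le_inverse (f n x) l0 s0 st)).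
apply: (@le_trans _ _ (B / kappa * (maxn n 1)%:R ^- 2)); last first.
  rewrite ler_wpM2r ?invr_ge0 ?(ltW m0)//; lra.
rewrite -[leRHS]mulrA -invfM; apply: ler_pM => //; first exact: sqr_ge0.
  by rewrite invr_ge0 ltW.
by rewrite lef_pV2 ?posrE ?mulr_gt0.
Qed.

(** The orthogonal modes contribute at most a multiple of [gap n s], with [s]
    equal to [|t - s|] for the time increment and to [(x - y) ^+ 2] for the space
    increment. *)
Lemma partial_kernel_increment T : 0 < T -> exists2 C : R, 0 < C &
  forall N s t x y, s \in `[0, T] -> t \in `[0, T] -> x \in `[0, L] -> y \in `[0, L] ->
  dot leb2 setT (fun z => KN N t x z - KN N s y z) (fun z => KN N t x z - KN N s y z) <=
  C * (Num.sqrt `|t - s| + `|x - y|).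
Proof.
move=> T0; have k0 := sb_kappa sb; have B0 := sb_B sb.
have Bk : 0 < B / kappa by rewrite divr_gt0.
have BT : 0 < 2 * B * T by rewrite !mulr_gt0.
pose C1 := 4 * B / kappa + B; pose C2 := 2 * B + B / kappa + 2 * B * T.
have C10 : 0 < C1 by rewrite /C1; lra.
have C20 : 0 < C2 by rewrite /C2; lra.
exists (16 * (C1 + C2)); first by lra.
move=> N s t x y sT tT xL yL.
pose a n r := (decay (f n x) (lam n) t r - decay (f n x) (lam n) s r) +
  decay (f n x - f n y) (lam n) s r.
have La1 n : L2 leb setT (fun r => decay (f n x) (lam n) t r - decay (f n x) (lam n) s r).
  by apply: L2B => //; exact: L2_decay.
have La n : L2 leb setT (a n) by apply: L2D => //; exact: L2_decay.
have -> : (fun z => KN N t x z - KN N s y z) =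
    (fun z => \sum_(n <- index_iota 0 N) tensor (a n) (g n) z).
  apply/funext => z; rewrite /KN -sumrB; apply: eq_bigr => n _.
  by rewrite /tensor /a -decayB; ring.
rewrite pythagoras_modes ?iota_uniq//.
have st0 : 0 <= s by rewrite (itvP sT).
have h n : dot leb setT (a n) (a n) <=
    2 * C2 * gap n `|t - s| + 2 * C1 * gap n ((x - y) ^+ 2).
  apply: (le_trans (dot_sqrD_le measurableT (La1 n) (L2_decay _ _ _))).
  rewrite -!mulrA; apply: lerD; rewrite ler_pM2l//.
    exact: term_time_increment.
  exact: term_space_increment.
apply: (@le_trans _ _ (\sum_(0 <= n < N) (2 * C2 * gap n `|t - s| + 2 * C1 * gap n ((x - y) ^+ 2)))).
  by apply: ler_sum => n _; exact: h.
rewrite big_split/= -!mulr_sumr.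
have := @sum_gap _ N `|t - s| (normr_ge0 _); have := @sum_gap _ N ((x - y) ^+ 2) (sqr_ge0 _).
rewrite sqrtr_sqr; set S1 := \sum_(_ <= _ < _) _; set S2 := \sum_(_ <= _ < _) _.
have := sqrtr_ge0 `|t - s|; have := normr_ge0 (x - y).
move: (Num.sqrt _) (`|_|) => u v v0 u0 h1 h2.
have : 2 * C2 * S2 <= 2 * C2 * (8 * u) by rewrite ler_pM2l//; lra.
have : 2 * C1 * S1 <= 2 * C1 * (8 * v) by rewrite ler_pM2l//; lra.
nra.
Qed.

Lemma partial_kernel_tail N M t x : (0 < N)%N -> (N <= M)%N -> 0 <= t -> x \in `[0, L] ->
  dot leb2 setT (fun z => KN M t x z - KN N t x z) (fun z => KN M t x z - KN N t x z) <=
  2 * B / kappa / N%:R.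
Proof.
move=> N0 NM t0 xL; have k0 := sb_kappa sb; have B0 := sb_B sb.
have -> : (fun z => KN M t x z - KN N t x z) =
    (fun z => \sum_(n <- index_iota N M) tensor (decay (f n x) (lam n) t) (g n) z).
  by apply/funext => z; rewrite /KN (@big_cat_nat _ _ _ N 0 M)//= addrAC subrr add0r.
rewrite pythagoras_modes ?iota_uniq//; last by move=> n; exact: L2_decay.
apply: (@le_trans _ _ (\sum_(N <= n < M) (B / kappa * n%:R ^- 2))).
  rewrite big_nat_cond [leRHS]big_nat_cond; apply: ler_sum => n.
  rewrite andbT => /andP[Nn _]; have n0 := leq_trans N0 Nn.
  have n0' : 0 < n%:R ^+ 2 :> R by rewrite exprn_gt0// ltr0n.
  have [l0|lk] := sb_growth sb n.
    by have [/esym nz _] := sb_zero sb l0; rewrite -nz in n0.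
  rewrite (maxn_idPl n0) in lk.
  have l0 : 0 < lam n by rewrite (lt_le_trans _ lk)// mulr_gt0.
  apply: (le_trans (decay_norm_le_inverse _ l0 t0)).
  rewrite -[leRHS]mulrA -invfM; apply: ler_pM; rewrite ?sqr_ge0 ?invr_ge0 ?(ltW l0)//.
    exact: (sb_bound sb).
  by rewrite lef_pV2 ?posrE//; exact: mulr_gt0.
rewrite -mulr_sumr (le_trans (ler_wpM2l _ (sum_inverse_squares N0 NM)))//.
  by rewrite divr_ge0// ltW.
by rewrite le_eqVlt; apply/orP; left; apply/eqP; field; rewrite !gt_eqF// ltr0n.
Qed.

End partial_kernels.

(** * The mild kernel *)

Section mild_kernels.
Context {R : realType} (L : R) (lam : nat -> R) (f : nat -> R -> R) (kappa B : R).
Local Notation leb := (@lebesgue_measure R).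
Local Notation leb2 := (leb \x leb)%E.
Hypothesis sb : spectral_bounds L lam f kappa B.
Hypothesis cf : forall n, {within `[0, L], continuous (f n)}.
Hypothesis orth : forall n m, \int[leb]_(x in `[0, L]) (f n x * f m x) = (n == m)%:R.
Local Notation KN := (partial_kernel L lam f).
Local Notation K := (mild_kernel L lam f).

(** At a positive time the series converges absolutely: [exp (- a) <= a^-1] bounds
    its terms by a summable [gap]. *)
Lemma heat_kernel_cvg tau x y : 0 < tau -> x \in `[0, L] -> y \in `[0, L] ->
  series (fun n => expR (- lam n * tau) * f n x * f n y) @ \oo --> heat_kernel lam f tau x y.
Proof.
move=> tau0 xL yL; have k0 := sb_kappa sb; have B0 := sb_B sb.
set u := fun n => _.
have kt : 0 < (kappa * tau)^-1 by rewrite invr_gt0 mulr_gt0.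
suff : cvgn (series u) by [].
apply: normed_cvg.
pose C := B * (1 + (kappa * tau)^-1).
have uC n : `|u n| <= C * gap n 1.
  have ffB : `|f n x * f n y| <= B.
    have := sb_bound sb n xL; have := sb_bound sb n yL => h1 h2.
    by rewrite ler_norml; apply/andP; split; nra.
  rewrite /u -mulrA normrM ger0_norm ?expR_ge0// mulrC /C -mulrA.
  apply: ler_pM; rewrite ?expR_ge0 ?normr_ge0//.
  have e1 : expR (- lam n * tau) <= 1.
    by rewrite -expR0 ler_expR mulNr oppr_le0 mulr_ge0 ?(ltW tau0)// (sb_ge0 sb).
  apply: le_mul_min; last by rewrite mulr1 (le_trans e1)// lerDl ltW.
  have m0 : 0 < (maxn n 1)%:R ^+ 2 :> R by rewrite exprn_gt0// ltr0n leq_max orbT.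
  have [l0|lk] := sb_growth sb n.
    have [n0 _] := sb_zero sb l0; rewrite (_ : maxn n 1 = 1%N); last by rewrite n0.
    by rewrite expr1n invr1 mulr1 (le_trans e1)// lerDl ltW.
  have l0 : 0 < lam n by rewrite (lt_le_trans _ lk)// mulr_gt0.
  apply: (@le_trans _ _ ((kappa * tau)^-1 * (maxn n 1)%:R ^- 2)); last first.
    by rewrite ler_pM2r ?invr_gt0// lerDr.
  rewrite mulNr expRN -invfM lef_pV2 ?posrE ?expR_gt0//; last first.
    by apply: mulr_gt0 => //; exact: mulr_gt0.
  rewrite (le_trans _ (expR_ge1Dx _))// (@le_trans _ _ (lam n * tau)) ?lerDr//.
  by rewrite mulrAC ler_pM2r.
have C0 : 0 <= C by rewrite mulr_ge0 ?(ltW B0)// addr_ge0// ltW.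
apply: nondecreasing_is_cvgn.
  by apply: nondecreasing_series => n _ _; exact: normr_ge0.
exists (C * (8 * Num.sqrt 1)) => _ [N _ <-].
rewrite /= /series/= (le_trans (ler_sum _ (fun n _ => uC n)))// -mulr_sumr.
by rewrite ler_wpM2l// sum_gap.
Qed.

Lemma partial_kernel_cvg t x z : x \in `[0, L] -> (KN n t x z) @[n --> \oo] --> K t x z.
Proof.
move=> xL; rewrite /mild_kernel patchE.
have [|zn] := boolP (z \in `]0, t[ `*` `[0, L]).
  rewrite inE => -[]; rewrite /= !in_itv/= => /andP[z0 zt] zL.
  have tz : 0 < t - z.1 by rewrite subr_gt0.
  have := heat_kernel_cvg tz xL zL; apply: cvg_trans.
  apply: near_eq_cvg; apply: nearW => n; rewrite /= /series/= /partial_kernel.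
  apply: eq_bigr => i _; rewrite /tensor decay_in// /truncated_mode patchE mem_set//.
  by rewrite [f i x * _]mulrC.
rewrite (_ : (fun n => KN n t x z) = fun=> 0); first exact: cvg_cst.
apply/funext => n; rewrite /partial_kernel big1// => i _; rewrite /tensor.
have [h|h] := boolP (0 < z.1 < t); last by rewrite decay_out ?mul0r.
rewrite /truncated_mode patchE memNset ?mulr0// => zL.
by move/negP: zn; apply; rewrite inE; split => //=; rewrite in_itv/=.
Qed.

Lemma partial_kernel_norm t : 0 <= t ->
  exists C : R, forall N x, x \in `[0, L] -> dot leb2 setT (KN N t x) (KN N t x) <= C.
Proof.
move=> t0; have t1 : 0 < t + 1 by rewrite ltr_wpDl.
have [C C0 h] := partial_kernel_increment sb cf orth t1.
exists (C * Num.sqrt `|t - 0|) => N x xL.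
have /h : (0 : R) \in `[0, t + 1] by rewrite in_itv/= lexx ltW.
have tT : t \in `[0, t + 1] by rewrite in_itv/= t0 lerDl ler01.
move=> /(_ N t x x tT xL xL).
rewrite subrr normr0 addr0.
have -> : (fun z => KN N t x z - KN N 0 x z) = KN N t x.
  apply/funext => z; rewrite [KN N 0 x z]big1 ?subr0// => n _.
  by rewrite /tensor decay_time0 mul0r.
by [].
Qed.

Lemma L2_mild_kernel t x : 0 <= t -> x \in `[0, L] -> L2 leb2 setT (K t x).
Proof.
move=> t0 xL; have [C hC] := partial_kernel_norm t0.
have [] // := @L2_pointwise_limit _ _ _ leb2 setT measurableT (fun N => KN N t x) (K t x) C.
- by move=> N; exact: L2_partial_kernel.
- by move=> N; exact: hC.
- by move=> z _; exact: partial_kernel_cvg.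
Qed.

Lemma mild_kernel_increment T : 0 < T -> exists2 C : R, 0 < C &
  forall s t x y, s \in `[0, T] -> t \in `[0, T] -> x \in `[0, L] -> y \in `[0, L] ->
  dot leb2 setT (fun z => K t x z - K s y z) (fun z => K t x z - K s y z) <=
  C * (Num.sqrt `|t - s| + `|x - y|).
Proof.
move=> T0; have [C C0 h] := partial_kernel_increment sb cf orth T0.
exists C => // s t x y sT tT xL yL.
have [] // := @L2_pointwise_limit _ _ _ leb2 setT measurableT
  (fun N z => KN N t x z - KN N s y z) (fun z => K t x z - K s y z)
  (C * (Num.sqrt `|t - s| + `|x - y|)).
- by move=> N; apply: L2B => //; exact: L2_partial_kernel.
- by move=> N; exact: h.
- by move=> z _; apply: cvgB; exact: partial_kernel_cvg.
Qed.

Lemma dot_partial_kernel_cvg h t x : 0 <= t -> x \in `[0, L] -> L2 leb2 setT h ->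
  dot leb2 setT h (KN n t x) @[n --> \oo] --> dot leb2 setT h (K t x).
Proof.
move=> t0 xL Lh; rewrite -(cvg_shiftS (fun n => dot leb2 setT h (KN n t x))).
have LK := L2_mild_kernel t0 xL.
apply: (@cvg_dot_of_norm _ _ _ leb2 setT measurableT (fun n => KN n.+1 t x) (K t x) h
  (fun n => 2 * B / kappa * harmonic n)) => //.
- by move=> n; exact: L2_partial_kernel.
- move=> n.
  have [] // := @L2_pointwise_limit _ _ _ leb2 setT measurableT
    (fun M z => KN (M + n.+1) t x z - KN n.+1 t x z) (fun z => K t x z - KN n.+1 t x z)
    (2 * B / kappa * harmonic n).
  + by move=> M; apply: L2B => //; exact: L2_partial_kernel.
  + by move=> M; apply: (partial_kernel_tail sb cf orth) => //; rewrite leq_addl.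
  + move=> z _; apply: cvgB; last exact: cvg_cst.
    rewrite (cvg_shiftn n.+1 (fun M => KN M t x z)).
    exact: partial_kernel_cvg.
- by rewrite -[X in _ --> X](mulr0 (2 * B / kappa)); apply: cvgM; [exact: cvg_cst|exact: cvg_harmonic].
Qed.

Lemma mild_kernel_time0 x : K 0 x = fun=> 0.
Proof.
apply/funext => z; rewrite /mild_kernel patchE memNset// => -[].
by rewrite /= in_itv/= => /andP[/lt_trans h /h]; rewrite ltxx.
Qed.

Lemma mild_kernel_boundary t x : (forall n, f n x = 0) -> K t x = fun=> 0.
Proof.
move=> fx0; apply/funext => z; rewrite /mild_kernel patchE; case: ifP => // _.
rewrite /heat_kernel (_ : series _ = fun=> 0) ?lim_cst//.
by apply/funext => n; rewrite /series/= big1// => i _; rewrite fx0 mulr0 mul0r.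
Qed.

End mild_kernels.

(** * Test functions *)

Section bumps.
Context {R : realType}.
Local Notation leb := (@lebesgue_measure R).

Definition pospart (y : R) : R := Num.max 0 y.

Lemma pospart_ge0 y : 0 <= pospart y.
Proof. by rewrite /pospart le_max lexx. Qed.

Lemma pospart_id y : 0 <= y -> pospart y = y.
Proof. by move=> y0; rewrite /pospart; apply/max_idPr. Qed.

Lemma pospart_eq0 y : y <= 0 -> pospart y = 0.
Proof. by move=> y0; rewrite /pospart; apply/max_idPl. Qed.

Lemma pospart_continuous : continuous pospart.
Proof.
move=> y; rewrite /pospart.
apply: (@continuous_max _ _ (fun=> 0) (fun y => y) y); first exact: cvg_cst.
exact: cvg_id.
Qed.

(** At [0] the difference quotient of the squared positive part is the positive
    part itself. *)
Lemma derive_pospart_sqr f (x a : R) : is_derive x (1 : R) f a ->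
  is_derive x (1 : R) (fun y => pospart (f y) ^+ 2) (2 * pospart (f x) * a).
Proof.
move=> h; suff base y : is_derive y (1 : R) (fun y => pospart y ^+ 2) (2 * pospart y).
  exact: (derive_to (@is_derive1_comp _ (fun y => pospart y ^+ 2) f x _ _ (base _) h)).
have [y0|y0|->] := ltgtP y 0.
- rewrite (pospart_eq0 (ltW y0)) mulr0.
  apply: (near_eq_is_derive _ (derive_const 0 y)).
  near=> z; rewrite pospart_eq0 ?expr0n//.
  apply: ltW; near: z; exact: lt_nbhsl.
- rewrite (pospart_id (ltW y0)).
  have e : is_derive y (1 : R) (fun y => y ^+ 2) (2 * y) by derive_tac; ring.
  apply: (near_eq_is_derive _ e).
  near=> z; rewrite pospart_id//=.
  apply: ltW; near: z; exact: lt_nbhsr.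
- rewrite pospart_eq0// mulr0.
  have lim0 : h^-1 *: (pospart (h *: 1 + 0) ^+ 2 - pospart 0 ^+ 2) @[h --> (0 : R)^'] --> (0 : R).
    have e : (fun h : R => h^-1 *: (pospart (h *: 1 + 0) ^+ 2 - pospart 0 ^+ 2)) = pospart.
      apply/funext => u; rewrite (pospart_eq0 (lexx 0)) expr0n/= subr0 addr0 /GRing.scale/= mulr1.
      have [u0|u0] := leP u 0; first by rewrite pospart_eq0// expr0n mulr0.
      by rewrite pospart_id ?ltW// expr2 mulKf// gt_eqF.
    rewrite e; apply: cvg_within_filter.
    by have := @pospart_continuous 0; rewrite /continuous_at pospart_eq0.
  apply: DeriveDef; first by apply/cvg_ex; exists 0; exact: lim0.
  exact: cvg_lim lim0.
Unshelve. all: by end_near. Qed.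

Lemma pospart_cube y : pospart y ^+ 3 = y * pospart y ^+ 2.
Proof.
have [y0|y0] := leP y 0; first by rewrite pospart_eq0// !expr0n/= mulr0.
by rewrite pospart_id ?ltW// exprS.
Qed.

Lemma derive_pospart_cube f (x a : R) : is_derive x (1 : R) f a ->
  is_derive x (1 : R) (fun y => pospart (f y) ^+ 3) (3 * pospart (f x) ^+ 2 * a).
Proof.
move=> h; under eq_fun do rewrite pospart_cube.
apply: (derive_to (derive_mul h (derive_pospart_sqr h))).
have := pospart_cube (f x); rewrite exprS => /eqP; rewrite -subr_eq0 -mulrBl expr2 mulrA.
have [fx0|fx0] := leP (f x) 0; first by rewrite pospart_eq0// => _; ring.
by rewrite pospart_id ?ltW// => _; ring.
Qed.

Lemma pospart_le1 (u : R) : pospart (1 - u ^+ 2) <= 1.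
Proof. by rewrite /pospart ge_max ler01 gerBl sqr_ge0. Qed.

Lemma pospart_out (u : R) : 1 <= `|u| -> pospart (1 - u ^+ 2) = 0.
Proof.
by move=> u1; rewrite pospart_eq0// subr_le0 -real_normK ?num_real// exprn_ege1.
Qed.

Lemma L2_bounded_support (u : R -> R) (a b M : R) : a <= b -> measurable_fun setT u -> 0 <= M ->
  (forall r, `|u r| <= M) -> (forall r, r \notin `[a, b] -> u r = 0) ->
  L2 leb setT u /\ dot leb setT u u <= M ^+ 2 * (b - a).
Proof.
move=> ab mu M0 uM u0.
have cst2 : leb.-integrable `[a, b] (EFin \o (fun=> M ^+ 2)).
  by apply: integrable_within; apply: continuous_subspaceT; exact: continuous_const.
have dom r : u r ^+ 2 <= ((fun=> M ^+ 2) \_ `[a, b]) r.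
  rewrite patchE; case: ifPn => [_|rn].
    by rewrite -real_normK ?num_real// lerXn2r ?nnegrE.
  rewrite u0 ?expr0n//; apply/negP => rab; move/negP: rn; apply.
  by rewrite mem_set.
have dint : leb.-integrable setT (EFin \o ((fun=> M ^+ 2) \_ `[a, b])).
  by rewrite integrable_mkcond// restrict_EFin in cst2.
have Lu : L2 leb setT u.
  split => //; apply: (integrable_domin _ _ _ dint) => //.
    exact: measurable_funX.
  by move=> r _; rewrite ger0_norm ?sqr_ge0.
split => //; rewrite /dot.
have -> : M ^+ 2 * (b - a) = \int[leb]_r ((fun=> M ^+ 2) \_ `[a, b]) r.
  rewrite -Rintegral_mkcond; move: ab; rewrite le_eqVlt => /orP[/eqP->|ab].
    by rewrite set_itv1 Rintegral_set1 subrr mulr0.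
  by rewrite Rintegral_cst//= lebesgue_measure_itv/= lte_fin ab.
apply: le_Rintegral => //; first exact: L2M.
by move=> r _; rewrite -expr2.
Qed.

Section time_bump.
Variables (t tau : R).
Hypothesis tau0 : 0 < tau.

(** A bump of class [C^1] around [t], which is what the first-order part of the
    heat operator requires. *)
Definition time_bump (r : R) : R := pospart (1 - ((r - t) / tau) ^+ 2) ^+ 2.

Definition time_bump_derivative (r : R) : R :=
  2 * pospart (1 - ((r - t) / tau) ^+ 2) * (- (2 * ((r - t) / tau) / tau)).

Lemma derive_time_bump r : is_derive r (1 : R) time_bump (time_bump_derivative r).
Proof.
apply: derive_pospart_sqr.
by derive_tac; field; rewrite gt_eqF.
Qed.

Lemma outside_support r : r \notin `[t - tau, t + tau] -> 1 <= `|(r - t) / tau|.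
Proof.
move=> h; rewrite normrM normfV (gtr0_norm tau0) ler_pdivlMr// mul1r leNgt.
by apply: contra h; rewrite ltr_distlC in_itv/= => /andP[h1 h2]; rewrite !ltW//; lra.
Qed.

Lemma time_bump_bounds :
  [/\ L2 leb setT time_bump, dot leb setT time_bump time_bump <= 2 * tau,
    L2 leb setT time_bump_derivative &
    dot leb setT time_bump_derivative time_bump_derivative <= 32 / tau].
Proof.
have ab : t - tau <= t + tau by have := tau0; lra.
have cu : continuous (fun r => pospart (1 - ((r - t) / tau) ^+ 2)).
  apply: continuous_after; first exact: pospart_continuous.
  apply: continuous_sub; first exact: continuous_const.
  apply: continuous_pow; apply: continuous_mul; last exact: continuous_const.
  by apply: continuous_sub => [x|]; [exact: cvg_id|exact: continuous_const].
have len : t + tau - (t - tau) = 2 * tau by ring.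
have [||||L1 h1] := @L2_bounded_support time_bump _ _ 1 ab.
- by apply: continuous_measurable_fun; exact: continuous_pow.
- by [].
- by move=> r; rewrite ger0_norm ?sqr_ge0// expr_le1// ?pospart_ge0// pospart_le1.
- by move=> r /outside_support h; rewrite /time_bump pospart_out// expr0n.
have [||||L2' h2] := @L2_bounded_support time_bump_derivative _ _ (4 / tau) ab.
- apply: continuous_measurable_fun; apply: continuous_mul.
    by apply: continuous_mul; [exact: continuous_const|exact: cu].
  apply: continuous_opp; apply: continuous_mul; last exact: continuous_const.
  apply: continuous_mul; first exact: continuous_const.
  apply: continuous_mul; last exact: continuous_const.
  by apply: continuous_sub => [x|]; [exact: cvg_id|exact: continuous_const].
- by rewrite divr_ge0// ltW.
- move=> r; rewrite /time_bump_derivative.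
  have [h|h] := leP 1 `|(r - t) / tau|.
    by rewrite pospart_out// mulr0 mul0r normr0 divr_ge0// ltW.
  rewrite !normrM normrN !normrM (ger0_norm (pospart_ge0 _)) normfV (gtr0_norm tau0).
  rewrite ger0_norm//; have := pospart_le1 ((r - t) / tau); have := pospart_ge0 (1 - ((r - t) / tau) ^+ 2).
  move: h; rewrite normrM normfV (gtr0_norm tau0).
  have : 0 <= `|r - t| / tau by rewrite divr_ge0// ltW.
  move: (pospart _) (`|r - t| / tau) => p v v0 v1 p0 p1.
  rewrite mulrA ler_pM2r ?invr_gt0//; nra.
- by move=> r /outside_support h; rewrite /time_bump_derivative pospart_out// mulr0 mul0r.
split => //; first by move: h1; rewrite len expr1n mul1r.
rewrite (le_trans h2)// len le_eqVlt; apply/orP; left; apply/eqP.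
by field; rewrite gt_eqF.
Qed.

Lemma time_bump_center : time_bump t = 1.
Proof. by rewrite /time_bump subrr mul0r expr0n/= subr0 pospart_id// expr1n. Qed.

Lemma time_bump_far r : tau <= `|r - t| -> time_bump r = 0.
Proof.
move=> h; rewrite /time_bump pospart_out ?expr0n//.
by rewrite normrM normfV (gtr0_norm tau0) ler_pdivlMr// mul1r.
Qed.

End time_bump.

End bumps.

Section space_bumps.
Context {R : realType}.
Local Notation leb := (@lebesgue_measure R).
Variables (L eps : R).
Hypotheses (L_gt0 : 0 < L) (eps0 : 0 < eps).
Implicit Types c x z : R.

(** A bump of class [C^2] around [c]; the two next functions are its
    derivatives. *)
Definition space_bump c z : R := pospart (1 - ((z - c) / eps) ^+ 2) ^+ 3.

Definition space_bump1 c z : R :=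
  3 * pospart (1 - ((z - c) / eps) ^+ 2) ^+ 2 * (- (2 * ((z - c) / eps) / eps)).

Definition space_bump2 c z : R :=
  (24 * ((z - c) / eps) ^+ 2 * pospart (1 - ((z - c) / eps) ^+ 2) -
   6 * pospart (1 - ((z - c) / eps) ^+ 2) ^+ 2) / eps ^+ 2.

Lemma derive_ratio_sqr c z : is_derive z (1 : R) (fun z => 1 - ((z - c) / eps) ^+ 2)
  (- (2 * ((z - c) / eps) / eps)).
Proof. by derive_tac; field; rewrite gt_eqF. Qed.

Lemma derive_space_bump c z : is_derive z (1 : R) (space_bump c) (space_bump1 c z).
Proof. by apply: derive_pospart_cube; exact: derive_ratio_sqr. Qed.

Lemma derive_space_bump1 c z : is_derive z (1 : R) (space_bump1 c) (space_bump2 c z).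
Proof.
have h := derive_pospart_sqr (derive_ratio_sqr c z).
rewrite /space_bump1 /space_bump2.
by derive_tac; field; rewrite gt_eqF.
Qed.

Let cratio c : continuous (fun z => (z - c) / eps).
Proof.
apply: continuous_mul; last exact: continuous_const.
by apply: continuous_sub => [x|]; [exact: cvg_id|exact: continuous_const].
Qed.

Lemma space_bump2_continuous c : continuous (space_bump2 c).
Proof.
have cp : continuous (fun r => pospart (1 - ((r - c) / eps) ^+ 2)).
  apply: continuous_after; first exact: pospart_continuous.
  by apply: continuous_sub; [exact: continuous_const|apply: continuous_pow; exact: cratio].
apply: continuous_mul; last exact: continuous_const.
apply: continuous_sub; last first.
  by apply: continuous_mul; [exact: continuous_const|exact: continuous_pow].
apply: continuous_mul => //; apply: continuous_mul; first exact: continuous_const.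
by apply: continuous_pow; exact: cratio.
Qed.

Lemma space_bump_far c z : eps <= `|z - c| ->
  [/\ space_bump c z = 0, space_bump1 c z = 0 & space_bump2 c z = 0].
Proof.
move=> h; have p0 : pospart (1 - ((z - c) / eps) ^+ 2) = 0.
  by apply: pospart_out; rewrite normrM normfV (gtr0_norm eps0) ler_pdivlMr// mul1r.
by rewrite /space_bump /space_bump1 /space_bump2 p0 !expr0n/= !mulr0 !mul0r subrr mul0r.
Qed.

Let patch_bound (u : R -> R) c M : continuous u -> 0 <= M ->
  (forall z, `|u z| <= M) -> (forall z, eps <= `|z - c| -> u z = 0) ->
  L2 leb setT (u \_ `[0, L]) /\ dot leb setT (u \_ `[0, L]) (u \_ `[0, L]) <= M ^+ 2 * (2 * eps).
Proof.
move=> cu M0 uM u0.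
have ab : c - eps <= c + eps by have := eps0; lra.
have [||||h1 h2] := @L2_bounded_support _ (u \_ `[0, L]) _ _ M ab.
- apply/(measurable_restrictT _ _).1 => //; apply: measurable_funTS.
  exact: continuous_measurable_fun.
- by [].
- by move=> r; rewrite patchE; case: ifP => _; rewrite ?normr0.
- move=> r rn; rewrite patchE u0; first by case: ifP.
  rewrite leNgt; apply: contra rn; rewrite ltr_distlC in_itv/= => /andP[? ?].
  by rewrite !ltW//; lra.
split => //; apply: (le_trans h2); rewrite le_eqVlt; apply/orP; left; apply/eqP; ring.
Qed.

Lemma space_bump_bounds c :
  [/\ L2 leb setT (space_bump c \_ `[0, L]),
    dot leb setT (space_bump c \_ `[0, L]) (space_bump c \_ `[0, L]) <= 2 * eps,
    L2 leb setT (space_bump2 c \_ `[0, L]) &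
    dot leb setT (space_bump2 c \_ `[0, L]) (space_bump2 c \_ `[0, L]) <= 1800 / eps ^+ 3].
Proof.
have e0 := eps0; have e2 : 0 < eps ^+ 2 by rewrite exprn_gt0.
have [||||h1 h2] := @patch_bound (space_bump c) c 1.
- exact: derive_continuous (derive_space_bump c).
- by [].
- move=> z; rewrite ger0_norm ?exprn_ge0 ?pospart_ge0//.
  by rewrite exprn_ile1 ?pospart_ge0 ?pospart_le1.
- by move=> z /space_bump_far[].
have [||||h3 h4] := @patch_bound (space_bump2 c) c (30 / eps ^+ 2).
- exact: space_bump2_continuous.
- by rewrite divr_ge0// ltW.
- move=> z; have [h|h] := leP eps `|z - c|.
    by have [_ _ ->] := space_bump_far h; rewrite normr0 divr_ge0// ltW.
  rewrite /space_bump2 normrM normfV (gtr0_norm e2) ler_pM2r ?invr_gt0//.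
  have : ((z - c) / eps) ^+ 2 <= 1.
    rewrite -real_normK ?num_real// expr_le1//.
    by rewrite normrM normfV (gtr0_norm e0) ler_pdivrMr// mul1r ltW.
  have := sqr_ge0 ((z - c) / eps).
  have := pospart_le1 ((z - c) / eps); have := pospart_ge0 (1 - ((z - c) / eps) ^+ 2).
  move: (pospart (1 - ((z - c) / eps) ^+ 2)) (((z - c) / eps) ^+ 2) => p v p0 p1 v0 v1.
  by rewrite ler_norml; apply/andP; split; nra.
- by move=> z /space_bump_far[].
split => //; first by move: h2; rewrite expr1n mul1r.
rewrite (le_trans h4)// le_eqVlt; apply/orP; left; apply/eqP.
by field; rewrite gt_eqF.
Qed.

Variables (bc : boundary_condition) (x : R).
Hypotheses (xL : x \in `[0, L]) (epsL : eps <= L).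

(** Method of images: odd reflections at both end points for the Dirichlet
    condition, even ones for the Neumann condition. *)
Definition image_sign : R := match bc with Dirichlet => - 1 | Neumann => 1 end.

Definition with_images (b : R -> R -> R) z : R :=
  b x z + image_sign * (b (- x) z + b (2 * L - x) z).

Lemma with_images_twice_differentiable :
  twice_differentiable L (with_images space_bump) (with_images space_bump1)
    (with_images space_bump2).
Proof.
have d0 c := derive_space_bump c; have d1 c := derive_space_bump1 c.
have D0 z : is_derive z (1 : R) (with_images space_bump) (with_images space_bump1 z).
  have h1 := d0 x z; have h2 := d0 (- x) z; have h3 := d0 (2 * L - x) z.
  by rewrite /with_images; derive_tac.
have D1 z : is_derive z (1 : R) (with_images space_bump1) (with_images space_bump2 z).
  have h1 := d1 x z; have h2 := d1 (- x) z; have h3 := d1 (2 * L - x) z.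
  by rewrite /with_images; derive_tac.
split => //.
- by apply: continuous_subspaceT; exact: derive_continuous D0.
- by apply: continuous_subspaceT; exact: derive_continuous D1.
- apply: continuous_subspaceT; have h := space_bump2_continuous.
  apply: continuous_add => //; apply: continuous_mul; first exact: continuous_const.
  exact: continuous_add.
Qed.

Lemma with_images_boundary :
  boundary_vanishes L bc (with_images space_bump) (with_images space_bump1).
Proof.
have /andP[x0 xL'] : (0 <= x) && (x <= L) by move: xL; rewrite in_itv.
have e0 := eps0; have eL := epsL; have L0 := L_gt0.
have [f1 f2 _] : [/\ space_bump (2 * L - x) 0 = 0, space_bump1 (2 * L - x) 0 = 0 &
    space_bump2 (2 * L - x) 0 = 0].
  by apply: space_bump_far; rewrite distrC ger0_norm; lra.
have [f3 f4 _] : [/\ space_bump (- x) L = 0, space_bump1 (- x) L = 0 &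
    space_bump2 (- x) L = 0].
  by apply: space_bump_far; rewrite ger0_norm; lra.
have r1 : (0 - - x) / eps = - ((0 - x) / eps) by field; rewrite gt_eqF.
have r2 : (L - (2 * L - x)) / eps = - ((L - x) / eps) by field; rewrite gt_eqF.
rewrite /boundary_vanishes /with_images /image_sign; case: bc.
  rewrite f1 f3 /space_bump r1 r2 !sqrrN; split; ring.
rewrite f2 f4 /space_bump1 r1 r2 !sqrrN; split; ring.
Qed.

Lemma with_images_ge1 : match bc with Dirichlet => eps <= 2 * x /\ eps <= 2 * (L - x) | Neumann => True end ->
  1 <= with_images space_bump x.
Proof.
have /andP[x0 xL'] : (0 <= x) && (x <= L) by move: xL; rewrite in_itv.
have c1 : space_bump x x = 1.
  by rewrite /space_bump subrr mul0r expr0n/= subr0 pospart_id// expr1n.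
rewrite /with_images /image_sign c1; case: bc => [[h1 h2]|_].
  have [-> _ _] : [/\ space_bump (- x) x = 0, space_bump1 (- x) x = 0 &
      space_bump2 (- x) x = 0] by apply: space_bump_far; rewrite ger0_norm; lra.
  have [-> _ _] : [/\ space_bump (2 * L - x) x = 0, space_bump1 (2 * L - x) x = 0 &
      space_bump2 (2 * L - x) x = 0].
    by apply: space_bump_far; rewrite distrC ger0_norm; lra.
  by rewrite addr0 mulr0 addr0.
by rewrite lerDl mul1r addr_ge0// exprn_ge0// pospart_ge0.
Qed.

Lemma with_images_far y : y \in `[0, L] -> eps <= `|y - x| -> with_images space_bump y = 0.
Proof.
have /andP[x0 xL'] : (0 <= x) && (x <= L) by move: xL; rewrite in_itv.
rewrite in_itv/= => /andP[y0 yL] h; rewrite /with_images.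
have [-> _ _] := space_bump_far h.
have [|-> _ _] := @space_bump_far (- x) y.
  rewrite opprK [`|y + x|]ger0_norm ?addr_ge0// (le_trans h)// ler_norml; apply/andP; split; lra.
have [|-> _ _] := @space_bump_far (2 * L - x) y.
  rewrite distrC [`|2 * L - x - y|]ger0_norm; last by lra.
  by rewrite (le_trans h)// ler_norml; apply/andP; split; lra.
by rewrite addr0 mulr0 addr0.
Qed.

Let image_patch (b : R -> R -> R) : with_images b \_ `[0, L] =
  (fun z => (b x \_ `[0, L]) z + image_sign *
    ((b (- x) \_ `[0, L]) z + (b (2 * L - x) \_ `[0, L]) z)).
Proof.
by apply/funext => z; rewrite /with_images !patchE; case: ifP => // _; rewrite addr0 mulr0 addr0.
Qed.

Let image_bound (b : R -> R -> R) M : (forall c, L2 leb setT (b c \_ `[0, L])) ->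
  (forall c, dot leb setT (b c \_ `[0, L]) (b c \_ `[0, L]) <= M) ->
  L2 leb setT (with_images b \_ `[0, L]) /\
  dot leb setT (with_images b \_ `[0, L]) (with_images b \_ `[0, L]) <= 10 * M.
Proof.
move=> Lb bM; rewrite image_patch.
have L1 : L2 leb setT (fun z => (b (- x) \_ `[0, L]) z + (b (2 * L - x) \_ `[0, L]) z).
  exact: L2D.
have L2' := L2Z measurableT image_sign L1.
split; first exact: L2D.
apply: (le_trans (dot_sqrD_le measurableT (Lb x) L2')).
have -> : dot leb setT (fun z => image_sign * ((b (- x) \_ `[0, L]) z + (b (2 * L - x) \_ `[0, L]) z))
    (fun z => image_sign * ((b (- x) \_ `[0, L]) z + (b (2 * L - x) \_ `[0, L]) z)) =
    dot leb setT (fun z => (b (- x) \_ `[0, L]) z + (b (2 * L - x) \_ `[0, L]) z)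
    (fun z => (b (- x) \_ `[0, L]) z + (b (2 * L - x) \_ `[0, L]) z).
  by apply: eq_Rintegral => z _; rewrite /image_sign; case: bc; ring.
have := dot_sqrD_le measurableT (Lb (- x)) (Lb (2 * L - x)).
have := bM x; have := bM (- x); have := bM (2 * L - x); lra.
Qed.

Lemma with_images_bounds :
  [/\ L2 leb setT (with_images space_bump \_ `[0, L]),
    dot leb setT (with_images space_bump \_ `[0, L]) (with_images space_bump \_ `[0, L]) <= 20 * eps,
    L2 leb setT (with_images space_bump2 \_ `[0, L]) &
    dot leb setT (with_images space_bump2 \_ `[0, L]) (with_images space_bump2 \_ `[0, L]) <=
      18000 / eps ^+ 3].
Proof.
have h c := space_bump_bounds c.
have [||h1 h2] := @image_bound space_bump (2 * eps).
- by move=> c; have [] := h c.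
- by move=> c; have [] := h c.
have [||h3 h4] := @image_bound space_bump2 (1800 / eps ^+ 3).
- by move=> c; have [] := h c.
- by move=> c; have [] := h c.
split => //; first by rewrite (le_trans h2)// mulrA -natrM.
by rewrite (le_trans h4)// mulrA -natrM.
Qed.

End space_bumps.

(** * The mild kernel inverts the heat operator *)

Lemma continuous_sum {R : realType} {T : topologicalType} (I : Type) (s : seq I) (F : I -> T -> R) :
  (forall i, continuous (F i)) -> continuous (fun x => \sum_(i <- s) F i x).
Proof.
move=> cF x; apply: (@cvg_big _ _ (@GRing.add R) 0).
- exact: add_continuous.
- by move=> i _; exact: cF.
Qed.

Section kernel_duality.
Context {R : realType} (L : R) (L_gt0 : 0 < L) (bc : boundary_condition).
Context (lam : nat -> R) (f : nat -> R -> R) (lam_f : eigenpairs L bc lam f).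
Context (kappa B : R) (sb : spectral_bounds L lam f kappa B).
Local Notation leb := (@lebesgue_measure R).
Local Notation leb2 := (leb \x leb)%E.
Local Notation KN := (partial_kernel L lam f).
Local Notation K := (mild_kernel L lam f).

Lemma eigenfunction_continuous n : {within `[0, L], continuous (f n)}.
Proof. by have [/(_ n)[d []]] := lam_f. Qed.

Lemma eigenfunction_orthonormal n m :
  \int[leb]_(x in `[0, L]) (f n x * f m x) = (n == m)%:R.
Proof. by have [_ _] := lam_f. Qed.

Local Notation cf := eigenfunction_continuous.
Local Notation orth := eigenfunction_orthonormal.

Lemma second_derivative_coefficient n psi dpsi ddpsi :
  twice_differentiable L psi dpsi ddpsi -> boundary_vanishes L bc psi dpsi ->
  \int[leb]_(x in `[0, L]) (ddpsi x * f n x) =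
  - (2 * lam n) * \int[leb]_(x in `[0, L]) (psi x * f n x).
Proof.
move=> tpsi bpsi; have [/(_ n) eqf _ _ _] := lam_f.
have [dphi tphi bphi] := eigen_equation_twice_differentiable eqf.
rewrite (green_identity L_gt0 tpsi tphi bpsi bphi) -RintegralZl//; last first.
  have [cpsi _ _ _ _] := tpsi.
  apply: integrable_within; apply: (@continuous_mul _ (subspace `[0, L])) => //.
  exact: cf.
by apply: eq_Rintegral => x _; ring.
Qed.

(** [(phi * exp (- a * (s - r)))'] is integrated from [0] to [s]. *)
Lemma decay_duality (phi dphi : R -> R) c (a s : R) :
  (forall r, is_derive r (1 : R) phi (dphi r)) -> continuous dphi -> phi 0 = 0 ->
  L2 leb setT phi -> L2 leb setT dphi -> 0 <= s ->
  dot leb setT dphi (decay c a s) + a * dot leb setT phi (decay c a s) = c * phi s.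
Proof.
move=> dphiP cdphi phi0 Lphi Ldphi s0.
have cphi := derive_continuous dphiP; have Ld := @L2_decay _ c a s.
rewrite -dotZl// -dotDl//; last exact: L2Z.
have dexp (r : R) : is_derive r (1 : R) (fun r => c * expR (- a * (s - r)))
    (c * (a * expR (- a * (s - r)))) by derive_tac; ring.
pose F r := phi r * (c * expR (- a * (s - r))).
pose dF r := (dphi r + a * phi r) * (c * expR (- a * (s - r))).
have dFP r : is_derive r (1 : R) F (dF r).
  have h1 := dphiP r; have h2 := dexp r.
  by apply: (derive_to (derive_mul h1 h2)); rewrite /dF; ring.
have cdF : continuous dF.
  apply: continuous_mul; last exact: derive_continuous dexp.
  by apply: continuous_add => //; apply: continuous_mul => //; exact: continuous_const.
have -> : dot leb setT (fun r => dphi r + a * phi r) (decay c a s) =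
    \int[leb]_(r in `]0, s[) dF r.
  rewrite /dot [RHS]Rintegral_mkcond; apply: eq_Rintegral => r _.
  by rewrite /decay !patchE; case: ifP => // _; rewrite mulr0.
have i1 : leb.-integrable `[0, s] (EFin \o dF).
  by apply: integrable_within; exact: continuous_subspaceT.
have i2 : leb.-integrable `]0, s[ (EFin \o dF).
  apply: integrableS i1 => //; exact: subset_itv_oo_cc.
have i3 : leb.-integrable `]0, s] (EFin \o dF).
  apply: integrableS i1 => //; exact: subset_itv_oc_cc.
rewrite (Rintegral_itv_bndo_bndc i2) (Rintegral_itv_obnd_cbnd i3).
move: s0; rewrite le_eqVlt => /orP[/eqP <-|s0].
  by rewrite set_itv1 Rintegral_set1 phi0 mulr0.
rewrite (@Rintegral_derivative _ 0 s s0 dF F _ _ (fun r _ => dFP r)).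
- by rewrite /F phi0 subrr mulr0 expR0; ring.
- exact: continuous_subspaceT.
- by apply: continuous_subspaceT; exact: derive_continuous dFP.
Qed.

Section duality.
Variables (phi dphi psi dpsi ddpsi : R -> R).
Hypotheses (dphiP : forall r, is_derive r (1 : R) phi (dphi r)) (cdphi : continuous dphi)
  (phi0 : phi 0 = 0) (Lphi : L2 leb setT phi) (Ldphi : L2 leb setT dphi)
  (tpsi : twice_differentiable L psi dpsi ddpsi) (bpsi : boundary_vanishes L bc psi dpsi).

(** [d/dt - 1/2 d^2/dx^2] applied to [phi (t) psi (x)]. *)
Definition heat_operator (z : R * R) : R :=
  tensor dphi (psi \_ `[0, L]) z - 2^-1 * tensor phi (ddpsi \_ `[0, L]) z.
Local Notation h := heat_operator.

Let coef n := \int[leb]_(x in `[0, L]) (psi x * f n x).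

Let Lpsi : L2 leb setT (psi \_ `[0, L]).
Proof. by have [c _ _ _ _] := tpsi; exact: L2_patch. Qed.

Let Lddpsi : L2 leb setT (ddpsi \_ `[0, L]).
Proof. by have [_ _ c _ _] := tpsi; exact: L2_patch. Qed.

Lemma L2_heat_operator : L2 leb2 setT h.
Proof.
apply: L2B => //; first exact: L2_tensor.
by apply: L2Z => //; exact: L2_tensor.
Qed.

Lemma dot_heat_operator_partial N s y : 0 <= s ->
  dot leb2 setT h (KN N s y) = phi s * \sum_(0 <= n < N) coef n * f n y.
Proof.
move=> s0; have Lh := L2_heat_operator.
have Lg n := L2_mode cf n; have Lt n : L2 leb2 setT (tensor (decay (f n y) (lam n) s) (truncated_mode L f n)).
  by apply: L2_tensor => //; exact: L2_decay.
rewrite dotC dot_suml// mulr_sumr; apply: eq_bigr => n _.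
have L1 := L2_tensor Ldphi Lpsi; have L2' := L2_tensor Lphi Lddpsi.
rewrite dotC /h dotBl//; last exact: L2Z.
rewrite dotZl// !dot_tensor//; try exact: L2_decay.
rewrite !dot_patch (second_derivative_coefficient n tpsi bpsi) -/(coef n).
have := @decay_duality phi dphi (f n y) (lam n) s dphiP cdphi phi0 Lphi Ldphi s0.
set A := dot _ _ _ _; set A' := dot _ _ _ _ => e.
rewrite [RHS](_ : _ = coef n * (f n y * phi s)); last by ring.
by rewrite -e; field.
Qed.

Lemma dot_kernel_continuous s : 0 <= s ->
  {within `[0, L], continuous (fun y => dot leb2 setT h (K s y))}.
Proof.
move=> s0; have Lh := L2_heat_operator.
have s1 : 0 < s + 1 by rewrite ltr_wpDl.
have sT : s \in `[0, s + 1] by rewrite in_itv/= s0 lerDl ler01.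
have [C C0 hC] := mild_kernel_increment sb cf orth s1.
pose D := dot leb2 setT h h * C + 1.
have D0 : 0 < D by rewrite ltr_wpDl// mulr_ge0 ?dot_ge0// ltW.
have inc x y : x \in `[0, L] -> y \in `[0, L] ->
    (dot leb2 setT h (K s x) - dot leb2 setT h (K s y)) ^+ 2 <= D * `|x - y|.
  move=> xL yL; have Lx := L2_mild_kernel sb cf orth s0 xL.
  have Ly := L2_mild_kernel sb cf orth s0 yL.
  have -> : dot leb2 setT h (K s x) - dot leb2 setT h (K s y) =
      dot leb2 setT h (fun z => K s x z - K s y z).
    by rewrite [RHS]dotC (dotBl measurableT Lx Ly Lh); congr (_ - _); exact: dotC.
  have LB := L2B measurableT Lx Ly.
  rewrite (le_trans (cauchy_schwarz measurableT Lh LB))//.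
  have := hC s s x y sT sT xL yL; rewrite subrr normr0 sqrtr0 add0r => hxy.
  rewrite (@le_trans _ _ (dot leb2 setT h h * (C * `|x - y|)))//.
    by rewrite ler_wpM2l// dot_ge0.
  by rewrite mulrA ler_wpM2r// lerDl.
apply/subspace_continuousP => x xL; apply/cvgrPdist_le => e e0.
have e2 : 0 < e ^+ 2 / D by rewrite divr_gt0// exprn_gt0.
near=> y.
rewrite -(ler_pXn2r (n := 2))// ?nnegrE//; last exact: ltW.
rewrite real_normK ?num_real//.
have yL : y \in `[0, L] by near: y; exact: withinT.
rewrite (le_trans (inc _ _ xL yL))// mulrC -ler_pdivlMr//.
near: y; apply: cvg_within => /=.
have /cvgrPdist_le/(_ _ e2) : y @[y --> x] --> x by exact: cvg_id.
by [].
Unshelve. all: by end_near. Qed.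

(** The kernel inverts the heat operator. At time [s] the pairing is a
    continuous function of [y] with the Fourier coefficients of
    [phi s * psi]. *)
Lemma dot_heat_operator s y : 0 <= s -> y \in `[0, L] ->
  dot leb2 setT h (K s y) = phi s * psi y.
Proof.
move=> s0 yL; have Lh := L2_heat_operator.
pose g y := dot leb2 setT h (K s y).
have lim x : x \in `[0, L] ->
    (fun N => phi s * \sum_(0 <= n < N) coef n * f n x) @ \oo --> g x.
  move=> xL; have := dot_partial_kernel_cvg sb cf orth s0 xL Lh.
  by under eq_fun do rewrite dot_heat_operator_partial//.
have cg : {within `[0, L], continuous g} by exact: dot_kernel_continuous.
have [cpsi _ _ _ _] := tpsi.
pose e x := g x - phi s * psi x.
have ce : {within `[0, L], continuous e}.
  apply: (@continuous_sub _ (subspace `[0, L])) => //.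
  by apply: (@continuous_mul _ (subspace `[0, L])) => //; exact: continuous_const.
have [M hM] := partial_kernel_norm sb cf orth s0.
have cfg m : {within `[0, L], continuous (fun x => g x * f m x)}.
  by apply: (@continuous_mul _ (subspace `[0, L])) => //; exact: cf.
pose S N x := phi s * \sum_(0 <= n < N) coef n * f n x.
have cS N : {within `[0, L], continuous (S N)}.
  apply: (@continuous_mul _ (subspace `[0, L])); first exact: continuous_const.
  apply: (@continuous_sum _ (subspace `[0, L])) => n.
  by apply: (@continuous_mul _ (subspace `[0, L])); [exact: continuous_const|exact: cf].
have cSf N m : {within `[0, L], continuous (fun x => S N x * f m x)}.
  have mulf (u : R -> R) : {within `[0, L], continuous u} -> {within `[0, L], continuous (fun x => u x * f m x)}.
    by move=> cu; apply: (@continuous_mul _ (subspace `[0, L])) => //; exact: cf.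
  exact: mulf (cS N).
have iS N m : \int[leb]_(x in `[0, L]) (S N x * f m x) = phi s * ((m < N)%N%:R * coef m).
  have cff n : {within `[0, L], continuous (fun x => f n x * f m x)}.
    by apply: (@continuous_mul _ (subspace `[0, L])); exact: cf.
  elim: N => [|N ih].
    rewrite ltn0 mul0r mulr0 (@eq_integral_itv _ _ _ (fun=> 0)).
      by rewrite Rintegral_cst// mul0r.
    by move=> x _; rewrite /S big_geq// mulr0 mul0r.
  rewrite (@eq_integral_itv _ _ _ (fun x => S N x * f m x + phi s * coef N * (f N x * f m x))); last first.
    by move=> x _; rewrite /S big_nat_recr//=; ring.
  rewrite RintegralD//; last 2 first.
  - exact: integrable_within.
  - apply: integrable_within; apply: (@continuous_mul _ (subspace `[0, L])) => //.
      exact: continuous_const.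
    exact: cff.
  rewrite RintegralZl//; last exact: integrable_within.
  rewrite ih orth ltnS [in RHS]leq_eqVlt eq_sym.
  have [->|] := eqVneq N m; first by rewrite ltnn/=; ring.
  by rewrite /= => _; ring.
have bS N x : x \in `[0, L] -> `|S N x| <= Num.sqrt (dot leb2 setT h h * M).
  move=> xL; rewrite -sqrtr_sqr ler_wsqrtr// /S -dot_heat_operator_partial//.
  rewrite (le_trans (cauchy_schwarz measurableT Lh (L2_partial_kernel lam cf N s x)))//.
  by rewrite ler_wpM2l ?dot_ge0// hM.
(* The Fourier coefficients of [g] are the limits of those of its partial sums
   [S N], which are uniformly bounded by Cauchy-Schwarz. *)
have eort m : \int[leb]_(x in `[0, L]) (e x * f m x) = 0.
  have [|||||_ dc] := @Rdominated_convergence _ _ _ leb `[0, L]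
    (fun N x => S N x * f m x) (fun x => g x * f m x)
    (fun x => Num.sqrt (dot leb2 setT h h * M) * Num.sqrt B).
  - by [].
  - by move=> N; exact: measurable_within.
  - by move=> x xL; apply: cvgM; [exact: lim|exact: cvg_cst].
  - by apply: integrable_within; exact: continuous_const.
  - move=> N x xL; rewrite normrM; apply: ler_pM => //; first exact: bS.
    by rewrite -sqrtr_sqr ler_wsqrtr// (sb_bound sb).
  have ig : \int[leb]_(x in `[0, L]) (g x * f m x) = phi s * coef m.
    apply: (cvg_unique _ dc) => //.
    apply: cvg_near_cst.
    by near=> N; rewrite iS (_ : (m < N)%N) ?mul1r//; near: N; exact: nbhs_infty_gt.
  rewrite (@eq_integral_itv _ _ _ (fun x => g x * f m x - phi s * (psi x * f m x))); last first.
    by move=> x _; rewrite /e; ring.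
  have cpf : {within `[0, L], continuous (fun x => psi x * f m x)}.
    by apply: (@continuous_mul _ (subspace `[0, L])) => //; exact: cf.
  rewrite RintegralB//; last 2 first.
  - exact: integrable_within.
  - apply: integrable_within; apply: (@continuous_mul _ (subspace `[0, L])) => //.
    exact: continuous_const.
  by rewrite RintegralZl ?ig ?subrr//; exact: integrable_within.
by have := eigenfunctions_complete L_gt0 lam_f ce eort yL; rewrite /e => /eqP; rewrite subr_eq0 => /eqP.
Unshelve. all: by end_near. Qed.

Lemma heat_operator_norm :
  dot leb2 setT h h <=
  2 * (dot leb setT dphi dphi * dot leb setT (psi \_ `[0, L]) (psi \_ `[0, L])) +
  2^-1 * (dot leb setT phi phi * dot leb setT (ddpsi \_ `[0, L]) (ddpsi \_ `[0, L])).
Proof.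
have L1 := L2_tensor Ldphi Lpsi; have L2' := L2_tensor Lphi Lddpsi.
have LZ := L2Z measurableT (2^-1) L2'.
rewrite -!dot_tensor//; apply: (le_trans (dot_sqrB_le measurableT L1 LZ)).
have e1 := dotZl measurableT (2^-1) L2' LZ; have e2 := dotZl measurableT (2^-1) L2' L2'.
by move: e1; rewrite [X in _ = _ * X -> _]dotC e2 => ->; lra.
Qed.

End duality.
End kernel_duality.

(** * Distance between kernels *)

Section kernel_separation.
Context {R : realType} (L : R) (L_gt0 : 0 < L) (bc : boundary_condition).
Context (lam : nat -> R) (f : nat -> R -> R) (lam_f : eigenpairs L bc lam f).
Context (kappa B : R) (sb : spectral_bounds L lam f kappa B).
Local Notation leb := (@lebesgue_measure R).
Local Notation leb2 := (leb \x leb)%E.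
Local Notation K := (mild_kernel L lam f).

(** The heat operator applied to a bump on the parabolic ball of radius [eps]
    around [(t, x)] pairs with a kernel [K s y] to the value of the bump at
    [(s, y)]. It is of order [eps ^- 2] on a set of area of order [eps ^+ 3], hence
    the bound on its squared norm. *)
Lemma separating_function (t x eps : R) : 0 < eps -> eps ^+ 2 <= t -> eps <= L ->
  x \in `[0, L] ->
  match bc with Dirichlet => eps <= 2 * x /\ eps <= 2 * (L - x) | Neumann => True end ->
  exists h : R * R -> R, [/\ L2 leb2 setT h, dot leb2 setT h h <= 20000 / eps,
    1 <= dot leb2 setT h (K t x) &
    forall s y, 0 <= s -> y \in `[0, L] -> eps ^+ 2 <= `|s - t| \/ eps <= `|y - x| ->
      dot leb2 setT h (K s y) = 0].
Proof.
move=> e0 et eL xL bcx.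
have tau0 : 0 < eps ^+ 2 by rewrite exprn_gt0.
have t0 : 0 <= t by rewrite (le_trans (ltW tau0)).
have [Lphi phi2 Ldphi dphi2] := time_bump_bounds t tau0.
have tpsi := with_images_twice_differentiable L e0 bc x.
have bpsi := with_images_boundary L_gt0 e0 bc xL eL.
have [Lpsi psi2 Lddpsi ddpsi2] := with_images_bounds L e0 bc x.
have dphiP r := derive_time_bump t tau0 r.
have phi0 : time_bump t (eps ^+ 2) 0 = 0.
  by apply: time_bump_far => //; rewrite sub0r normrN ger0_norm.
have cdphi : continuous (time_bump_derivative t (eps ^+ 2)).
  have cr : continuous (fun r => (r - t) / eps ^+ 2).
    apply: continuous_mul; last exact: continuous_const.
    by apply: continuous_sub => [z|]; [exact: cvg_id|exact: continuous_const].
  apply: continuous_mul.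
    apply: continuous_mul; first exact: continuous_const.
    apply: continuous_after; first exact: pospart_continuous.
    by apply: continuous_sub; [exact: continuous_const|exact: continuous_pow].
  apply: continuous_opp; apply: continuous_mul; last exact: continuous_const.
  by apply: continuous_mul; [exact: continuous_const|exact: cr].
have dual s y := @dot_heat_operator _ L L_gt0 bc lam f lam_f kappa B sb _ _ _ _ _
  dphiP cdphi phi0 Lphi Ldphi tpsi bpsi s y.
eexists; split.
- exact: (L2_heat_operator Lphi Ldphi tpsi).
- apply: (le_trans (heat_operator_norm Lphi Ldphi tpsi)).
  apply: (@le_trans _ _ (2 * (32 / eps ^+ 2 * (20 * eps)) +
      2^-1 * (2 * eps ^+ 2 * (18000 / eps ^+ 3)))).
    apply: lerD; rewrite ler_pM2l ?invr_gt0//; apply: ler_pM => //; exact: dot_ge0.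
  rewrite (_ : _ + _ = 19280 / eps); last by field; rewrite gt_eqF.
  by apply: ler_wpM2r; [rewrite invr_ge0 ltW|lra].
- by rewrite dual// time_bump_center mul1r with_images_ge1.
- move=> s y s0 yL [far|far]; rewrite dual//.
    by rewrite time_bump_far// mul0r.
  by rewrite with_images_far ?mulr0.
Qed.

(** A test function orthogonal to all other kernels bounds the distance of
    [K t x] to their span from below. *)
Lemma residual_lower_bound : exists2 c : R, 0 < c &
  forall (t x eps : R) m (s y : 'I_m -> R) (b : 'I_m -> R),
  0 < eps -> eps ^+ 2 <= t -> eps <= L -> x \in `[0, L] ->
  match bc with Dirichlet => eps <= 2 * x /\ eps <= 2 * (L - x) | Neumann => True end ->
  (forall j, 0 <= s j) -> (forall j, y j \in `[0, L]) ->
  (forall j, eps ^+ 2 <= `|s j - t| \/ eps <= `|y j - x|) ->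
  c * eps <= dot leb2 setT (fun z => K t x z - \sum_(j < m) b j * K (s j) (y j) z)
    (fun z => K t x z - \sum_(j < m) b j * K (s j) (y j) z).
Proof.
have N0 : 0 < 20000 :> R by lra.
exists 20000^-1; first by rewrite invr_gt0.
move=> t x eps m s y b e0 et eL xL bcx s0 yL far; set U := fun z => _.
have [h [Lh h2 h1 hfar]] := separating_function e0 et eL xL bcx.
have t0 : 0 <= t by rewrite (le_trans (sqr_ge0 _) et).
have LK := L2_mild_kernel sb (eigenfunction_continuous lam_f) (eigenfunction_orthonormal lam_f).
have Lsum : L2 leb2 setT (fun z => \sum_(j < m) b j * K (s j) (y j) z).
  by apply: L2_sum => // j; apply: L2Z => //; exact: LK.
have LU : L2 leb2 setT U by apply: L2B => //; exact: LK.
have hU : 1 <= dot leb2 setT h U.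
  rewrite dotC /U dotBl//; last exact: LK.
  rewrite dot_suml//; last by move=> j; apply: L2Z => //; exact: LK.
  rewrite big1 ?subr0; first by rewrite dotC.
  by move=> j _; rewrite dotZl//; [rewrite dotC hfar ?mulr0|exact: LK].
have := cauchy_schwarz measurableT Lh LU.
have : 1 <= dot leb2 setT h U ^+ 2 by rewrite exprn_ege1.
move=> le1 /(le_trans le1) le2.
have U0 := dot_ge0 leb2 setT U.
have : 1 <= 20000 / eps * dot leb2 setT U U.
  by rewrite (le_trans le2)// ler_wpM2r.
move: (dot _ _ _ _) U0 N0; move: (20000 : R) => N u _ N0.
by rewrite mulrAC ler_pdivlMr// mul1r [N^-1 * _]mulrC ler_pdivrMr// mulrC.
Qed.

End kernel_separation.

Section min_quantity_comparison.
Context {R : realType} (L : R) (bc : boundary_condition).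
Implicit Types (p q : R * R).

(** In this form the distance is comparable with the increment bound of the
    kernels. *)
Lemma parabolic_dist_sqr p q :
  parabolic_dist p q ^+ 2 = Num.max (Num.sqrt `|p.1 - q.1|) `|p.2 - q.2|.
Proof.
have pow4 (a : R) : 0 <= a -> (a `^ 4^-1) ^+ 2 = Num.sqrt a.
  move=> a0; rewrite -powR_mulrn ?powR_ge0// -powRrM -powR12_sqrt//.
  by congr (_ `^ _); field.
have pow2 (a : R) : 0 <= a -> (a `^ 2^-1) ^+ 2 = a.
  by move=> a0; rewrite powR12_sqrt// sqr_sqrtr.
rewrite /parabolic_dist -(pow4 `|p.1 - q.1|)// -[X in _ = Num.max _ X]pow2//.
move: (powR_ge0 `|p.1 - q.1| 4^-1) (powR_ge0 `|p.2 - q.2| 2^-1).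
move: (_ `^ 4^-1) (_ `^ 2^-1) => a b a0 b0.
have [ab|ba] := leP a b.
  by apply/esym/max_idPr; rewrite lerXn2r.
by apply/esym/max_idPl; rewrite lerXn2r// ltW.
Qed.

Lemma min_quantity_le m p (q : 'I_m -> R * R) :
  [/\ min_quantity L bc p q <= Num.sqrt p.1,
    min_quantity L bc p q <= principal_eigenfunction L bc p.2 &
    forall j, min_quantity L bc p q <= parabolic_dist p (q j) ^+ 2].
Proof.
have h : min_quantity L bc p q <= Num.min (Num.sqrt p.1) (principal_eigenfunction L bc p.2).
  rewrite /min_quantity; elim/big_rec : _ => [//|j v _ h].
  by rewrite ge_min h orbT.
split.
- by rewrite (le_trans h)// ge_min lexx.
- by rewrite (le_trans h)// ge_min lexx orbT.
- by move=> j; rewrite /min_quantity (bigD1 j)//= ge_min lexx.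
Qed.

Lemma le_min_quantity m p (q : 'I_m -> R * R) (X C : R) :
  X <= C * Num.sqrt p.1 -> X <= C * principal_eigenfunction L bc p.2 ->
  (forall j, X <= C * parabolic_dist p (q j) ^+ 2) ->
  X <= C * min_quantity L bc p q.
Proof.
move=> h1 h2 h3; rewrite /min_quantity; elim/big_rec : _ => [|j v _ h].
  exact: le_mul_min.
by apply: le_mul_min.
Qed.

End min_quantity_comparison.

Section principal_bounds.
Context {R : realType} (L : R) (L_gt0 : 0 < L).
Implicit Types x y : R.

Lemma sin_reflection x : sin (pi * (L - x) / L) = sin (pi * x / L).
Proof.
rewrite (_ : pi * (L - x) / L = - (pi * x / L) + pi); last by field; rewrite gt_eqF.
by rewrite sinDpi sinN opprK.
Qed.

Lemma sin_le_id x : 0 <= x -> sin x <= x.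
Proof.
move=> x0; have := sin_lipschitz x 0; rewrite sin0 !subr0 [X in _ <= X]ger0_norm//.
by apply: le_trans; rewrite ler_norm.
Qed.

(** [sin y = 2 * sin (y / 2) * cos (y / 2)], and by the mean value theorem
    [sin z >= z * cos z]; finally [2 * cos (y / 2) ^+ 2 = 1 + cos y >= 1]. *)
Lemma sin_ge_half y : 0 <= y -> y <= pi / 2 -> y / 2 <= sin y.
Proof.
move=> y0 y2; have p0 := pi_gt0 R.
have y20 : 0 <= y / 2 by rewrite divr_ge0.
have [|c] := @MVT_segment _ (@sin R) cos 0 (y / 2) y20 (fun z _ => is_derive_sin z).
  by apply: continuous_subspaceT => z; exact: continuous_sin.
rewrite in_itv/= subr0 sin0 subr0 => /andP[c0 cy] sE.
have cosc : cos (y / 2) <= cos c.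
  move: cy; rewrite le_eqVlt => /orP[/eqP->//|cy].
  by rewrite ltW// ltr_cos// in_itv/=; apply/andP; split; lra.
have cos0 : 0 <= cos (y / 2) by apply: cos_ge0_pihalf; apply/andP; split; lra.
have cosy0 : 0 <= cos y by apply: cos_ge0_pihalf; apply/andP; split; lra.
have yE : y = y / 2 + y / 2 by field.
have : cos y = 2 * cos (y / 2) ^+ 2 - 1.
  by rewrite [in LHS]yE cosD; have := cos2Dsin2 (y / 2); nra.
have -> : sin y = 2 * (sin (y / 2) * cos (y / 2)) by rewrite [in LHS]yE sinD; ring.
rewrite sE => cE.
have : cos (y / 2) * cos (y / 2) <= cos c * cos (y / 2) by rewrite ler_wpM2r.
move: cosc cos0 cosy0 cE; move: (cos c) (cos (y / 2)) (cos y) => u v w.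
move=> uv v0 w0 wE vv; nra.
Qed.

End principal_bounds.

Section kernel_bounds.
Context {R : realType} (L : R) (L_gt0 : 0 < L) (bc : boundary_condition).
Context (lam : nat -> R) (f : nat -> R -> R) (lam_f : eigenpairs L bc lam f).
Local Notation leb := (@lebesgue_measure R).
Local Notation leb2 := (leb \x leb)%E.
Local Notation K := (mild_kernel L lam f).
Local Notation cf := (eigenfunction_continuous lam_f).
Local Notation orth := (eigenfunction_orthonormal lam_f).

Let s2L : 0 < Num.sqrt (2 / L). Proof. by rewrite sqrtr_gt0 divr_gt0. Qed.
Let s1L : 0 < Num.sqrt (1 / L). Proof. by rewrite sqrtr_gt0 divr_gt0. Qed.

(** The residual is bounded below at the scale [eps], a small multiple [c] of the
    minimum. The terms of the minimum say that the bump of radius [eps] vanishes at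
    time [0] and at the other points, and that under the Dirichlet condition its
    negative images vanish at the center. *)
Lemma kernel_lower_bound : exists2 C : R, 0 < C &
  forall m (p : R * R) (q : 'I_m -> R * R) (b : 'I_m -> R),
    0 <= p.1 -> p.2 \in `[0, L] -> (forall j, 0 <= (q j).1) ->
    (forall j, (q j).2 \in `[0, L]) ->
    C * min_quantity L bc p q <=
    dot leb2 setT (fun z => K p.1 p.2 z - \sum_(j < m) b j * K (q j).1 (q j).2 z)
      (fun z => K p.1 p.2 z - \sum_(j < m) b j * K (q j).1 (q j).2 z).
Proof.
have [kappa [B sb]] := eigenpairs_bounds L_gt0 lam_f.
have L0 := L_gt0; have a0 := s2L; have b0 := s1L; have p0 := pi_gt0 R.
(* The second term gives [eps <= L] in the Neumann case. The last one bounds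
   [eps] by twice the distance to the end points in the Dirichlet case, where the
   principal eigenfunction is at most linear in this distance. *)
pose c := Num.min 1 (Num.min (L / Num.sqrt (1 / L)) (2 * L / (Num.sqrt (2 / L) * pi))).
have c0 : 0 < c by rewrite /c !lt_min ltr01 !divr_gt0 ?mulr_gt0.
have c1 : c <= 1 by rewrite /c ge_min lexx.
have cN : c * Num.sqrt (1 / L) <= L.
  by rewrite -ler_pdivlMr// /c !ge_min lexx !orbT.
have cD : c * (Num.sqrt (2 / L) * pi) <= 2 * L.
  by rewrite -ler_pdivlMr ?mulr_gt0// /c !ge_min lexx !orbT.
have [c2 c20 hc2] := residual_lower_bound L_gt0 lam_f sb.
exists (c2 * c); first exact: mulr_gt0.
move=> m p q b t0 xL s0 yL.
have [Mt Mf Mq] := min_quantity_le L bc p q.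
set M := min_quantity L bc p q in Mt Mf Mq *.
have [M0|M0] := leP M 0.
  apply: (le_trans _ (dot_ge0 _ _ _)); by rewrite mulr_ge0_le0// mulr_ge0 ?ltW.
rewrite -mulrA.
have /andP[x0 xL'] : (0 <= p.2) && (p.2 <= L) by move: xL; rewrite in_itv.
have e0 : 0 < c * M by rewrite mulr_gt0.
have eM : c * M <= M by rewrite ler_piMl// ltW.
have le_of v : M <= Num.sqrt v -> (c * M) ^+ 2 <= v.
  move=> h; have v0 : 0 < v by rewrite -sqrtr_gt0 (lt_le_trans M0).
  by rewrite -(sqr_sqrtr (ltW v0)) lerXn2r ?nnegrE ?sqrtr_ge0 ?(ltW e0)// (le_trans eM).
have bcx : match bc with Dirichlet => c * M <= 2 * p.2 /\ c * M <= 2 * (L - p.2) | Neumann => c * M <= L end.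
  move: Mf; rewrite /principal_eigenfunction; case: bc => Mf; last first.
    by rewrite (le_trans _ cN)// ler_pM2l.
  have half y : 0 <= y -> M <= Num.sqrt (2 / L) * sin (pi * y / L) -> c * M <= 2 * y.
    move=> y0 My; have : sin (pi * y / L) <= pi * y / L.
      by apply: sin_le_id; rewrite divr_ge0 ?mulr_ge0 ?(ltW p0) ?(ltW L0).
    move=> sy; apply: (@le_trans _ _ (c * (Num.sqrt (2 / L) * (pi * y / L)))).
      by rewrite ler_pM2l// (le_trans My)// ler_pM2l.
    rewrite (_ : c * _ = c * (Num.sqrt (2 / L) * pi) * (y / L)); last by field; rewrite gt_eqF.
    rewrite (_ : 2 * y = 2 * L * (y / L)); last by field; rewrite gt_eqF.
    by rewrite ler_wpM2r// divr_ge0// ltW.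
  split; first exact: half.
  by apply: half; [lra|rewrite sin_reflection].
apply: hc2 e0 (le_of _ Mt) _ xL _ _ _ _ => //.
- by move: bcx; case: bc => [[]|]//; lra.
- by move: bcx; case: bc.
- move=> j; have := Mq j; rewrite parabolic_dist_sqr le_max => /orP[/le_of|h].
    by rewrite distrC; left.
  by right; rewrite distrC (le_trans eM).
Qed.

(** The field vanishes at time [0], and at the end points under the Dirichlet
    condition: the increment bound then gives the two one-point bounds. *)
Lemma kernel_upper_bound (T : R) : 0 < T -> exists2 C : R, 0 < C &
  forall m (p : R * R) (q : 'I_m -> R * R) (X : R),
    p.1 \in `[0, T] -> p.2 \in `[0, L] ->
    (forall j, (q j).1 \in `[0, T] /\ (q j).2 \in `[0, L]) ->
    X <= dot leb2 setT (K p.1 p.2) (K p.1 p.2) ->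
    (forall j, X <= dot leb2 setT (fun z => K p.1 p.2 z - K (q j).1 (q j).2 z)
      (fun z => K p.1 p.2 z - K (q j).1 (q j).2 z)) ->
    X <= C * min_quantity L bc p q.
Proof.
move=> T0; have [kappa [B sb]] := eigenpairs_bounds L_gt0 lam_f.
have L0 := L_gt0; have a0 := s2L; have b0 := s1L; have p0 := pi_gt0 R.
have [C C0 hC] := mild_kernel_increment sb cf orth T0.
have sT0 : 0 < Num.sqrt T by rewrite sqrtr_gt0.
have D0 : 0 < 2 * L / (Num.sqrt (2 / L) * pi) by rewrite divr_gt0 ?mulr_gt0.
have E0 : 0 < Num.sqrt T / Num.sqrt (1 / L) by rewrite divr_gt0.
set D := 2 * L / _ in D0; set E := Num.sqrt T / _ in E0.
(* [D] comes from comparing the distance to the end points with the Dirichlet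
   principal eigenfunction, [E] from comparing [sqrt T] with the Neumann one. *)
exists (C * (2 + D + E)); first by rewrite mulr_gt0//; lra.
move=> m p q X tT xL qTL XK Xq.
have /andP[x0 xL'] : (0 <= p.2) && (p.2 <= L) by move: xL; rewrite in_itv.
have /andP[t0 tT'] : (0 <= p.1) && (p.1 <= T) by move: tT; rewrite in_itv.
have zT : 0 \in `[0, T] by rewrite in_itv/= lexx ltW.
have zero_diff t x : K t x = (fun=> 0) -> (fun z => K p.1 p.2 z - K t x z) = K p.1 p.2.
  by move=> ->; apply/funext => z; rewrite subr0.
have Kt : X <= C * Num.sqrt p.1.
  apply: (le_trans XK); have := hC 0 p.1 p.2 p.2 zT tT xL xL.
  by rewrite zero_diff ?mild_kernel_time0// subrr normr0 addr0 subr0 ger0_norm.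
have Kx x : x \in `[0, L] -> (forall n, f n x = 0) -> X <= C * `|p.2 - x|.
  move=> xL1 fx; apply: (le_trans XK); have := hC p.1 p.1 p.2 x tT tT xL xL1.
  by rewrite zero_diff ?subrr ?normr0 ?sqrtr0 ?add0r//; exact: mild_kernel_boundary.
have leC v w : 0 <= v -> 0 <= w -> w <= 2 + D + E -> X <= C * (w * v) -> X <= C * (2 + D + E) * v.
  move=> v0 w0 wle h; rewrite (le_trans h)// -mulrA ler_wpM2l ?(ltW C0)//.
  by rewrite ler_wpM2r.
apply: le_min_quantity.
- by apply: (leC _ 1) => //; [lra|rewrite mul1r].
- move: Kx; have [eqf _ _ _] := lam_f; rewrite /principal_eigenfunction.
  case: bc eqf => eqf Kx; last first.
    apply: (leC _ E); rewrite ?sqrtr_ge0 ?(ltW E0)//; first by lra.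
    rewrite divfK ?gt_eqF// (le_trans Kt)// ler_pM2l// ler_wsqrtr//.
  have fend n : f n 0 = 0 /\ f n L = 0 by have [d [_ _ _ _]] := eqf n.
  have half y : 0 <= y -> y <= L / 2 -> y <= D * (Num.sqrt (2 / L) * sin (pi * y / L)).
    move=> y0 yL2; rewrite mulrA /D invfM.
    have : pi * y / L / 2 <= sin (pi * y / L).
      apply: sin_ge_half; first by rewrite divr_ge0 ?mulr_ge0 ?(ltW p0) ?(ltW L0).
      by rewrite -mulrA ler_pM2l// ler_pdivrMr// mulrC.
    rewrite (_ : 2 * L * _ * _ = 2 * L / pi); last first.
      move: (Num.sqrt (2 / L)) (lt0r_neq0 a0) => s sn.
      move: (pi : R) (lt0r_neq0 p0) => P Pn.
      by field; rewrite sn Pn.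
    move=> h; apply: (le_trans _ (ler_wpM2l _ h)).
      rewrite le_eqVlt; apply/orP; left; apply/eqP.
      move: (pi : R) (lt0r_neq0 p0) (lt0r_neq0 L0) => P Pn Ln.
      by field; rewrite Ln Pn.
    by rewrite divr_ge0 ?mulr_ge0 ?(ltW p0) ?(ltW L0).
  have D1 : D <= 2 + D + E by lra.
  have sin0 : 0 <= Num.sqrt (2 / L) * sin (pi * p.2 / L).
    rewrite mulr_ge0 ?(ltW a0)// sin_ge0_pi//.
    rewrite divr_ge0 ?mulr_ge0 ?(ltW p0) ?(ltW L0)//=.
    by rewrite ler_pdivrMr// ler_pM2l.
  apply: (leC _ D) => //; first exact: ltW.
  have [xh|xh] := leP p.2 (L / 2).
    have := Kx 0; rewrite in_itv/= lexx ltW// subr0 ger0_norm// => /(_ erefl) h.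
    rewrite (le_trans (h _))// ?ler_pM2l//; last exact: half.
    by move=> n; have [] := fend n.
  have := Kx L; rewrite in_itv/= lexx ltW// distrC ger0_norm ?subr_ge0// => /(_ erefl) h.
  rewrite (le_trans (h _))// ?ler_pM2l//; last first.
    by rewrite -sin_reflection//; apply: half; lra.
  by move=> n; have [] := fend n.
- move=> j; have [sT yL] := qTL j; rewrite parabolic_dist_sqr.
  apply: (leC _ 2); [by rewrite le_max sqrtr_ge0|by []|lra|].
  apply: (le_trans (Xq j)); apply: (le_trans (hC _ _ _ _ sT tT xL yL)).
  rewrite ler_pM2l// mulr2n mulrDl mul1r; apply: lerD; rewrite le_max lexx ?orbT//.
Qed.

End kernel_bounds.

(** * White noise as an isometry *)

Section isometry.
Context {R : realType} d (T : measurableType d) (mu : {measure set T -> \bar R}).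
Variables (D : set T) (mD : measurable D).

(** A residual has a Gram-matrix expression, so an isometry preserves its norm. *)
Lemma dot_residual m (X : T -> R) (Y : 'I_m -> T -> R) (b : 'I_m -> R) :
  L2 mu D X -> (forall j, L2 mu D (Y j)) ->
  dot mu D (fun x => X x - \sum_(j < m) b j * Y j x) (fun x => X x - \sum_(j < m) b j * Y j x) =
  dot mu D X X - 2 * (\sum_(j < m) b j * dot mu D (Y j) X) +
  \sum_(i < m) b i * (\sum_(j < m) b j * dot mu D (Y j) (Y i)).
Proof.
move=> LX LY; have LbY j : L2 mu D (fun x => b j * Y j x) by exact: L2Z.
have LS : L2 mu D (fun x => \sum_(j < m) b j * Y j x) by apply: L2_sum => // j; exact: LbY.
have dotS Z : L2 mu D Z -> dot mu D (fun x => \sum_(j < m) b j * Y j x) Z =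
    \sum_(j < m) b j * dot mu D (Y j) Z.
  by move=> LZ; rewrite dot_suml//; apply: eq_bigr => j _; exact: dotZl.
rewrite dot_sqrB// dotS//; congr (_ - 2 * _ + _); first by rewrite dotC dotS.
by apply: eq_bigr => i _; rewrite [dot mu D (Y i) _]dotC dotS.
Qed.

Lemma orthogonal_residual_le (U V : T -> R) : L2 mu D U -> L2 mu D V -> dot mu D U V = 0 ->
  dot mu D U U <= dot mu D (fun x => U x + V x) (fun x => U x + V x).
Proof.
move=> LU LV UV; have := dot_sqr_comb mD 1 LU LV.
under [X in dot _ _ X _ = _]eq_fun do rewrite mul1r.
under [X in dot _ _ _ X = _]eq_fun do rewrite mul1r.
by move=> ->; rewrite UV; have := dot_ge0 mu D V; lra.
Qed.

(** The residual minimizes the distance of [X] to the vectors [Z] orthogonal to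
    it, in particular to [0] and to each [Y j]. *)
Lemma orthogonal_sub_le m (X Z : T -> R) (Y : 'I_m -> T -> R) (b : 'I_m -> R) :
  L2 mu D X -> L2 mu D Z -> (forall j, L2 mu D (Y j)) ->
  (forall j, dot mu D (fun x => X x - \sum_(i < m) b i * Y i x) (Y j) = 0) ->
  dot mu D (fun x => X x - \sum_(i < m) b i * Y i x) Z = 0 ->
  dot mu D (fun x => X x - \sum_(i < m) b i * Y i x) (fun x => X x - \sum_(i < m) b i * Y i x) <=
  dot mu D (fun x => X x - Z x) (fun x => X x - Z x).
Proof.
move=> LX LZ LY orthY orthZ; set U := fun x => _ - _ in orthY orthZ *.
have LbY j : L2 mu D (fun x => b j * Y j x) by exact: L2Z.
have LS : L2 mu D (fun x => \sum_(j < m) b j * Y j x) by apply: L2_sum => // j; exact: LbY.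
have LU : L2 mu D U by exact: L2B.
have LV := L2B mD LS LZ.
have := orthogonal_residual_le LU LV.
rewrite [X in X = 0 -> _]dotC (dotBl mD LS LZ LU) dot_suml// [dot mu D Z U]dotC orthZ subr0.
rewrite big1 => [/(_ erefl)|j _]; last by rewrite dotZl// dotC orthY mulr0.
rewrite (_ : (fun x => U x + _) = (fun x => X x - Z x))//.
by apply/funext => x; rewrite /U addrA subrK.
Qed.

End isometry.

Section gaussian_transfer.
Context {R : realType} d (Omega : measurableType d) (P : probability Omega R).

Lemma centered_gaussian_ae (X Y : Omega -> R) : measurable_fun setT X ->
  measurable_fun setT Y -> {ae P, forall om, X om = Y om} ->
  centered_gaussian P X -> centered_gaussian P Y.
Proof.
move=> mX mY XY [s s0 lawX]; exists s => // B mB; rewrite -lawX//.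
have mXB : measurable (X @^-1` B) by rewrite -[X in measurable X]setTI; exact: mX.
have mYB : measurable (Y @^-1` B) by rewrite -[X in measurable X]setTI; exact: mY.
have PE A : measurable A -> P A = (\int[P]_x (\1_A x)%:E)%E.
  by move=> mA; rewrite integral_indic// setIT.
rewrite !PE//.
apply: ae_eq_integral => //.
- by apply/measurable_EFinP; exact: measurable_indic.
- by apply/measurable_EFinP; exact: measurable_indic.
apply: filterS XY => om XYom _; rewrite !indicE.
rewrite (_ : (om \in Y @^-1` B) = (om \in X @^-1` B))//.
by apply/idP/idP; rewrite !inE /= XYom.
Qed.

End gaussian_transfer.

Section noise.
Context {R : realType} (L : R) d (Omega : measurableType d) (P : probability Omega R).
Context (xi : (R * R -> R) -> {RV P >-> R}) (xi_noise : white_noise L xi).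
Local Notation leb := (@lebesgue_measure R).
Local Notation leb2 := (leb \x leb)%E.

Lemma measurable_space_time : measurable (space_time L : set (measurableTypeR R * measurableTypeR R)).
Proof. by apply: measurableX. Qed.

Lemma L2_square_integrable h : L2 leb2 setT h -> square_integrable (space_time L) h.
Proof.
move=> [mh h2]; split; first exact: measurable_funTS.
by apply: integrableS h2 => //; exact: measurable_space_time.
Qed.

Lemma L2_noise h : L2 leb2 setT h -> L2 P setT (xi h).
Proof.
move=> Lh; have sh := L2_square_integrable Lh; split => //.
apply/integrableP; split; first by apply/measurable_EFinP; exact: measurable_funX.
have [_ /(_ h h sh sh)] := xi_noise; rewrite unlock.
have -> : (\int[P]_x `|((xi h x) ^+ 2)%:E| = \int[P]_w (xi h w * xi h w)%:E)%E.
  by apply: eq_integral => om _; rewrite /= ger0_norm ?sqr_ge0// expr2.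
move=> ->; have [_ h2] := sh.
have /integrable_fin_num := h2 => /(_ measurable_space_time).
under eq_integral do rewrite expr2.
by rewrite fin_numE ltey => /andP[].
Qed.

Lemma noise_isometry h g : L2 leb2 setT h -> L2 leb2 setT g ->
  (forall z, z \notin space_time L -> h z = 0) ->
  dot P setT (xi h) (xi g) = dot leb2 setT h g.
Proof.
move=> Lh Lg h0; have sh := L2_square_integrable Lh; have sg := L2_square_integrable Lg.
have [_ /(_ h g sh sg)] := xi_noise; rewrite unlock /dot /Rintegral => ->.
congr fine; rewrite [LHS]integral_mkcond; apply: eq_integral => z _.
by rewrite patchE; case: ifPn => // /h0 ->; rewrite mul0r.
Qed.

Lemma noise0 : {ae P, forall om, xi (fun=> 0) om = 0}.
Proof.
have L0 : L2 leb2 setT (fun=> 0 : R) by exact: L2_0.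
have s0 := L2_square_integrable L0.
have [_ /(_ _ _ s0 s0)] := xi_noise; rewrite unlock => e.
have : (\int[P]_om `|((xi (fun=> 0) om) ^+ 2)%:E| = 0)%E.
  transitivity (\int[P]_om (xi (fun=> 0) om * xi (fun=> 0) om)%:E)%E.
    by apply: eq_integral => om _; rewrite /= ger0_norm ?sqr_ge0// expr2.
  by rewrite e; under eq_integral do rewrite mul0r; rewrite integral0.
move/ae_eq_integral_abs => /(_ measurableT); have h : measurable_fun setT (fun om => ((xi (fun=> 0) om) ^+ 2)%:E).
  by apply/measurable_EFinP; exact: measurable_funX.
move=> /(_ h); apply: filterS => om /(_ I) [] /eqP.
by rewrite sqrf_eq0 => /eqP.
Qed.

End noise.

(** * The conditional variance of the field *)

Section stochastic_heat_equation.
Context {R : realType} (L : R) (L_gt0 : 0 < L) (bc : boundary_condition).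
Context (lam : nat -> R) (f : nat -> R -> R) (lam_f : eigenpairs L bc lam f).
Context d (Omega : measurableType d) (P : probability Omega R).
Context (xi : (R * R -> R) -> {RV P >-> R}) (xi_noise : white_noise L xi).
Context (w : R -> R -> {RV P >-> R}) (w_mild : mild_solution L lam f xi w).
Local Notation leb := (@lebesgue_measure R).
Local Notation leb2 := (leb \x leb)%E.
Local Notation K := (mild_kernel L lam f).

Lemma L2_kernel t x : 0 <= t -> x \in `[0, L] -> L2 leb2 setT (K t x).
Proof.
have [kappa [B sb]] := eigenpairs_bounds L_gt0 lam_f.
exact: L2_mild_kernel sb (eigenfunction_continuous lam_f) (eigenfunction_orthonormal lam_f) _ _.
Qed.

Lemma mild_kernel_outside t x z : z \notin space_time L -> K t x z = 0.
Proof.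
move=> zn; rewrite /mild_kernel patchE memNset// => -[zt zL]; move/negP: zn; apply.
rewrite inE; split => //=; move: zt; rewrite /= !in_itv/= => /andP[z0 _].
by rewrite (ltW z0).
Qed.

(** At time [0] the kernel vanishes, and the noise of the zero function is null
    almost surely. *)
Lemma field_eq_noise t x : 0 <= t -> x \in `[0, L] ->
  {ae P, forall om, w t x om = xi (K t x) om}.
Proof.
move=> t0 xL; have [w0 wt] := w_mild xL; move: t0; rewrite le_eqVlt => /orP[/eqP<-|]; last exact: wt.
have n0 := noise0 xi_noise; rewrite mild_kernel_time0.
by apply: filterS2 w0 n0 => om -> ->.
Qed.

Lemma L2_field t x : 0 <= t -> x \in `[0, L] -> L2 P setT (w t x).
Proof.
move=> t0 xL; apply: (L2_ae measurableT _ _ (L2_noise xi_noise (L2_kernel t0 xL))) => //.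
by apply: filterS (field_eq_noise t0 xL) => om ->.
Qed.

Lemma field_covariance t x s y : 0 <= t -> x \in `[0, L] -> 0 <= s -> y \in `[0, L] ->
  dot P setT (w t x) (w s y) = dot leb2 setT (K t x) (K s y).
Proof.
move=> t0 xL s0 yL.
rewrite -(noise_isometry xi_noise (L2_kernel t0 xL) (L2_kernel s0 yL)); last first.
  by move=> z; exact: mild_kernel_outside.
apply: eq_Rintegral_ae => //; [exact: measurable_funM|exact: measurable_funM|].
by apply: filterS2 (field_eq_noise t0 xL) (field_eq_noise s0 yL) => om -> ->.
Qed.

Lemma field_gaussian m (p : R * R) (q : 'I_m -> R * R) (u : R) (a : 'I_m -> R) :
  0 <= p.1 -> p.2 \in `[0, L] -> (forall j, 0 <= (q j).1 /\ (q j).2 \in `[0, L]) ->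
  centered_gaussian P (fun om => u * w p.1 p.2 om + \sum_(j < m) a j * w (q j).1 (q j).2 om).
Proof.
move=> t0 xL qL.
pose pt (i : 'I_m.+1) := if unlift ord0 i is Some j then q j else p.
pose c (i : 'I_m.+1) := if unlift ord0 i is Some j then a j else u.
have ptL i : 0 <= (pt i).1 /\ (pt i).2 \in `[0, L].
  by rewrite /pt; case: unliftP => [j _|_] //; exact: qL.
have [/(_ m.+1 (fun i => K (pt i).1 (pt i).2) c) gauss _] := xi_noise.
apply: centered_gaussian_ae (gauss _); last first.
- by move=> i; have [? ?] := ptL i; apply: L2_square_integrable; exact: L2_kernel.
- have : {ae P, forall om, forall i, w (pt i).1 (pt i).2 om = xi (K (pt i).1 (pt i).2) om}.
    have aeI (s : seq 'I_m.+1) : {ae P, forall om, forall i, i \in s ->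
        w (pt i).1 (pt i).2 om = xi (K (pt i).1 (pt i).2) om}.
      elim: s => [|i s ih]; first by apply: aeW.
      have [? ?] := ptL i.
      apply: filterS2 ih (@field_eq_noise (pt i).1 (pt i).2 _ _) => // om h1 h2 k.
      by rewrite inE => /orP[/eqP->//|]; exact: h1.
    by apply: filterS (aeI (enum 'I_m.+1)) => om h i; apply: h; rewrite mem_enum.
  apply: filterS => om h; under eq_bigr do rewrite -h.
  rewrite big_ord_recl /c /pt unlift_none; congr (_ + _).
  by apply: eq_bigr => j _; rewrite liftK.
- apply: measurable_funD; first exact: measurable_funM.
  by apply: measurable_sum => j; exact: measurable_funM.
- by apply: measurable_sum => j; exact: measurable_funM.
Qed.

End stochastic_heat_equation.

Theorem lemma3p6 (R : realType) (L : R) (L_gt0 : 0 < L)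
  (bc : boundary_condition) (lam : nat -> R) (f : nat -> R -> R)
  (lam_f : eigenpairs L bc lam f)
  (d : measure_display) (Omega : measurableType d) (P : probability Omega R)
  (xi : (R * R -> R) -> {RV P >-> R}) (xi_noise : white_noise L xi)
  (w : R -> R -> {RV P >-> R}) (w_mild : mild_solution L lam f xi w)
  (T : R) (T_gt0 : 0 < T) :
  exists C1 C2 : R, [/\ 0 < C1, 0 < C2 &
    forall (m : nat) (p : R * R) (q : 'I_m -> R * R), (0 < m)%N ->
      p.1 \in `[0, T] -> p.2 \in `[0, L] ->
      (forall j, (q j).1 \in `[0, T] /\ (q j).2 \in `[0, L]) ->
      {ae P, forall om,
        C1 * min_quantity L bc p q <=
          conditional_variance P (w p.1 p.2)
            (fun j => w (q j).1 (q j).2 : Omega -> R) om <=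
          C2 * min_quantity L bc p q}].
Proof.
have [C1 C10 low] := kernel_lower_bound L_gt0 lam_f.
have [C2 C20 up] := kernel_upper_bound L_gt0 lam_f T_gt0.
exists C1, C2; split => // m p q _ tT xL qTL.
have t0 : 0 <= p.1 by rewrite (itvP tT).
have s0 j : 0 <= (q j).1 by have [h _] := qTL j; rewrite (itvP h).
have yL j : (q j).2 \in `[0, L] by have [] := qTL j.
pose X : Omega -> R := w p.1 p.2.
pose Y j : Omega -> R := w (q j).1 (q j).2.
have LX : L2 P setT X := L2_field L_gt0 lam_f xi_noise w_mild t0 xL.
have LY j : L2 P setT (Y j) := L2_field L_gt0 lam_f xi_noise w_mild (s0 j) (yL j).
have LKX := L2_kernel L_gt0 lam_f t0 xL.
have LKY j := L2_kernel L_gt0 lam_f (s0 j) (yL j).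
have cov := field_covariance L_gt0 lam_f xi_noise w_mild.
have [b orthU] := exists_projection measurableT LX LY.
have gauss u a := field_gaussian L_gt0 lam_f xi_noise w_mild u a t0 xL (fun j => conj (s0 j) (yL j)).
have := gaussian_conditional_variance LX LY gauss orthU.
apply: filterS => om ->.
apply/andP; split.
- rewrite (dot_residual measurableT b LX LY) cov//.
  under eq_bigr do rewrite cov//.
  under [X in _ + X]eq_bigr do under eq_bigr do rewrite cov//.
  rewrite -(dot_residual measurableT b LKX LKY).
  exact: low.
- apply: (up m p q) => //.
    rewrite -cov//; apply: (le_trans (orthogonal_sub_le measurableT LX (L2_0 _ _) LY orthU _)).
      by rewrite dotC dot0l.
    by under [leLHS]eq_Rintegral do rewrite !subr0.
  move=> j; apply: (le_trans (orthogonal_sub_le measurableT LX (LY j) LY orthU (orthU j))).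
  by rewrite (dot_sqrB measurableT LX (LY j)) (dot_sqrB measurableT LKX (LKY j)) !cov.
Qed.
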